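(* Let $\omega=\sqrt{-1}$ and let $M_i(G_i(t))$, $i=1,\dots,q$, be the components of the multivariate generalized counting process time-changed by an independent multivariate gamma subordinator, with parameters $q$, $k_i$, $\lambda_{ij_i}$, $\lambda$, $\theta$, $a_i$ as in the context. Then for all $i,l\in\{1,\dots,q\}$ and $t\ge0$, $$\operatorname{Cov}(M_i(G_i(t)),M_l(G_l(t)))=\sum_{j_i=1}^{k_i}j_i^2\lambda_{ij_i}\frac{\lambda t}{a_i(1-\theta)}\mathbb{I}_{\{i=l\}}+\sum_{j_i=1}^{k_i}\sum_{j_l=1}^{k_l}j_ij_l\frac{\lambda_{ij_i}\lambda_{lj_l}\lambda t}{a_ia_l(1-\theta)^2}\big(\theta\, \mathbb{I}_{\{i\ne l\}}+\mathbb{I}_{\{i=l\}}\big)$$ and the codifference is $$\tau(M_i(G_i(t)),M_l(G_l(t)))=\lambda t\ln \Big(\frac{a_ia_l(1-\theta)}{(a_i-c_i)(a_l-c_l)-\theta a_ia_l}\Big)\mathbb{I}_{\{i\ne l\}}-\lambda t \ln \Big( \frac{a_ia_l(1-\theta)^2}{(a_i(1-\theta)-c_i)(a_l(1-\theta)-c_l)}\Big),$$ where $c_i=-\sum_{j_i=1}^{k_i}\lambda_{ij_i}(1-e^{\omega j_i})$ (the quantity attached to the first argument), $c_l=-\sum_{j_l=1}^{k_l}\lambda_{lj_l}(1-e^{-\omega j_l})$ (the quantity attached to the second argument), $\mathbb{I}$ is the indicator, and $\ln$ on the right-hand side is the principal logarithm.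
   Context: Multivariate GCP: let $q\in\mathbb{N}$, $k_1,\dots,k_q\in\mathbb{N}$ and $\lambda_{ij_i}>0$ for $1\le i\le q$, $1\le j_i\le k_i$. $\bar M(t)=(M_1(t),\dots,M_q(t))$ has independent components, where $\{M_i(t)\}_{t\ge0}$ is a generalized counting process (GCP): the Lévy process started at $0$ performing independent jumps of sizes $j_i=1,\dots,k_i$ with rates $\lambda_{ij_i}$; equivalently $\mathbb{E}(u^{M_i(t)})=\exp\big(-t\sum_{j_i=1}^{k_i}\lambda_{ij_i}(1-u^{j_i})\big)$, $|u|\le1$. Multivariate gamma subordinator: let $\lambda>0$, $0<\theta<1$, $a_1,\dots,a_q>0$. $\{Z_i(t)\}_{t\ge0}$ are gamma Lévy processes with $Z_i(t)\sim\Gamma(\lambda t,a_i)$ (shape $\lambda t$, rate $a_i$), $\{B^-(\lambda t)\}_{t\ge0}$ is a negative binomial Lévy process with $\Pr\{B^-(\lambda t)=n\}=(1-\theta)^{\lambda t}\binom{n+\lambda t-1}{n}\theta^n$, $n\ge0$, and $Z_1,\dots,Z_q,B^-$ are mutually independent. $\bar G(t)=(G_1(t),\dots,G_q(t))$ with $G_i(t)=Z_i(t+\lambda^{-1}B^-(\lambda t))$. The processes $\{\bar M(t)\}$ and $\{\bar G(t)\}$ are independent. The codifference of real random variables $X,Y$ is $\tau(X,Y)=\ln\mathbb{E}(e^{\omega(X-Y)})-\ln\mathbb{E}(e^{\omega X})-\ln\mathbb{E}(e^{-\omega Y})$. Here, for a random variable $W$ whose characteristic function has no zeros, $\ln\mathbb{E}(e^{\omega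 W})$ is the value at $u=1$ of the unique continuous function $\psi:[0,1]\to\mathbb{C}$ with $\psi(0)=0$ and $e^{\psi(u)}=\mathbb{E}(e^{\omega uW})$ (the distinguished logarithm). *)

(* Defs.v *)
From HB Require Import structures.
From mathcomp Require Import all_boot all_order all_algebra.
From mathcomp Require Import all_classical all_reals all_analysis.
From mathcomp Require Import complex.

Set Implicit Arguments.
Unset Strict Implicit.
Unset Printing Implicit Defensive.

Import Order.TTheory GRing.Theory Num.Theory.
Import numFieldNormedType.Exports.

Local Open Scope classical_set_scope.
Local Open Scope complex_scope.
Local Open Scope ring_scope.

Section complex_functions.
Context {R : realType}.

Definition cexp (z : R[i]) : R[i] :=
  let: x +i* y := z in (expR x * cos y) +i* (expR x * sin y).

Definition cmod (z : R[i]) : R :=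
  let: x +i* y := z in Num.sqrt (x ^+ 2 + y ^+ 2).

(* principal value, in ]-pi, pi] (for z != 0) *)
Definition carg (z : R[i]) : R :=
  let: x +i* y := z in
  if 0 <= y then acos (x / cmod z) else - acos (x / cmod z).

Definition cln (z : R[i]) : R[i] := ln (cmod z) +i* carg z.

Definition is_distinguished_log (phi psi : R -> R[i]) :=
  [/\ {within `[0, 1], continuous (fun u => complex.Re (psi u))},
      {within `[0, 1], continuous (fun u => complex.Im (psi u))},
      psi 0 = 0 &
      forall u, 0 <= u <= 1 -> cexp (psi u) = phi u].

(* psi u for u in [0, 1] does not depend on the choice of psi; the value is 0
   by convention when there is no such psi. *)
Definition distinguished_ln (phi : R -> R[i]) : R[i] :=
  xget 0 [set z | exists2 psi, is_distinguished_log phi psi & z = psi 1].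

End complex_functions.

Section probability_notions.
Context d (T : measurableType d) (R : realType) (P : probability T R).

Definition cexpectation (f : T -> R[i]) : R[i] :=
  fine 'E_P[fun w => complex.Re (f w)] +i* fine 'E_P[fun w => complex.Im (f w)].

Definition char_fun (W : T -> R) (u : R) : R[i] :=
  cexpectation (fun w => cexp ('i%C * (u * W w)%:C)).

Definition codifference (X Y : T -> R) : R[i] :=
  distinguished_ln (char_fun (fun w => X w - Y w))
  - distinguished_ln (char_fun X)
  - distinguished_ln (char_fun (fun w => - Y w)).

Definition mutually_independent (I : finType) (F : I -> set (set T)) :=
  forall (J : {set I}) (A : I -> set T),
    (forall i, i \in J -> F i (A i)) ->
    P (\bigcap_(i in [set` J]) A i) = (\prod_(i in J) P (A i))%E.

Definition independent (F G : set (set T)) :=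
  forall A B, F A -> G B -> P (A `&` B) = (P A * P B)%E.

Definition generated_sigma_algebra (J : Type) (D : set J) (X : J -> T -> R) :
    set (set T) :=
  <<s [set A | exists2 j, D j &
               exists2 B : set R, measurable B & A = X j @^-1` B] >>.

Definition sigma_process (X : R -> T -> R) : set (set T) :=
  generated_sigma_algebra [set t | 0 <= t] X.

Definition sigma_mprocess (I : Type) (X : I -> R -> T -> R) : set (set T) :=
  generated_sigma_algebra [set p : I * R | 0 <= p.2] (fun p => X p.1 p.2).

(* Processes are indexed by R, but only their values at times t >= 0 matter. *)

Definition cadlag (x : R -> R) :=
  (forall t, 0 <= t -> x s @[s --> t^'+] --> x t) /\
  (forall t, 0 < t -> cvg (x s @[s --> t^'-])).

(* Stochastic continuity is not listed: it follows from the right-continuity of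
   the paths and the stationarity of the increments. *)
Definition levy_process (X : R -> T -> R) :=
  [/\ forall t, 0 <= t -> measurable_fun [set: T] (X t),
      {ae P, forall w, X 0 w = 0},
      forall (n : nat) (s : nat -> R), 0 <= s 0 -> {homo s : m p / (m <= p)%N >-> m <= p} ->
        mutually_independent (fun m : 'I_n =>
          generated_sigma_algebra [set: unit]
            (fun _ w => X (s m.+1) w - X (s m) w)),
      forall s t (A : set R), 0 <= s -> 0 <= t -> measurable A ->
        P [set w | A (X (s + t) w - X s w)] = P (X t @^-1` A) &
      forall w, cadlag (X^~ w)].

(* Generalized counting process with jump sizes 1, ..., k, the size j having
   rate lam j; it is characterized by its probability generating function. *)
Definition gcp (k : nat) (lam : nat -> R) (M : R -> T -> nat) :=
  levy_process (fun t w => (M t w)%:R) /\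
  forall t (u : R[i]), 0 <= t -> `|u| <= 1 ->
    cexpectation (fun w => u ^+ M t w) =
    cexp (- t%:C * \sum_(1 <= j < k.+1) (lam j)%:C * (1 - u ^+ j)).

Definition gamma_function (s : R) : R :=
  \int[lebesgue_measure]_(x in `]0, +oo[) (x `^ (s - 1) * expR (- x)).

Definition gamma_pdf (s a x : R) : R :=
  if 0 < x then a `^ s / gamma_function s * x `^ (s - 1) * expR (- (a * x))
  else 0.

(* Gamma Lévy process, as a subordinator (its state space is [0, +oo[), with
   Z t of law Gamma(lambda t, a); at t = 0 this law degenerates to the point
   mass at 0, which is already part of [levy_process]. *)
Definition gamma_process (lambda a : R) (Z : R -> T -> R) :=
  [/\ levy_process Z,
      forall t w, 0 <= t -> 0 <= Z t w &
      forall t (A : set R), 0 < t -> measurable A ->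
        P (Z t @^-1` A) =
        (\int[lebesgue_measure]_(x in A) (gamma_pdf (lambda * t) a x)%:E)%E].

(* Binomial coefficient (r choose n) = r (r - 1) ... (r - n + 1) / n!, r real *)
Definition real_binomial (r : R) (n : nat) : R :=
  (\prod_(m < n) (r - m%:R)) / n`!%:R.

Definition negative_binomial_process (theta : R) (B : R -> T -> nat) :=
  levy_process (fun t w => (B t w)%:R) /\
  forall t n, 0 <= t ->
    P [set w | B t w = n] =
    ((1 - theta) `^ t * real_binomial (n%:R + t - 1) n * theta ^+ n)%:E.

Definition multivariate_gcp (q : nat) (k : 'I_q -> nat) (lam : 'I_q -> nat -> R)
    (M : 'I_q -> R -> T -> nat) :=
  (forall i, gcp (k i) (lam i) (M i)) /\
  mutually_independent (fun i => sigma_process (fun t w => (M i t w)%:R)).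

Definition gamma_subordinator_data (q : nat) (lambda theta : R) (a : 'I_q -> R)
    (Z : 'I_q -> R -> T -> R) (B : R -> T -> nat) :=
  [/\ forall i, gamma_process lambda (a i) (Z i),
      negative_binomial_process theta B &
      mutually_independent (fun o : option 'I_q =>
        if o is Some i then sigma_process (Z i)
        else sigma_process (fun t w => (B t w)%:R))].

Definition gamma_subordinator (q : nat) (lambda : R) (Z : 'I_q -> R -> T -> R)
    (B : R -> T -> nat) (i : 'I_q) (t : R) (w : T) : R :=
  Z i (t + lambda^-1 * (B (lambda * t) w)%:R) w.

Definition time_changed (q : nat) (M : 'I_q -> R -> T -> nat)
    (G : 'I_q -> R -> T -> R) (i : 'I_q) (t : R) (w : T) : R :=
  (M i (G i t w) w)%:R.

End probability_notions.

(* Main.v *)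
(** The pair M_i(G_i(t)), M_l(G_l(t)) is approximated by freezing the clocks at
    the next multiple of 1/(n+1): the paths being right-continuous, independence
    of M and G gives
      E[u1^M_i(G_i) u2^M_l(G_l)] = E[exp(c_i(u1) G_i + c_l(u2) G_l)]
    in the limit. Conditioning on B^-(lambda t) = n turns the right-hand side
    into a negative binomial mixture of gamma transforms
    exp(s (ln a - clog(a - c))), and the binomial series sums it to
    exp(lambda t K) for an explicit continuous exponent K.

    Along u -> exp(i u), exp K is a positive multiple of 1/w(u), where w is a
    product of two numbers of the right half-plane, or such a product minus a
    real number smaller than the product of lower bounds of the real parts;
    hence w avoids ]-oo, 0], the curve K stays in the strip |Im| < pi, and the
    distinguished logarithm is lambda t times a principal logarithm.

    For the covariance, u -> 1- in (1 - u^X)/(1 - u) and its second-order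
    analogues, by monotone convergence on the side of M(G) and by dominated
    convergence on the side of the Laplace transform of G, expresses the moments
    of M(G) by those of G. The latter follow from
    (r + n) p_r(n) = r/(1 - theta) p_(r+1)(n) for the negative binomial weights. *)

Require Import Defs.
From HB Require Import structures.
From mathcomp Require Import all_boot all_order all_algebra.
From mathcomp Require Import all_classical all_reals all_analysis.
From mathcomp Require Import measurable_realfun complex zify ring lra.

Set Implicit Arguments.
Unset Strict Implicit.
Unset Printing Implicit Defensive.

Import Order.TTheory GRing.Theory Num.Theory.
Import numFieldNormedType.Exports.

Local Open Scope classical_set_scope.
Local Open Scope complex_scope.
Local Open Scope ring_scope.

(** All analysis is real: complex functions go through real and imaginary parts, and the two complex
    power series are summed along the segment v z, 0 <= v <= 1, by checking that the sum times the
    expected inverse has zero derivative in v. Every logarithm met on the way is taken at a point of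
    positive real part (a - c, 1 - theta e^K), so the smooth [clog] suffices; the principal [cln]
    enters only when the final formulas are matched. For |c| > a the expansion of E[exp(c Z)] in the
    moments of Z diverges. It is recentred at a real point A, chosen so that |A - (a - c)| < A.
    Facts on the Gamma function are extracted from the hypothesis that the density has mass 1, which
    forces Gamma(s) to be finite and positive. Independence is used in the single form P(E, X in A,
    Y in B) = P(E) P(X in A) P(Y in B), with E either {B = n} or a cell of the clocks. A constant Y
    gives the one-component statements, which are all that i = l requires: there the covariance is a
    variance and the difference in the codifference is zero. *)

Section complex_exponential.
Context {R : realType}.
Implicit Types z w : R[i].

(** * Complex arithmetic in coordinates, exponential and logarithms *)

Lemma ReM z w :
  complex.Re (z * w) = complex.Re z * complex.Re w - complex.Im z * complex.Im w.
Proof. by case: z w => [? ?] [? ?]. Qed.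

Lemma ImM z w :
  complex.Im (z * w) = complex.Re z * complex.Im w + complex.Im z * complex.Re w.
Proof. by case: z w => [? ?] [? ?]. Qed.

Lemma ReD z w : complex.Re (z + w) = complex.Re z + complex.Re w.
Proof. by case: z w => [? ?] [? ?]. Qed.

Lemma ImD z w : complex.Im (z + w) = complex.Im z + complex.Im w.
Proof. by case: z w => [? ?] [? ?]. Qed.

Lemma ReN z : complex.Re (- z) = - complex.Re z.
Proof. by case: z. Qed.

Lemma ImN z : complex.Im (- z) = - complex.Im z.
Proof. by case: z. Qed.

Lemma ReV z : complex.Re z^-1 =
  complex.Re z / (complex.Re z ^+ 2 + complex.Im z ^+ 2).
Proof. by case: z. Qed.

Lemma ImV z : complex.Im z^-1 =
  - complex.Im z / (complex.Re z ^+ 2 + complex.Im z ^+ 2).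
Proof. by case: z => a b /=; rewrite mulNr. Qed.

Lemma complex_eq z w : complex.Re z = complex.Re w ->
  complex.Im z = complex.Im w -> z = w.
Proof. by case: z w => [? ?] [? ?] /= -> ->. Qed.

Lemma cexpE z : cexp z = (expR (complex.Re z) * cos (complex.Im z))
  +i* (expR (complex.Re z) * sin (complex.Im z)).
Proof. by case: z. Qed.

Lemma cexpD z w : cexp (z + w) = cexp z * cexp w.
Proof.
rewrite !cexpE ReD ImD expRD cosD sinD.
by apply: complex_eq; rewrite ?ReM ?ImM /=; ring.
Qed.

Lemma cexp0 : cexp (0 : R[i]) = 1.
Proof. by rewrite cexpE /= expR0 cos0 sin0 mul1r mulr0. Qed.

Lemma cexp_real (x : R) : cexp x%:C = (expR x)%:C.
Proof. by rewrite cexpE /= cos0 sin0 mulr1 mulr0. Qed.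

Lemma cexpN z : cexp (- z) = (cexp z)^-1.
Proof.
have e1 : cexp (- z) * cexp z = 1 by rewrite -cexpD addNr cexp0.
have nz : cexp z != 0.
  by apply/eqP => e0; move/eqP: e1; rewrite e0 mulr0 eq_sym oner_eq0.
by rewrite -[LHS](mulfK nz) e1 mul1r.
Qed.

Lemma cexp_neq0 z : cexp z != 0.
Proof.
apply/eqP => e0; have := cexp0.
by rewrite -(addrN z) cexpD e0 mul0r => /eqP; rewrite eq_sym oner_eq0.
Qed.

Lemma cexpMn n z : cexp (n%:R * z) = cexp z ^+ n.
Proof.
elim: n => [|n ih]; first by rewrite mul0r cexp0 expr0.
by rewrite -addn1 natrD mulrDl mul1r cexpD ih exprD expr1.
Qed.

Lemma cmodE z : cmod z = Num.sqrt (complex.Re z ^+ 2 + complex.Im z ^+ 2).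
Proof. by case: z. Qed.

Lemma cmod_cexp z : cmod (cexp z) = expR (complex.Re z).
Proof.
rewrite cmodE cexpE /=.
by rewrite !exprMn -mulrDr cos2Dsin2 mulr1 sqrtr_sqr ger0_norm ?expR_ge0.
Qed.

(** On ]-pi, pi[ the sine has the sign of its argument, so the sign test in [carg] picks the right
    branch: [acos (cos y)] is y for y >= 0 and - y for y < 0. *)
Lemma cln_cexp z : - pi < complex.Im z < pi -> cln (cexp z) = z.
Proof.
move=> /andP[h1 h2].
have ep : 0 < expR (complex.Re z) by exact: expR_gt0.
rewrite /cln cmod_cexp expRK.
apply: complex_eq => //=.
rewrite /carg cexpE -cexpE cmod_cexp.
rewrite mulrAC divff ?mul1r ?gt_eqF//.
rewrite pmulr_rge0//.
have [y0|y0] := leP 0 (complex.Im z).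
  rewrite sin_ge0_pi ?y0 ?ltW//= cosK// in_itv/= y0 ltW//.
have -> : (0 <= sin (complex.Im z)) = false.
  apply/negbTE; rewrite -ltNge -oppr_gt0 -sinN.
  by apply: sin_gt0_pi; rewrite oppr_gt0 y0 ltrNl.
by rewrite cosKN ?opprK// !ltW.
Qed.

(* Unlike [cln], a smooth expression; correct only on the right half-plane. *)
Definition clog z : R[i] :=
  (ln (complex.Re z ^+ 2 + complex.Im z ^+ 2) / 2)
  +i* atan (complex.Im z / complex.Re z).

(** Positivity of the real part x simplifies [Num.sqrt (x ^+ 2)] to x in cos (atan (y / x)) = x /
    |z|; the sine is then recovered from tan = y / x. *)
Lemma clogK z : 0 < complex.Re z -> cexp (clog z) = z.
Proof.
move=> x0; rewrite cexpE /clog /=.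
set x := complex.Re z; set y := complex.Im z.
have xn0 : x != 0 by rewrite gt_eqF.
have s0 : 0 < x ^+ 2 + y ^+ 2.
  by rewrite ltr_wpDr ?sqr_ge0// exprn_gt0.
have -> : expR (ln (x ^+ 2 + y ^+ 2) / 2) = Num.sqrt (x ^+ 2 + y ^+ 2).
  rewrite -powR12_sqrt ?ltW// /powR gt_eqF// mulrC//.
have c0 : cos (atan (y / x)) = x / Num.sqrt (x ^+ 2 + y ^+ 2).
  rewrite cos_atan expr_div_n.
  have -> : 1 + y ^+ 2 / x ^+ 2 = (x ^+ 2 + y ^+ 2) / x ^+ 2.
    by rewrite mulrDl divff// expf_neq0.
  rewrite sqrtrM ?ltW// sqrtrV ?sqr_ge0// sqrtr_sqr gtr0_norm//.
  by rewrite invfM invrK mulrC.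
have sq0 : Num.sqrt (x ^+ 2 + y ^+ 2) != 0 by rewrite sqrtr_eq0 -ltNge.
have -> : sin (atan (y / x)) = y / Num.sqrt (x ^+ 2 + y ^+ 2).
  have := atanK (y / x); rewrite /tan => /(canRL (divfK _)) -> .
    by rewrite c0; field; rewrite sq0 xn0.
  by rewrite c0 mulf_neq0 ?invr_eq0.
rewrite c0; apply: complex_eq; rewrite /= -/x -/y; by field.
Qed.

Lemma clog1 : clog 1 = 0.
Proof.
by rewrite /clog /= expr0n addr0 expr1n ln1 !mul0r atan0.
Qed.

Lemma clog_real (x : R) : 0 < x -> clog x%:C = (ln x)%:C.
Proof.
move=> x0; rewrite /clog /= expr0n addr0 lnXn// mul0r atan0.
by congr (_ +i* _); rewrite mulr2n; field.
Qed.

End complex_exponential.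

(** * Distinguished logarithm against principal logarithm *)

Section distinguished_logarithm.
Context {R : realType}.

(* A continuous curve of logarithms starting at 0 cannot leave the strip
   |Im| < pi without its exponential crossing ]-oo, 0]. *)
Lemma cln_path (psi : R -> R[i]) :
  {within `[0, 1], continuous (fun u => complex.Im (psi u))} ->
  psi 0 = 0 ->
  (forall u, 0 <= u <= 1 -> complex.Im (cexp (psi u)) = 0 ->
     0 < complex.Re (cexp (psi u))) ->
  cln (cexp (psi 1)) = psi 1.
Proof.
move=> cpsi psi0 hneg; apply: cln_cexp.
have pi0 : 0 < pi :> R by exact: pi_gt0.
(* Where the imaginary part reaches pi or - pi the cosine is -1, so the exponential is a negative
   real number, which [hneg] forbids. *)
have hpi v : v = pi \/ v = - pi ->
    (exists2 u : R, u \in `[0, 1] & complex.Im (psi u) = v) -> False.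
  move=> hv [u]; rewrite in_itv/= => u01 uv.
  have := hneg _ u01; rewrite cexpE /= uv.
  have -> : sin v = 0 by case: hv => ->; rewrite ?sinN sinpi ?oppr0.
  have -> : cos v = -1 by case: hv => ->; rewrite ?cosN cospi.
  rewrite mulr0 mulrN1 oppr_gt0 => /(_ erefl).
  by rewrite ltNge expR_ge0.
(* The imaginary part is 0 at u = 0; if it were outside ]-pi, pi[ at u = 1, the intermediate value
   theorem would produce a forbidden value. *)
have ivt v := @IVT R (fun u => complex.Im (psi u)) 0 1 v ler01 cpsi.
rewrite /= psi0 /= in ivt.
apply/andP; split; rewrite ltNge; apply/negP => h.
  apply: (hpi (- pi)); first by right.
  by apply: ivt; rewrite ge_min le_max h oppr_le0 (ltW pi0) /= orbT.
apply: (hpi pi); first by left.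
by apply: ivt; rewrite ge_min le_max h (ltW pi0) /= orbT.
Qed.

(** The difference of two such logarithms is a continuous curve from 0 with exponential 1 on [0, 1];
    [cln_path] equates its endpoint with [cln 1], which is 0. *)
Lemma is_distinguished_log_unique (phi psi1 psi2 : R -> R[i]) :
  is_distinguished_log phi psi1 -> is_distinguished_log phi psi2 ->
  psi1 1 = psi2 1.
Proof.
move=> [_ ci1 p10 e1] [_ ci2 p20 e2].
have := @cln_path (fun u => psi1 u - psi2 u) _ _ _.
have expB u : 0 <= u <= 1 -> cexp (psi1 u - psi2 u) = 1.
  move=> u01; rewrite cexpD cexpN e1// e2// divff//.
  by rewrite -(e1 _ u01) cexp_neq0.
rewrite expB ?ler01 ?lexx//.
have -> : cln (1 : R[i]) = 0.
  by rewrite -cexp0 cln_cexp//= oppr_lt0 pi_gt0.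
move=> /(_ _ _ _)/eqP; rewrite eq_sym subr_eq0 => h; apply/eqP/h.
- have -> : (fun u => complex.Im (psi1 u - psi2 u)) =
      (fun u => complex.Im (psi1 u) - complex.Im (psi2 u)).
    by apply/funext => u; rewrite ImD ImN.
  move=> x; apply: continuousB; [exact: ci1|exact: ci2].
- by rewrite p10 p20 subrr.
- by move=> u u01 _; rewrite expB.
Qed.

Lemma distinguished_lnE (phi psi : R -> R[i]) :
  is_distinguished_log phi psi -> distinguished_ln phi = psi 1.
Proof.
move=> h; rewrite /distinguished_ln; case: xgetP => [z _ /= [psi' h' ->]|].
  exact: is_distinguished_log_unique h' h.
by move=> /(_ (psi 1)) []; exists psi.
Qed.

(** With z = a + i b and w = c + i e one has a Re(z w) = |z|^2 c - b Im(z w), and the last term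
    vanishes. Geometrically, two arguments in ]-pi/2, pi/2[ cannot add up to pi or - pi. *)
Lemma mulc_rhp_notin_neg (z w : R[i]) : 0 < complex.Re z -> 0 < complex.Re w ->
  complex.Im (z * w) = 0 -> 0 < complex.Re (z * w).
Proof.
case: z w => [a b] [c e] /= a0 c0 h.
have : 0 < a * (a * c - b * e).
  have -> : a * (a * c - b * e) = (a ^+ 2 + b ^+ 2) * c - b * (a * e + b * c).
    by ring.
  rewrite h mulr0 subr0 mulr_gt0// ltr_wpDr ?sqr_ge0//.
  by rewrite exprn_gt0.
by rewrite pmulr_rgt0.
Qed.

(** If z w is real, it is positive by the previous lemma, hence equal to |z| |w|, which is at least
    x y > r. *)
Lemma mulc_rhp_sub_notin_neg (z w : R[i]) (x y r : R) :
  0 < x -> 0 < y -> x <= complex.Re z -> y <= complex.Re w -> r < x * y ->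
  complex.Im (z * w - r%:C) = 0 -> 0 < complex.Re (z * w - r%:C).
Proof.
move=> x0 y0 xz yw rxy.
have z0 := lt_le_trans x0 xz; have w0 := lt_le_trans y0 yw.
rewrite ImD ImN subr0 => h; have := mulc_rhp_notin_neg z0 w0 h.
rewrite ReD ReN subr_gt0 => zw0; apply: (lt_le_trans rxy).
rewrite -(@ler_pXn2r _ 2) ?nnegrE ?(ltW zw0) ?mulr_ge0 ?(ltW x0) ?(ltW y0)//.
have -> : complex.Re (z * w) ^+ 2 = complex.Re (z * w) ^+ 2 + complex.Im (z * w) ^+ 2.
  by rewrite h expr0n addr0.
rewrite ReM ImM.
have -> : forall a b c e : R, (a * c - b * e) ^+ 2 + (a * e + b * c) ^+ 2 =
  (a ^+ 2 + b ^+ 2) * (c ^+ 2 + e ^+ 2) by move=> *; ring.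
rewrite exprMn.
apply: ler_pM; rewrite ?sqr_ge0//.
  by rewrite ler_wpDr ?sqr_ge0// lerXn2r// nnegrE ltW.
by rewrite ler_wpDr ?sqr_ge0// lerXn2r// nnegrE ltW.
Qed.

End distinguished_logarithm.

(** * Integrals of bounded functions and dominated convergence *)

Section bounded_integrals.
Context d (T : measurableType d) (R : realType) (P : probability T R).
Implicit Types (E : set T) (f g : T -> R).

Lemma bounded_integrable E f (C : R) : measurable E ->
  measurable_fun setT f -> (forall w, `|f w| <= C) ->
  P.-integrable E (EFin \o f).
Proof.
move=> mE mf fC.
apply: (@le_integrable _ _ _ _ _ mE _ (EFin \o cst C)).
- exact/measurable_EFinP/measurable_funTS.
- by move=> w _ /=; rewrite lee_fin (le_trans (fC w)) ?ler_norm.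
- exact: finite_measure_integrable_cst.
Qed.

Lemma dominated_Rintegral_cvg E (F : nat -> T -> R) f g : measurable E ->
  (forall n, measurable_fun setT (F n)) -> P.-integrable E (EFin \o g) ->
  (forall n w, `|F n w| <= g w) ->
  (forall w, F n w @[n --> \oo] --> f w) ->
  \int[P]_(w in E) F n w @[n --> \oo] --> \int[P]_(w in E) f w.
Proof.
move=> mE mF ig Fg Ff.
have mf : measurable_fun setT f.
  exact: (@measurable_fun_cvg _ _ _ _ F).
have cF w : E w -> (EFin \o F n) w @[n --> \oo] --> (EFin \o f) w.
  by move=> _; apply/fine_cvgP; split; [exact: nearW|exact: Ff].
have bF w n : E w -> (`|(EFin \o F n) w| <= (EFin \o g) w)%E.
  by move=> _; rewrite lee_fin.
have [fi _ h] := @dominated_convergence _ _ _ P _ mE (fun n => EFin \o F n)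
  (EFin \o f) (EFin \o g)
  (fun n => measurable_funTS ((measurable_EFinP _ _).2 (mF n)))
  (measurable_funTS ((measurable_EFinP _ _).2 mf))
  (aeW P cF) ig (aeW P bF).
by apply: fine_cvg; rewrite fineK//; exact: integrable_fin_num.
Qed.

Lemma RintegralI E A f : measurable E -> measurable A ->
  \int[P]_(w in E `&` A) f w = \int[P]_(w in E) (\1_A w * f w).
Proof.
move=> mE mA; rewrite Rintegral_mkcondr; apply: eq_Rintegral => w _.
by rewrite patchE indicE; case: ifP => _; rewrite ?mul1r ?mul0r.
Qed.

End bounded_integrals.

(** * Complex-valued limits and integrals *)

Section complex_integral.
Context {d} {T : measurableType d} {R : realType} (P : probability T R).
Implicit Types (E : set T) (f g : T -> R[i]).

Definition cvgc (u : nat -> R[i]) (z : R[i]) :=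
  (complex.Re (u n) @[n --> \oo] --> complex.Re z) /\
  (complex.Im (u n) @[n --> \oo] --> complex.Im z).

Lemma cvgc_unique u y z : cvgc u y -> cvgc u z -> y = z.
Proof.
move=> [r1 i1] [r2 i2]; apply: complex_eq.
  by rewrite -(cvg_lim _ r1)// -(cvg_lim _ r2).
by rewrite -(cvg_lim _ i1)// -(cvg_lim _ i2).
Qed.

Lemma cvgc_cst z : cvgc (fun=> z) z.
Proof. by split; exact: cvg_cst. Qed.

Lemma cvgcD u v y z : cvgc u y -> cvgc v z -> cvgc (fun n => u n + v n) (y + z).
Proof.
move=> [r1 i1] [r2 i2]; split.
  by rewrite ReD; under eq_fun do rewrite ReD; exact: cvgD.
by rewrite ImD; under eq_fun do rewrite ImD; exact: cvgD.
Qed.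

Lemma cvgcM u v y z : cvgc u y -> cvgc v z -> cvgc (fun n => u n * v n) (y * z).
Proof.
move=> [r1 i1] [r2 i2]; split.
  rewrite ReM; under eq_fun do rewrite ReM.
  by apply: cvgB; exact: cvgM.
rewrite ImM; under eq_fun do rewrite ImM.
by apply: cvgD; exact: cvgM.
Qed.

Lemma cvgc_near u v z : (\forall n \near \oo, u n = v n) -> cvgc u z -> cvgc v z.
Proof.
move=> uv [ru iu]; split.
  by apply: cvg_trans ru; apply: near_eq_cvg; near=> n; congr complex.Re; near: n.
by apply: cvg_trans iu; apply: near_eq_cvg; near=> n; congr complex.Im; near: n.
Unshelve. all: by end_near. Qed.

Lemma cvgc_cexp u z : cvgc u z -> cvgc (fun n => cexp (u n)) (cexp z).
Proof.
move=> [ru iu]; rewrite cexpE; split => /=.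
  under eq_fun do rewrite cexpE /=.
  apply: cvgM; first by apply: (cvg_comp _ _ ru); exact: continuous_expR.
  by apply: (cvg_comp _ _ iu); exact: continuous_cos.
under eq_fun do rewrite cexpE /=.
apply: cvgM; first by apply: (cvg_comp _ _ ru); exact: continuous_expR.
by apply: (cvg_comp _ _ iu); exact: continuous_sin.
Qed.

Lemma cmodM (y z : R[i]) : cmod (y * z) = cmod y * cmod z.
Proof. exact: ComplexField.Normc.normcM. Qed.

Lemma cmodD (y z : R[i]) : cmod (y + z) <= cmod y + cmod z.
Proof. exact: le_normcD. Qed.

Lemma cmod_ge0 (z : R[i]) : 0 <= cmod z.
Proof. by rewrite cmodE sqrtr_ge0. Qed.

Lemma cmod1 : cmod (1 : R[i]) = 1.
Proof. exact: ComplexField.Normc.normc1. Qed.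

Lemma cmod_real (x : R) : cmod x%:C = `|x|.
Proof. by rewrite cmodE /= expr0n addr0 sqrtr_sqr. Qed.

Lemma cmodV (z : R[i]) : cmod z^-1 = (cmod z)^-1.
Proof. exact: ComplexField.Normc.normcV. Qed.

Lemma cmodX (z : R[i]) n : cmod (z ^+ n) = cmod z ^+ n.
Proof. by elim: n => [|n ih]; rewrite ?expr0 ?cmod1// !exprS cmodM ih. Qed.

Lemma ler_Re_cmod (z : R[i]) : `|complex.Re z| <= cmod z.
Proof.
rewrite cmodE -sqrtr_sqr ler_wsqrtr// lerDl; exact: sqr_ge0.
Qed.

Lemma ler_Im_cmod (z : R[i]) : `|complex.Im z| <= cmod z.
Proof.
rewrite cmodE -sqrtr_sqr ler_wsqrtr// lerDr; exact: sqr_ge0.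
Qed.

Definition measurable_cfun f :=
  measurable_fun setT (fun w => complex.Re (f w)) /\
  measurable_fun setT (fun w => complex.Im (f w)).

Lemma measurable_cfun_cst (z : R[i]) : measurable_cfun (fun=> z).
Proof. by split; exact: measurable_cst. Qed.

Lemma measurable_cfunD f g : measurable_cfun f -> measurable_cfun g ->
  measurable_cfun (fun w => f w + g w).
Proof.
move=> [rf jf] [rg ig]; split.
  by under eq_fun do rewrite ReD; exact: measurable_funD.
by under eq_fun do rewrite ImD; exact: measurable_funD.
Qed.

Lemma measurable_cfunM f g : measurable_cfun f -> measurable_cfun g ->
  measurable_cfun (fun w => f w * g w).
Proof.
move=> [rf jf] [rg ig]; split.
  under eq_fun do rewrite ReM.
  by apply: measurable_funB; exact: measurable_funM.
under eq_fun do rewrite ImM.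
by apply: measurable_funD; exact: measurable_funM.
Qed.

Lemma measurable_cfun_cexp f : measurable_cfun f ->
  measurable_cfun (fun w => cexp (f w)).
Proof.
move=> [rf jf]; split; under eq_fun do rewrite cexpE /=.
  apply: measurable_funM; first exact: (measurableT_comp (@measurable_expR R)).
  by apply: (measurableT_comp _ jf); apply: continuous_measurable_fun;
    exact: continuous_cos.
apply: measurable_funM; first exact: (measurableT_comp (@measurable_expR R)).
by apply: (measurableT_comp _ jf); apply: continuous_measurable_fun;
  exact: continuous_sin.
Qed.

(** Integration over an event E, not only over the whole space, because expectations are split along
    the cells of a partition. *)
Definition cintegral E f : R[i] :=
  (\int[P]_(w in E) complex.Re (f w)) +i* (\int[P]_(w in E) complex.Im (f w)).

Lemma cexpectationE f : cexpectation P f = cintegral setT f.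
Proof. by rewrite /cexpectation unlock. Qed.

Lemma eq_cintegral E f g : {in E, f =1 g} -> cintegral E f = cintegral E g.
Proof.
by move=> fg; congr (_ +i* _); apply: eq_Rintegral => w /fg ->.
Qed.

Lemma dominated_cintegral_cvg E (F : nat -> T -> R[i]) f (g : T -> R) :
  measurable E -> (forall n, measurable_cfun (F n)) ->
  P.-integrable E (EFin \o g) -> (forall n w, cmod (F n w) <= g w) ->
  (forall w, cvgc (F ^~ w) (f w)) ->
  cvgc (fun n => cintegral E (F n)) (cintegral E f).
Proof.
move=> mE mF ig Fg Ff; split => /=.
  apply: (@dominated_Rintegral_cvg _ _ _ _ _ _ _ g) => //.
  - by move=> n; have [] := mF n.
  - by move=> n w; rewrite (le_trans (ler_Re_cmod _)).
  - by move=> w; have [] := Ff w.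
apply: (@dominated_Rintegral_cvg _ _ _ _ _ _ _ g) => //.
- by move=> n; have [] := mF n.
- by move=> n w; rewrite (le_trans (ler_Im_cmod _)).
- by move=> w; have [] := Ff w.
Qed.

Lemma cintegral_cvg E (F : nat -> T -> R[i]) f (C : R) : measurable E ->
  (forall n, measurable_cfun (F n)) -> (forall n w, cmod (F n w) <= C) ->
  (forall w, cvgc (F ^~ w) (f w)) ->
  cvgc (fun n => cintegral E (F n)) (cintegral E f).
Proof.
move=> mE mF FC; apply: (@dominated_cintegral_cvg _ _ _ (cst C)) => //.
exact: finite_measure_integrable_cst.
Qed.

Lemma integrable_Re E f (C : R) : measurable E -> measurable_cfun f ->
  (forall w, cmod (f w) <= C) ->
  P.-integrable E (EFin \o (fun w => complex.Re (f w))).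
Proof.
move=> mE [mf _] fC; apply: (@bounded_integrable _ _ _ _ _ _ C) => // w.
by rewrite (le_trans (ler_Re_cmod _)).
Qed.

Lemma integrable_Im E f (C : R) : measurable E -> measurable_cfun f ->
  (forall w, cmod (f w) <= C) ->
  P.-integrable E (EFin \o (fun w => complex.Im (f w))).
Proof.
move=> mE [_ mf] fC; apply: (@bounded_integrable _ _ _ _ _ _ C) => // w.
by rewrite (le_trans (ler_Im_cmod _)).
Qed.

Lemma cintegralD E f g (C D : R) : measurable E ->
  measurable_cfun f -> (forall w, cmod (f w) <= C) ->
  measurable_cfun g -> (forall w, cmod (g w) <= D) ->
  cintegral E (fun w => f w + g w) = cintegral E f + cintegral E g.
Proof.
move=> mE mf fC mg gD; apply: complex_eq; rewrite ?ReD ?ImD /=.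
  rewrite -RintegralD//; [|exact: integrable_Re fC|exact: integrable_Re gD].
  by apply: eq_Rintegral => w _; rewrite ReD.
rewrite -RintegralD//; [|exact: integrable_Im fC|exact: integrable_Im gD].
by apply: eq_Rintegral => w _; rewrite ImD.
Qed.

Lemma cintegralZ E f (z : R[i]) (C : R) : measurable E ->
  measurable_cfun f -> (forall w, cmod (f w) <= C) ->
  cintegral E (fun w => z * f w) = z * cintegral E f.
Proof.
move=> mE mf fC.
have iR := integrable_Re mE mf fC; have iI := integrable_Im mE mf fC.
have iZ (g : T -> R) (a : R) : P.-integrable E (EFin \o g) ->
    P.-integrable E (EFin \o (fun w => a * g w)).
  move=> /(integrableZl mE a); apply: eq_integrable => //.
apply: complex_eq; rewrite ?ReM ?ImM /=.
  rewrite -!RintegralZl// -RintegralB//; try exact: iZ.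
  by apply: eq_Rintegral => w _; rewrite ReM.
rewrite -!RintegralZl// -RintegralD//; try exact: iZ.
by apply: eq_Rintegral => w _; rewrite ImM.
Qed.

(** The bounds [C n] may grow with n, since only finite sums are exchanged; in the gamma transform
    the n-th term is bounded by n! / beta^n. *)
Lemma cintegral_lincomb E (z : nat -> R[i]) (f : nat -> T -> R[i])
    (C : nat -> R) N : measurable E ->
  (forall n, measurable_cfun (f n)) -> (forall n w, cmod (f n w) <= C n) ->
  cintegral E (fun w => \sum_(n < N) z n * f n w) =
  \sum_(n < N) z n * cintegral E (f n).
Proof.
move=> mE mf fC.
have mS m : measurable_cfun (fun w => \sum_(n < m) z n * f n w).
  elim: m => [|m ih].
    by under eq_fun do rewrite big_ord0; exact: measurable_cfun_cst.
  under eq_fun do rewrite big_ord_recr /=; apply: measurable_cfunD => //.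
  by apply: measurable_cfunM => //; exact: measurable_cfun_cst.
have Sb m w : cmod (\sum_(n < m) z n * f n w) <= \sum_(n < m) cmod (z n) * C n.
  elim: m => [|m ih]; first by rewrite !big_ord0 (cmod_real 0) normr0.
  rewrite !big_ord_recr /= (le_trans (cmodD _ _))// lerD// cmodM.
  by rewrite ler_wpM2l// cmod_ge0.
elim: N => [|N ih].
  under eq_cintegral do rewrite big_ord0; rewrite big_ord0.
  by congr (_ +i* _); rewrite /Rintegral integral0.
under eq_cintegral do rewrite big_ord_recr /=.
rewrite big_ord_recr /= -ih -(@cintegralZ _ _ _ (C N))//.
apply: (@cintegralD _ _ _ _ (cmod (z N) * C N) mE (mS N) (Sb N)); last first.
  by move=> w; rewrite cmodM ler_wpM2l ?cmod_ge0.
by apply: measurable_cfunM => //; exact: measurable_cfun_cst.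
Qed.

Lemma cintegral_real E (f : T -> R) :
  cintegral E (fun w => (f w)%:C) = (\int[P]_(w in E) f w)%:C.
Proof.
by apply: complex_eq => //=; rewrite /Rintegral integral0.
Qed.

Lemma cintegral_cst E (z : R[i]) : measurable E ->
  cintegral E (fun=> z) = z * (fine (P E))%:C.
Proof.
move=> mE; apply: complex_eq; rewrite ?ReM ?ImM /= Rintegral_cst//.
  by rewrite mulr0 subr0.
by rewrite mulr0 add0r.
Qed.

Lemma cintegralI E A f : measurable E -> measurable A ->
  cintegral (E `&` A) f = cintegral E (fun w => (\1_A w)%:C * f w).
Proof.
move=> mE mA; congr (_ +i* _); rewrite RintegralI//.
  by apply: eq_Rintegral => w _; rewrite ReM /= mul0r subr0.
by apply: eq_Rintegral => w _; rewrite ImM /= mul0r addr0.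
Qed.

Lemma measurable_cfun_indic A f : measurable A -> measurable_cfun f ->
  measurable_cfun (fun w => (\1_A w)%:C * f w).
Proof.
move=> mA mf; apply: measurable_cfunM => //.
by split; [exact: measurable_indic|exact: measurable_cst].
Qed.

Lemma cmod_indic A (z : R[i]) (w : T) : cmod ((\1_A w)%:C * z) <= cmod z.
Proof.
rewrite cmodM cmod_real indicE; case: (w \in A); rewrite ?normr1 ?mul1r//.
by rewrite normr0 mul0r cmod_ge0.
Qed.

End complex_integral.

(** * Splitting along the values of an integer variable *)

Section countable_partition.
Context {d} {T : measurableType d} {R : realType} (P : probability T R).
Variables (N : T -> nat).
Hypothesis mN : forall n, measurable [set w | N w = n].

Lemma measurable_fun_countable d' (S : measurableType d') (F : nat -> T -> S) :
  (forall n, measurable_fun setT (F n)) ->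
  measurable_fun setT (fun w => F (N w) w).
Proof.
move=> mF _ A mA; rewrite setTI.
rewrite (_ : _ @^-1` A = \bigcup_n ([set w | N w = n] `&` F n @^-1` A)).
  apply: bigcup_measurable => n _; apply: measurableI => //.
  by rewrite -[X in measurable X]setTI; exact: mF.
apply/seteqP; split => w /=; first by move=> Aw; exists (N w).
by move=> [n _ [/= -> ]].
Qed.

(** The partial sum of order m is the integral of [F (N w) w] cut off to N w < m; these truncations
    are bounded by C and eventually constant at each point. *)
Lemma cintegral_countable E (F : nat -> T -> R[i]) (C : R) : measurable E ->
  (forall n, measurable_cfun (F n)) -> (forall n w, cmod (F n w) <= C) ->
  cvgc (fun m => \sum_(n < m) cintegral P (E `&` [set w | N w = n]) (F n))
       (cintegral P E (fun w => F (N w) w)).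
Proof.
move=> mE mF FC.
(* A bound of moduli is nonnegative as soon as there is a point at which to evaluate it. *)
have C0 (w : T) : 0 <= C := le_trans (cmod_ge0 _) (FC 0%N w).
pose G m w : R[i] := \sum_(n < m) (\1_[set w | N w = n] w)%:C * F n w.
have GS m w : G m.+1 w = G m w + (\1_[set w | N w = m] w)%:C * F m w.
  by rewrite /G big_ord_recr.
have GE m w : G m w = if (N w < m)%N then F (N w) w else 0.
  elim: m => [|m ih]; first by rewrite /G big_ord0.
  rewrite GS ih indicE ltnS.
  have [e|ne] := eqVneq (N w) m.
    by rewrite mem_set// e ltnn leqnn/= add0r mul1r.
  by rewrite memNset ?mul0r ?addr0//= ?(leq_eqVlt (N w) m) ?(negbTE ne)//; exact/eqP.
have Gb m w : cmod (G m w) <= C.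
  rewrite GE; case: ifP => _ //.
  rewrite (_ : cmod 0 = 0); first exact: C0.
  by rewrite (cmod_real 0) normr0.
have mG m : measurable_cfun (G m).
  elim: m => [|m ih].
    rewrite (_ : G 0%N = fun=> 0); first exact: measurable_cfun_cst.
    by apply/funext => w; rewrite /G big_ord0.
  rewrite (funext (GS m)); apply: measurable_cfunD => //.
  exact: measurable_cfun_indic.
have -> : (fun m => \sum_(n < m) cintegral P (E `&` [set w | N w = n]) (F n)) =
    (fun m => cintegral P E (G m)).
  apply/funext; elim => [|m ih].
    rewrite big_ord0 (_ : G 0%N = fun=> 0) ?cintegral_cst ?mul0r//.
    by apply/funext => w; rewrite /G big_ord0.
  rewrite big_ord_recr /= ih (funext (GS m)) cintegralI//.
  rewrite (@cintegralD _ _ _ _ _ _ _ C C)//.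
    exact: measurable_cfun_indic.
  by move=> w; apply: le_trans (FC m w); exact: cmod_indic.
apply: (@cintegral_cvg _ _ _ _ _ _ _ C) => // w.
apply: (cvgc_near (u := fun=> F (N w) w)); last exact: cvgc_cst.
near=> m; rewrite GE ifT//; near: m; exact: nbhs_infty_gt.
Unshelve. all: by end_near. Qed.

(** Agreement on each cell suffices, both integrals being limits of the same partial sums; this is
    how a random grid index is frozen. *)
Lemma eq_cintegral_countable E (F G : nat -> T -> R[i]) (C D : R) : measurable E ->
  (forall n, measurable_cfun (F n)) -> (forall n w, cmod (F n w) <= C) ->
  (forall n, measurable_cfun (G n)) -> (forall n w, cmod (G n w) <= D) ->
  (forall n, cintegral P (E `&` [set w | N w = n]) (F n) =
             cintegral P (E `&` [set w | N w = n]) (G n)) ->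
  cintegral P E (fun w => F (N w) w) = cintegral P E (fun w => G (N w) w).
Proof.
move=> mE mF FC mG GD FG.
have h := cintegral_countable mE mF FC.
apply: cvgc_unique h _; under eq_fun do under eq_bigr do rewrite FG.
exact: cintegral_countable mE mG GD.
Qed.

Lemma ge0_integral_countable (F : nat -> T -> R) :
  (forall n, measurable_fun setT (F n)) -> (forall n w, 0 <= F n w) ->
  (\int[P]_w (F (N w) w)%:E =
   \sum_(n <oo) \int[P]_(w in [set w | N w = n]) (F n w)%:E)%E.
Proof.
move=> mF F0.
have UT : \bigcup_n [set w | N w = n] = setT.
  by apply/seteqP; split => // w _; exists (N w).
rewrite -{1}UT ge0_integral_bigcup//.
- apply: eq_eseriesr => n _; apply: eq_integral => w.
  by rewrite inE /= => ->.
- rewrite UT; apply/measurable_EFinP.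
  exact: measurable_fun_countable.
- by move=> w _; rewrite lee_fin.
- apply/trivIsetP => i j _ _ ij; apply/seteqP; split => // w [/= ni nj].
  by move: ij; rewrite -ni -nj eqxx.
Qed.

End countable_partition.

(** * Factorisation of integrals over an independent event *)

Section independence_on_event.
Context {d} {d1 d2 : measure_display} {T : measurableType d} {R : realType}.
Context {S1 : measurableType d1} {S2 : measurableType d2}.
Variable P : probability T R.

(** A factorisation rather than a conditional independence: it makes sense when P(E) = 0, and the
    marginals on the right are unconditional. *)
Definition independent_on (E : set T) (X : T -> S1) (Y : T -> S2) :=
  forall A B, measurable A -> measurable B ->
  P (E `&` (X @^-1` A `&` Y @^-1` B)) =
  (P E * (P (X @^-1` A) * P (Y @^-1` B)))%E.

Variables (E : set T) (X : T -> S1) (Y : T -> S2).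
Hypotheses (mE : measurable E) (mX : measurable_fun setT X)
  (mY : measurable_fun setT Y) (EXY : independent_on E X Y).

Let PE_fin : (P E < +oo)%E.
Proof. by rewrite ltey_eq fin_num_measure. Qed.

Let PE : {finite_measure set T -> \bar R} := mfrestr mE PE_fin.

Let integral_restr (f : T -> \bar R) : measurable_fun setT f ->
  (forall x, 0 <= f x)%E -> (\int[PE]_w f w = \int[P]_(w in E) f w)%E.
Proof.
move=> mf f0; have mEC : measurable (~` E) by exact: measurableC.
rewrite -(setUv E) ge0_integral_setU//; last 2 first.
- by rewrite setUv.
- exact/disj_setPCl.
rewrite [X in (_ + X)%E](_ : _ = 0%E) ?adde0; last first.
  apply: null_set_integral => //; first exact: measurable_funTS.
  by rewrite /PE /= /mfrestr /mrestr setICl measure0.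
by apply: eq_measure_integral => A mA AE; rewrite /PE /= /mfrestr /mrestr setIidl.
Qed.

Let XY w := (X w, Y w).

Let mXY : measurable_fun setT XY.
Proof. exact: measurable_fun_pair. Qed.

Let X_rv : {mfun T >-> S1} := HB.pack X (isMeasurableFun.Build _ _ _ _ _ mX).
Let Y_rv : {mfun T >-> S2} := HB.pack Y (isMeasurableFun.Build _ _ _ _ _ mY).
Let XY_rv : {mfun T >-> (S1 * S2)%type} :=
  HB.pack XY (isMeasurableFun.Build _ _ _ _ _ mXY).

(** Up to the factor 1 / P(E), the restriction of P to E sends (X, Y) to a measure that agrees on
    rectangles with the product of the laws of X and Y; uniqueness of the product measure and
    Tonelli conclude. The case P(E) = 0 is apart because of the division. *)
Lemma ge0_integral_independent_on (f : S1 -> \bar R) (g : S2 -> \bar R) :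
  measurable_fun setT f -> measurable_fun setT g ->
  (forall x, 0 <= f x)%E -> (forall y, 0 <= g y)%E ->
  (\int[P]_(w in E) (f (X w) * g (Y w)) =
   P E * (\int[P]_w f (X w) * \int[P]_w g (Y w)))%E.
Proof.
move=> mf mg f0 g0.
have mfX : measurable_fun setT (f \o X) by exact: measurableT_comp.
have mgY : measurable_fun setT (g \o Y) by exact: measurableT_comp.
have [PE0|PE0] := eqVneq (P E) 0%E.
  rewrite PE0 mul0e; apply: null_set_integral => //.
  by apply: measurable_funTS; exact: emeasurable_funM.
have fPE0 : 0 <= fine (P E) by rewrite fine_ge0.
have fPEn0 : fine (P E) != 0 by rewrite fine_eq0 ?fin_num_measure.
have iPE0 : 0 <= (fine (P E))^-1 by rewrite invr_ge0.
pose k : {nonneg R} := NngNum iPE0.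
have kPE : (k%:num%:E * P E = 1)%E.
  by rewrite -(@fineK _ (P E)) ?fin_num_measure// -EFinM /= mulVf.
have @m' : {measure set (S1 * S2) -> \bar R}.
  by refine (mscale k (pushforward PE XY_rv)); exact: mXY.
have m'E A B : measurable A -> measurable B ->
    m' (A `*` B) = (distribution P X_rv A * distribution P Y_rv B)%E.
  move=> mA mB; rewrite /m' /= /mscale /= /pushforward /PE /= /mfrestr /mrestr.
  rewrite (_ : _ @^-1` _ `&` E = E `&` (X @^-1` A `&` Y @^-1` B)); last first.
    by rewrite setIC.
  by rewrite EXY// muleA kPE mul1e.
have prodE := product_measure_unique m'E.
pose h (p : S1 * S2) := (f p.1 * g p.2)%E.
have mh : measurable_fun setT h.
  by apply: emeasurable_funM; exact: measurableT_comp.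
have h0 p : (0 <= h p)%E by exact: mule_ge0.
have : (\int[(distribution P X_rv \x distribution P Y_rv)%E]_p h p =
        k%:num%:E * \int[P]_(w in E) (f (X w) * g (Y w)))%E.
  rewrite (eq_measure_integral m'); last by move=> A mA _; exact: prodE.
  rewrite ge0_integral_mscale// ge0_integral_pushforward//.
  rewrite preimage_setT; congr (_ * _)%E; apply: integral_restr => [|w].
    by apply: measurableT_comp.
  exact: h0.
rewrite fubini_tonelli1// /fubini_F /h /=.
under eq_integral do rewrite ge0_integralZl//.
rewrite ge0_integralZr//; last by apply: integral_ge0 => y _; exact: g0.
rewrite !ge0_integral_distribution//.
by move=> ->; rewrite muleA [(P E * _)%E]muleC kPE mul1e.
Qed.

Let ge0_bounded_independent_on (f : S1 -> R) (g : S2 -> R) (C D : R) :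
  measurable_fun setT f -> measurable_fun setT g ->
  (forall x, 0 <= f x <= C) -> (forall y, 0 <= g y <= D) ->
  \int[P]_(w in E) (f (X w) * g (Y w)) =
  fine (P E) * (\int[P]_w f (X w) * \int[P]_w g (Y w)).
Proof.
move=> mf mg fC gD.
have := @ge0_integral_independent_on (EFin \o f) (EFin \o g).
rewrite /Rintegral => /= ->; first last.
- by move=> y; rewrite lee_fin; have /andP[] := gD y.
- by move=> y; rewrite lee_fin; have /andP[] := fC y.
- exact/measurable_EFinP.
- exact/measurable_EFinP.
have i1 : (\int[P]_w (f (X w))%:E)%E \is a fin_num.
  apply: integrable_fin_num => //.
  apply: (@bounded_integrable _ _ _ _ _ (f \o X) C) => //.
    exact: measurableT_comp.
  by move=> w /=; have /andP[? ?] := fC (X w); rewrite ger0_norm.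
have i2 : (\int[P]_w (g (Y w))%:E)%E \is a fin_num.
  apply: integrable_fin_num => //.
  apply: (@bounded_integrable _ _ _ _ _ (g \o Y) D) => //.
    exact: measurableT_comp.
  by move=> w /=; have /andP[? ?] := gD (Y w); rewrite ger0_norm.
by rewrite !fineM// ?fin_numM// fin_num_measure.
Qed.

Let shift_integral A (u v : T -> R) (K L : R) : measurable A ->
  measurable_fun setT u -> measurable_fun setT v ->
  (forall w, `|u w| <= K) -> (forall w, `|v w| <= L) ->
  \int[P]_(w in A) (u w - v w) = \int[P]_(w in A) u w - \int[P]_(w in A) v w.
Proof.
move=> mA mu mv uK vL; apply: RintegralB => //.
  exact: (@bounded_integrable _ _ _ _ _ _ K).
exact: (@bounded_integrable _ _ _ _ _ _ L).
Qed.

(** Signed bounded functions are shifted by their bounds to nonnegative ones, f = (f + C) - C, first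
    in f against a nonnegative second factor, then in g. *)
Lemma integral_independent_on (f : S1 -> R) (g : S2 -> R) (C D : R) :
  measurable_fun setT f -> measurable_fun setT g ->
  (forall x, `|f x| <= C) -> (forall y, `|g y| <= D) ->
  \int[P]_(w in E) (f (X w) * g (Y w)) =
  fine (P E) * (\int[P]_w f (X w) * \int[P]_w g (Y w)).
Proof.
move=> mf mg fC gD.
have shift_bd (S : Type) (h : S -> R) (K : R) : (forall x, `|h x| <= K) ->
    forall x, [/\ 0 <= h x + K <= K + K, `|h x + K| <= K + K, 0 <= K <= K & `|K| <= K].
  move=> hK x; have := hK x; rewrite ler_norml => /andP[h1 h2].
  have K0 : 0 <= K by exact: le_trans (hK x).
  have h3 : 0 <= h x + K by lra.
  rewrite !ger0_norm// lexx h3 K0; split => //; lra.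
have fK := shift_bd _ _ _ fC; have gK := shift_bd _ _ _ gD.
have mfX : measurable_fun setT (f \o X) by exact: measurableT_comp.
have mgY : measurable_fun setT (g \o Y) by exact: measurableT_comp.
have mfC : measurable_fun setT (fun x => f x + C).
  by apply: measurable_funD => //; exact: measurable_cst.
have mgD : measurable_fun setT (fun y => g y + D).
  by apply: measurable_funD => //; exact: measurable_cst.
have mfCX : measurable_fun setT (fun w => f (X w) + C).
  by apply: measurable_funD => //; exact: measurable_cst.
have mgDY : measurable_fun setT (fun w => g (Y w) + D).
  by apply: measurable_funD => //; exact: measurable_cst.
have fE A : measurable A -> \int[P]_(w in A) f (X w) =
    \int[P]_(w in A) (f (X w) + C) - \int[P]_(w in A) C.
  move=> mA; rewrite -(@shift_integral _ _ _ (C + C) C)//.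
  - by apply: eq_Rintegral => w _; rewrite addrK.
  - by move=> w; have [] := fK (X w).
  - by move=> w; have [] := fK (X w).
have gE A : measurable A -> \int[P]_(w in A) g (Y w) =
    \int[P]_(w in A) (g (Y w) + D) - \int[P]_(w in A) D.
  move=> mA; rewrite -(@shift_integral _ _ _ (D + D) D)//.
  - by apply: eq_Rintegral => w _; rewrite addrK.
  - by move=> w; have [] := gK (Y w).
  - by move=> w; have [] := gK (Y w).
have step (g1 : S2 -> R) (L : R) : measurable_fun setT g1 ->
    (forall y, 0 <= g1 y <= L) ->
    \int[P]_(w in E) (f (X w) * g1 (Y w)) =
    fine (P E) * (\int[P]_w f (X w) * \int[P]_w g1 (Y w)).
  move=> mg1 g1L.
  have mg1Y : measurable_fun setT (g1 \o Y) by exact: measurableT_comp.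
  have g1b y : `|g1 y| <= L by have /andP[? ?] := g1L y; rewrite ger0_norm.
  rewrite fE// mulrBl mulrBr.
  rewrite -(@ge0_bounded_independent_on (fun x => f x + C) g1 (C + C) L)//; last first.
    by move=> x; have [] := fK x.
  (* Nonnegativity of C is read off at a point, hence the case distinction on the existence of
     one. *)
  have [w0|T0] := pselect (exists w : T, True); last first.
    have -> : E = set0 by apply/seteqP; split => // w; case: T0; exists w.
    by rewrite !Rintegral_set0 measure0 mul0r subr0.
  case: w0 => w0 _.
  rewrite -(@ge0_bounded_independent_on (fun=> C) g1 C L)//; last first.
    by move=> _; have [] := fK (X w0).
  rewrite -(@shift_integral _ _ _ ((C + C) * L) (C * L))//.
  - by apply: eq_Rintegral => w _; rewrite mulrDl addrK.
  - exact: measurable_funM.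
  - by apply: measurable_funM => //; exact: measurable_cst.
  - by move=> w; rewrite normrM ler_pM//; have [] := fK (X w).
  - by move=> w; rewrite normrM ler_pM//; have [] := fK (X w).
have [w0|T0] := pselect (exists w : T, True); last first.
  have -> : E = set0 by apply/seteqP; split => // w; case: T0; exists w.
  by rewrite !Rintegral_set0 measure0 mul0r.
case: w0 => w0 _.
rewrite gE// !mulrBr.
rewrite -(step (fun y => g y + D) (D + D))//; last first.
  by move=> y; have [] := gK y.
rewrite -(step (fun=> D) D)//; last by move=> _; have [] := gK (Y w0).
rewrite -(@shift_integral _ _ _ (C * (D + D)) (C * D))//.
- by apply: eq_Rintegral => w _; rewrite mulrDr addrK.
- exact: measurable_funM.
- by apply: measurable_funM => //; exact: measurable_cst.
- by move=> w; rewrite normrM ler_pM//; have [] := gK (Y w).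
- by move=> w; rewrite normrM ler_pM//; have [] := gK (Y w).
Qed.

Lemma cintegral_independent_on (f : S1 -> R[i]) (g : S2 -> R[i]) (C D : R) :
  measurable_cfun f -> measurable_cfun g ->
  (forall x, cmod (f x) <= C) -> (forall y, cmod (g y) <= D) ->
  cintegral P E (fun w => f (X w) * g (Y w)) =
  (fine (P E))%:C *
  (cexpectation P (f \o X) * cexpectation P (g \o Y)).
Proof.
move=> [rf jf] [rg ig] fC gD.
have fR x : `|complex.Re (f x)| <= C by exact: le_trans (ler_Re_cmod _) _.
have fI x : `|complex.Im (f x)| <= C by exact: le_trans (ler_Im_cmod _) _.
have gR y : `|complex.Re (g y)| <= D by exact: le_trans (ler_Re_cmod _) _.
have gI y : `|complex.Im (g y)| <= D by exact: le_trans (ler_Im_cmod _) _.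
have mX' (u : S1 -> R) : measurable_fun setT u -> measurable_fun setT (u \o X).
  by move=> ?; exact: measurableT_comp.
have mY' (u : S2 -> R) : measurable_fun setT u -> measurable_fun setT (u \o Y).
  by move=> ?; exact: measurableT_comp.
have iM (u : S1 -> R) (v : S2 -> R) : measurable_fun setT u ->
    measurable_fun setT v -> (forall x, `|u x| <= C) -> (forall y, `|v y| <= D) ->
    P.-integrable E (EFin \o (fun w => u (X w) * v (Y w))).
  move=> mu mv uC vD; apply: (@bounded_integrable _ _ _ _ _ _ (C * D)) => //.
    by apply: measurable_funM; [exact: mX'|exact: mY'].
  by move=> w; rewrite normrM ler_pM.
rewrite !cexpectationE; apply: complex_eq.
  rewrite ReM mul0r subr0 ReM mulrBr /=.
  rewrite -(@integral_independent_on (fun x => complex.Re (f x)) (fun x => complex.Re (g x)) C D)//.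
  rewrite -(@integral_independent_on (fun x => complex.Im (f x)) (fun x => complex.Im (g x)) C D)//.
  rewrite -RintegralB//; last 2 first.
  - exact: (iM (fun x => complex.Re (f x)) (fun x => complex.Re (g x))).
  - exact: (iM (fun x => complex.Im (f x)) (fun x => complex.Im (g x))).
  by apply: eq_Rintegral => w _; rewrite ReM.
rewrite ImM mul0r addr0 ImM mulrDr /=.
rewrite -(@integral_independent_on (fun x => complex.Re (f x)) (fun x => complex.Im (g x)) C D)//.
rewrite -(@integral_independent_on (fun x => complex.Im (f x)) (fun x => complex.Re (g x)) C D)//.
rewrite -RintegralD//; last 2 first.
- exact: (iM (fun x => complex.Re (f x)) (fun x => complex.Im (g x))).
- exact: (iM (fun x => complex.Im (f x)) (fun x => complex.Re (g x))).
by apply: eq_Rintegral => w _; rewrite ImM.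
Qed.

End independence_on_event.

(** * Approximating a time from the right *)

Section right_discretization.
Context {R : realType}.
Implicit Types (n : nat) (x : R).

(* The smallest multiple of 1/(n+1) that is strictly above x (for x >= 0). *)
Definition grid n x : R := (Num.truncn (n.+1%:R * x)).+1%:R / n.+1%:R.

Lemma grid_gt n x : x < grid n x.
Proof. by rewrite /grid ltr_pdivlMr// mulrC truncnS_gt. Qed.

Lemma grid_le n x : 0 <= x -> grid n x <= x + n.+1%:R^-1.
Proof.
move=> x0; rewrite /grid ler_pdivrMr// mulrDl mulVf// -natr1 lerD2r mulrC.
by rewrite truncn_le// mulr_ge0.
Qed.

Lemma truncn_eq n x k : 0 <= x ->
  (Num.truncn (n.+1%:R * x) == k) =
  (x \in `[k%:R / n.+1%:R, k.+1%:R / n.+1%:R[).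
Proof.
move=> x0; rewrite in_itv/= ler_pdivrMr// ltr_pdivlMr// mulrC.
have y0 : 0 <= x * n.+1%:R by rewrite mulr_ge0.
apply/eqP/idP => [<-|]; last exact: truncn_def.
exact: truncn_itv.
Qed.

Lemma cvg_grid x : 0 <= x -> grid n x @[n --> \oo] --> x.
Proof.
move=> x0; apply: (@squeeze_cvgr _ _ _ _ (fun=> x) (fun n => x + n.+1%:R^-1)).
- by apply: nearW => n; rewrite grid_le// ltW// grid_gt.
- exact: cvg_cst.
- rewrite -[X in _ --> X]addr0; apply: cvgD; first exact: cvg_cst.
  exact: cvg_harmonic.
Qed.

(** Grid points lie strictly to the right of x, so right-continuity at x is enough; natural numbers
    at distance less than 1 are equal, so convergence becomes eventual equality. *)
Lemma grid_right_near (f : R -> nat) x : 0 <= x ->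
  (f s)%:R @[s --> x^'+] --> ((f x)%:R : R) ->
  \forall n \near \oo, f (grid n x) = f x.
Proof.
move=> x0 /cvgrPdist_lt /(_ 1 ltr01) fx.
have : \forall s \near x^'+, f s = f x.
  near=> s; have : `|(f x)%:R - (f s)%:R| < 1 :> R by near: s.
  rewrite -[_ - _]/((f x)%:~R - (f s)%:~R) -intrB -intr_norm.
  rewrite -[1]/(1%:~R) ltr_int => h.
  by lia.
rewrite -nbhs_nearE /at_right; case=> e /= e0 he.
have := cvg_grid x0; move=> /cvgrPdist_lt /(_ e e0); apply: filterS => n hn.
by apply: he => //=; exact: grid_gt.
Unshelve. all: by end_near. Qed.

End right_discretization.

(** * Counting processes evaluated at independent random times *)

Section subordination.
Context {d} {T : measurableType d} {R : realType} (P : probability T R).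

Lemma measurable_preimage d' (S : measurableType d') (f : T -> S) (A : set S) :
  measurable_fun setT f -> measurable A -> measurable (f @^-1` A).
Proof. by move=> mf mA; rewrite -[X in measurable X]setTI; exact: mf. Qed.

Lemma measurable_truncn_grid (H : T -> R) n k : measurable_fun setT H ->
  (forall w, 0 <= H w) ->
  measurable [set w | Num.truncn (n.+1%:R * H w) = k].
Proof.
move=> mH H0; rewrite (_ : [set w | _] =
    H @^-1` [set` `[k%:R / n.+1%:R : R, k.+1%:R / n.+1%:R[]); last first.
  apply/seteqP; split => w /=; rewrite -truncn_eq//; first by move=> ->.
  by move=> /eqP.
exact: measurable_preimage.
Qed.

(** Evaluation at a random time is a pointwise limit of evaluations at grid times, each a countable
    patchwork of fixed-time variables. *)
Lemma measurable_subordinated_nat (N : R -> T -> nat) (H : T -> R) :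
  (forall t, 0 <= t -> measurable_fun setT (N t)) ->
  (forall t w, 0 <= t -> (N s w)%:R @[s --> t^'+] --> ((N t w)%:R : R)) ->
  measurable_fun setT H -> (forall w, 0 <= H w) ->
  measurable_fun setT (fun w => (N (H w) w)%:R : R).
Proof.
move=> mN rN mH H0.
apply: (@measurable_fun_cvg _ _ _ _ (fun n w => (N (grid n (H w)) w)%:R)) => //.
  move=> n.
  have mK k := measurable_truncn_grid n k mH H0.
  apply: (measurable_fun_countable mK
    (fun k => measurableT_comp _ (mN (k.+1%:R / n.+1%:R) _))) => //.
move=> w _; have h := grid_right_near (f := N ^~ w) (H0 w) (rN _ w (H0 w)).
apply: cvg_near_cst.
by near=> n; rewrite (near h n).
Unshelve. all: by end_near. Qed.

Lemma measurable_cfun_natX (N : T -> nat) (u : R[i]) :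
  measurable_fun setT N -> measurable_cfun (fun w => u ^+ N w).
Proof.
move=> mN; split.
  exact: (@measurableT_comp _ _ _ _ _ _ (fun n => complex.Re (u ^+ n))).
exact: (@measurableT_comp _ _ _ _ _ _ (fun n => complex.Im (u ^+ n))).
Qed.

Lemma cmodX_le1 (u : R[i]) n : cmod u <= 1 -> cmod (u ^+ n) <= 1.
Proof. by move=> u1; rewrite cmodX exprn_ile1// cmod_ge0. Qed.

Lemma cmod_cexp_le1 (x : R) (c : R[i]) : 0 <= x -> complex.Re c <= 0 ->
  cmod (cexp (x%:C * c)) <= 1.
Proof.
move=> x0 c0; rewrite cmod_cexp ReM /= mul0r subr0 expR_le1.
exact: mulr_ge0_le0.
Qed.

Variables (N1 N2 : R -> T -> nat) (H1 H2 : T -> R).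
Hypotheses (mN1 : forall t, 0 <= t -> measurable_fun setT (N1 t))
  (mN2 : forall t, 0 <= t -> measurable_fun setT (N2 t))
  (rN1 : forall t w, 0 <= t -> (N1 s w)%:R @[s --> t^'+] --> ((N1 t w)%:R : R))
  (rN2 : forall t w, 0 <= t -> (N2 s w)%:R @[s --> t^'+] --> ((N2 t w)%:R : R))
  (mH1 : measurable_fun setT H1) (mH2 : measurable_fun setT H2)
  (H1_ge0 : forall w, 0 <= H1 w) (H2_ge0 : forall w, 0 <= H2 w).
Hypothesis NH_indep : forall s t A B, 0 <= s -> 0 <= t ->
  measurable A -> measurable B ->
  independent_on P (H1 @^-1` A `&` H2 @^-1` B) (N1 s) (N2 t).

(** On a cell of the grid both frozen clocks are deterministic, so only the one-time transforms of
    the counts are needed; all integrands have modulus at most 1, which settles both passages to the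
    limit. *)
Lemma subordination (u1 u2 c1 c2 : R[i]) :
  cmod u1 <= 1 -> cmod u2 <= 1 -> complex.Re c1 <= 0 -> complex.Re c2 <= 0 ->
  (forall t, 0 <= t -> cexpectation P (fun w => u1 ^+ N1 t w) = cexp (t%:C * c1)) ->
  (forall t, 0 <= t -> cexpectation P (fun w => u2 ^+ N2 t w) = cexp (t%:C * c2)) ->
  cexpectation P (fun w => u1 ^+ N1 (H1 w) w * u2 ^+ N2 (H2 w) w) =
  cexpectation P (fun w => cexp ((H1 w)%:C * c1) * cexp ((H2 w)%:C * c2)).
Proof.
move=> u1_le1 u2_le1 c1_le0 c2_le0 E1 E2.
pose K1 n w := Num.truncn (n.+1%:R * H1 w).
pose K2 n w := Num.truncn (n.+1%:R * H2 w).
pose s n k : R := k.+1%:R / n.+1%:R.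
have s0 n k : 0 <= s n k by rewrite divr_ge0.
have mK1 n k : measurable [set w | K1 n w = k] by exact: measurable_truncn_grid.
have mK2 n k : measurable [set w | K2 n w = k] by exact: measurable_truncn_grid.
pose F n k1 k2 w := u1 ^+ N1 (s n k1) w * u2 ^+ N2 (s n k2) w.
pose G n k1 k2 (w : T) := cexp ((s n k1)%:C * c1) * cexp ((s n k2)%:C * c2).
have mF n k1 k2 : measurable_cfun (F n k1 k2).
  by apply: measurable_cfunM; apply: measurable_cfun_natX;
    [exact: mN1|exact: mN2].
have Fb n k1 k2 w : cmod (F n k1 k2 w) <= 1.
  by rewrite cmodM mulr_ile1 ?cmod_ge0// cmodX_le1.
have mG n k1 k2 : measurable_cfun (G n k1 k2) by exact: measurable_cfun_cst.
have Gb n k1 k2 w : cmod (G n k1 k2 w) <= 1.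
  by rewrite cmodM mulr_ile1 ?cmod_ge0// cmod_cexp_le1.
have mcount (K : nat -> T -> nat) (V : nat -> nat -> T -> R[i]) n :
    (forall k, measurable [set w | K n w = k]) ->
    (forall k, measurable_cfun (V n k)) ->
    measurable_cfun (fun w => V n (K n w) w).
  move=> mK mV; split.
    exact: (measurable_fun_countable mK (fun k => (mV k).1)).
  exact: (measurable_fun_countable mK (fun k => (mV k).2)).
have mF2 n k1 : measurable_cfun (fun w => F n k1 (K2 n w) w).
  exact: (mcount K2 (fun n k => F n k1 k)).
have mG2 n k1 : measurable_cfun (fun w => G n k1 (K2 n w) w).
  exact: (mcount K2 (fun n k => G n k1 k)).
have mF1 n : measurable_cfun (fun w => F n (K1 n w) (K2 n w) w).
  exact: (mcount K1 (fun n k w => F n k (K2 n w) w)).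
have mG1 n : measurable_cfun (fun w => G n (K1 n w) (K2 n w) w).
  exact: (mcount K1 (fun n k w => G n k (K2 n w) w)).
have FG n : cintegral P setT (fun w => F n (K1 n w) (K2 n w) w) =
            cintegral P setT (fun w => G n (K1 n w) (K2 n w) w).
  apply: (@eq_cintegral_countable _ _ _ P (K1 n) (mK1 n) setT
    (fun k w => F n k (K2 n w) w) (fun k w => G n k (K2 n w) w) 1 1) => // k.
  apply: (@eq_cintegral_countable _ _ _ P (K2 n) (mK2 n) _
    (fun m w => F n k m w) (fun m w => G n k m w) 1 1) => //.
    exact: measurableI.
  move=> m.
  (* Fixing both grid indices confines (H1, H2) to a rectangle, the kind of event for which
     [NH_indep] is assumed. *)
  have EI : setT `&` [set w | K1 n w = k] `&` [set w | K2 n w = m] =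
      H1 @^-1` [set` `[k%:R / n.+1%:R : R, k.+1%:R / n.+1%:R[] `&`
      H2 @^-1` [set` `[m%:R / n.+1%:R : R, m.+1%:R / n.+1%:R[].
    rewrite setTI; apply/seteqP; split => w /=.
      by move=> [h1 h2]; rewrite -!truncn_eq// -h1 -h2.
    by rewrite -!truncn_eq// => -[/eqP ? /eqP ?].
  rewrite EI; rewrite /F /G.
  rewrite (@cintegral_independent_on _ _ _ _ _ _ _ P _ (N1 (s n k)) (N2 (s n m)) _ _ _ _
    (fun j => u1 ^+ j) (fun j => u2 ^+ j) 1 1)//.
  - rewrite cintegral_cst; first by rewrite E1// E2// mulrC.
    by apply: measurableI; exact: measurable_preimage.
  - by apply: measurableI; exact: measurable_preimage.
  - exact: mN1.
  - exact: mN2.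
  - exact: NH_indep.
  - by move=> j; exact: cmodX_le1.
  - by move=> j; exact: cmodX_le1.
rewrite !cexpectationE.
have cF : cvgc (fun n => cintegral P setT (fun w => F n (K1 n w) (K2 n w) w))
    (cintegral P setT (fun w => u1 ^+ N1 (H1 w) w * u2 ^+ N2 (H2 w) w)).
  apply: (@cintegral_cvg _ _ _ _ _ _ _ 1) => // w.
  have h1 := grid_right_near (f := N1 ^~ w) (H1_ge0 w) (@rN1 _ w (H1_ge0 w)).
  have h2 := grid_right_near (f := N2 ^~ w) (H2_ge0 w) (@rN2 _ w (H2_ge0 w)).
  apply: cvgc_near (cvgc_cst _).
  by near=> n; rewrite /F -[s n _]/(grid n (H1 w)) (near h1 n)//
    -[s n _]/(grid n (H2 w)) (near h2 n).
apply: cvgc_unique cF _; under eq_fun do rewrite FG.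
apply: (@cintegral_cvg _ _ _ _ _ _ _ 1) => // w.
by apply: cvgcM; apply: cvgc_cexp; apply: cvgcM; (try exact: cvgc_cst);
  split; [exact: cvg_grid|exact: cvg_cst|exact: cvg_grid|exact: cvg_cst].
Unshelve. all: by end_near. Qed.

End subordination.

(** * The binomial series of (1 - w)^(-r) *)

Section binomial_series.
Context {R : realType}.
Implicit Types (r v K : R) (n : nat) (w : R[i]).

(** The coefficient of z^n in (1 - z)^(-r); n! times it is the rising factorial, which also governs
    the gamma moments. *)
Definition binomial_coeff r n : R := (\prod_(m < n) (r + m%:R)) / n`!%:R.

(** The falling product from n + r - 1 is the rising product from r read backwards. *)
Lemma real_binomialE r n : real_binomial (n%:R + r - 1) n = binomial_coeff r n.
Proof.
rewrite /real_binomial /binomial_coeff; congr (_ / _).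
rewrite (reindex_inj rev_ord_inj) /=; apply: eq_bigr => m _.
rewrite natrB ?ltn_ord// -natr1; ring.
Qed.

Lemma binomial_coeff0 r : binomial_coeff r 0 = 1.
Proof. by rewrite /binomial_coeff big_ord0 fact0 divr1. Qed.

Lemma binomial_coeff_ge0 r n : 0 <= r -> 0 <= binomial_coeff r n.
Proof.
by move=> r0; rewrite divr_ge0// prodr_ge0// => m _; rewrite addr_ge0.
Qed.

Lemma binomial_coeffS r n :
  n.+1%:R * binomial_coeff r n.+1 = (r + n%:R) * binomial_coeff r n.
Proof.
rewrite /binomial_coeff big_ord_recr /= factS natrM.
have n0 : n`!%:R != 0 :> R by rewrite pnatr_eq0 -lt0n fact_gt0.
by field; rewrite n0 addrC natr1 pnatr_eq0.
Qed.

(** Both sides are r (r + 1) ... (r + n) / n!, with the last or the first factor split off. *)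
Lemma binomial_coeff_shift r n :
  (r + n%:R) * binomial_coeff r n = r * binomial_coeff (r + 1) n.
Proof.
rewrite /binomial_coeff !mulrA; congr (_ / _).
have := @big_ord_recl R 1 *%R n (fun m : 'I_n.+1 => r + (m : nat)%:R).
rewrite big_ord_recr /= mulrC => ->; rewrite addr0; congr (_ * _).
by apply: eq_bigr => m _; rewrite /bump leq0n add1n -natr1; ring.
Qed.

(** Coefficientwise form of (1 - z) (1 - z)^(-(r + 1)) = (1 - z)^(-r). *)
Lemma binomial_coeff_pascal r n :
  binomial_coeff (r + 1) n.+1 = binomial_coeff r n.+1 + binomial_coeff (r + 1) n.
Proof.
have n0 : n.+1%:R != 0 :> R by rewrite pnatr_eq0.
apply: (mulfI n0); rewrite mulrDr !binomial_coeffS (binomial_coeff_shift r) -natr1.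
ring.
Qed.

(** The ratio of consecutive terms is s (r + n) / (n + 1), at most 1 once n reaches the integer part
    of s r / (1 - s); from there on the terms do not increase, so the sum of the terms up to that
    index bounds them all. *)
Lemma binomial_coeff_bound r (s : R) : 0 <= r -> 0 <= s < 1 ->
  exists A, forall n, binomial_coeff r n * s ^+ n <= A.
Proof.
move=> r0 /andP[s0 s1]; pose b n := binomial_coeff r n * s ^+ n.
have b0 n : 0 <= b n by rewrite mulr_ge0 ?binomial_coeff_ge0 ?exprn_ge0.
pose N := Num.truncn (s * r / (1 - s)).
have bS n : (N <= n)%N -> b n.+1 <= b n.
  move=> Nn; rewrite -(@ler_pM2l _ n.+1%:R)// /b mulrA binomial_coeffS exprS.
  rewrite [leRHS]mulrC.
  have -> : (r + n%:R) * binomial_coeff r n * (s * s ^+ n) = b n * ((r + n%:R) * s).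
    by rewrite /b; ring.
  rewrite ler_wpM2l//.
  have : s * r / (1 - s) < n.+1%:R.
    by apply: lt_le_trans (truncnS_gt _) _; rewrite ler_nat ltnS.
  rewrite ltr_pdivrMr ?subr_gt0// => /ltW h.
  have n1 : n%:R <= n.+1%:R :> R by rewrite ler_nat.
  have : n%:R * s <= n.+1%:R * s by rewrite ler_wpM2r.
  by rewrite -natr1 in h *; lra.
exists (\sum_(k < N.+1) b k); elim => [|n ih].
  by rewrite big_ord_recl lerDl sumr_ge0.
have [nN|Nn] := ltnP n N; last exact: le_trans (bS _ Nn) ih.
rewrite (bigD1 (Ordinal (nN : (n.+1 < N.+1)%N)))//= lerDl sumr_ge0//.
Qed.

(* [L] stands for the real part, the imaginary part, and their compositions
   with a multiplication. *)
Definition binomial_pseries r w (L : R[i] -> R) v : R^nat :=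
  pseries (fun n => binomial_coeff r n * L (w ^+ n)) v.

Lemma is_cvg_binomial_pseries r w L v (A : R) : 0 <= r ->
  (forall z, `|L z| <= A * cmod z) -> `|v| * cmod w < 1 ->
  cvgn (binomial_pseries r w L v).
Proof.
move=> r0 LA vw1; set rho := `|v| * cmod w in vw1.
have rho0 : 0 <= rho by rewrite mulr_ge0 ?cmod_ge0.
have A0 : 0 <= A by have := LA 1; rewrite cmod1 mulr1; exact: le_trans.
(* Midpoint between rho and 1: the coefficients times s^n stay bounded because s < 1, and rho / s <
   1 leaves a geometric majorant. *)
pose s := (1 + rho) / 2.
have s0 : 0 < s by rewrite /s; lra.
have s1 : s < 1 by rewrite /s; lra.
have [D hD] := binomial_coeff_bound r0 (introT andP (conj (ltW s0) s1)).
have D0 : 0 <= D by have := hD 0%N; rewrite binomial_coeff0 mul1r expr0; lra.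
apply: normed_cvg => /=.
apply: (@series_le_cvg _ _ (geometric (D * A) (rho / s))).
- by move=> n /=.
- by move=> n /=; rewrite !mulr_ge0// exprn_ge0// divr_ge0// ltW.
- move=> n; rewrite -[leLHS]/(`|binomial_coeff r n * L (w ^+ n) * v ^+ n|).
  rewrite -[leRHS]/(D * A * (rho / s) ^+ n) 2!normrM.
  rewrite (ger0_norm (binomial_coeff_ge0 n r0)) normrX.
  have h : `|L (w ^+ n)| * `|v| ^+ n <= A * rho ^+ n.
    rewrite /rho exprMn -cmodX [_ ^+ n * cmod _]mulrC mulrA.
    by rewrite ler_wpM2r ?exprn_ge0.
  rewrite -mulrA; apply: le_trans (ler_wpM2l (binomial_coeff_ge0 _ r0) h) _.
  have -> : rho ^+ n = s ^+ n * (rho / s) ^+ n.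
    by rewrite -exprMn mulrCA divff ?mulr1// gt_eqF.
  have -> : binomial_coeff r n * (A * (s ^+ n * (rho / s) ^+ n)) =
    (binomial_coeff r n * s ^+ n) * (A * (rho / s) ^+ n) by ring.
  rewrite -[leRHS]mulrA; apply: ler_wpM2r => //.
  by rewrite mulr_ge0// exprn_ge0// divr_ge0// (ltW s0).
- have rs0 : 0 <= rho / s by rewrite mulr_ge0 ?invr_ge0 ?(ltW s0).
  apply: is_cvg_geometric_series; rewrite ger0_norm//.
  by rewrite ltr_pdivrMr// mul1r /s; lra.
Qed.

(** The derivative in v is r w times the series of parameter r + 1: the family is closed under
    differentiation, the factor r w being absorbed in [L]. *)
Lemma binomial_pseries_diffs r w L :
  pseries_diffs (fun n => binomial_coeff r n * L (w ^+ n)) =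
  (fun n => binomial_coeff (r + 1) n * (r * L (w * w ^+ n))).
Proof.
apply/funext => n; rewrite /pseries_diffs mulrA binomial_coeffS.
by rewrite binomial_coeff_shift exprS -mulrA mulrCA.
Qed.

Lemma is_derive_binomial_pseries r w L v (A : R) : 0 <= r -> cmod w < 1 ->
  (forall z, `|L z| <= A * cmod z) -> `|v| <= 1 ->
  is_derive v 1 (fun v => limn (binomial_pseries r w L v))
    (limn (binomial_pseries (r + 1) w (fun z => r * L (w * z)) v)).
Proof.
move=> r0 w1 LA v1.
have A0 : 0 <= A by have := LA 1; rewrite cmod1 mulr1; exact: le_trans.
have w0 : 0 <= cmod w := cmod_ge0 w.
(* Termwise differentiation needs a radius K > 1 to cover |v| <= 1, with K |w| < 1 for convergence;
   K = 2 / (1 + |w|) has both properties. *)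
have [K K1 Kw] : exists2 K, 1 < K & `|K| * cmod w < 1.
  exists (2 / (1 + cmod w)); first by rewrite ltr_pdivlMr; lra.
  have c0 : 0 < 1 + cmod w by lra.
  by rewrite ger0_norm ?divr_ge0 ?(ltW c0)// mulrAC ltr_pdivrMr//; lra.
have bL r' (L0 : R[i] -> R) (B : R) : 0 <= r' ->
   (forall z, `|L0 z| <= B * cmod z) -> forall z, `|r' * L0 (w * z)| <= (r' * B * cmod w) * cmod z.
  move=> r'0 LB z; rewrite normrM ger0_norm// -!mulrA ler_wpM2l//.
  by rewrite -cmodM.
have r10 : 0 <= r + 1 by rewrite addr_ge0.
have := @pseries_snd_diffs _ (fun n => binomial_coeff r n * L (w ^+ n)) K v.
rewrite (binomial_pseries_diffs r w L).
rewrite (binomial_pseries_diffs (r + 1) w (fun z => r * L (w * z))).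
apply.
- exact: is_cvg_binomial_pseries LA _.
- exact: is_cvg_binomial_pseries (bL _ _ _ r0 LA) _.
- apply: (is_cvg_binomial_pseries _ (bL _ _ _ r10 (bL _ _ _ r0 LA))) => //.
  by rewrite addr_ge0.
- by rewrite (le_lt_trans v1)// (lt_le_trans K1)// ler_norm.
Qed.

Lemma is_deriveD_fun (f g : R -> R) v df dg : is_derive v 1 f df ->
  is_derive v 1 g dg -> is_derive v 1 (fun v => f v + g v) (df + dg).
Proof. by move=> ? ?; exact: is_deriveD. Qed.

Lemma is_deriveB_fun (f g : R -> R) v df dg : is_derive v 1 f df ->
  is_derive v 1 g dg -> is_derive v 1 (fun v => f v - g v) (df - dg).
Proof. by move=> ? ?; exact: is_deriveB. Qed.

Lemma is_deriveM_fun (f g : R -> R) v df dg : is_derive v 1 f df ->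
  is_derive v 1 g dg ->
  is_derive v 1 (fun v => f v * g v) (df * g v + f v * dg).
Proof.
move=> ? ?; rewrite addrC [df * _]mulrC; exact: is_deriveM.
Qed.

Lemma is_derive_comp_fun (f g : R -> R) v df dg : is_derive (g v) 1 f df ->
  is_derive v 1 g dg -> is_derive v 1 (fun v => f (g v)) (df * dg).
Proof. by move=> ? ?; exact: is_derive1_comp. Qed.

Section binomial_sum.
Variable w : R[i].
Hypothesis w1 : cmod w < 1.

Let a := complex.Re w.
Let b := complex.Im w.

Let Phi r v : R[i] := limn (binomial_pseries r w (@complex.Re R) v)
  +i* limn (binomial_pseries r w (@complex.Im R) v).

Let Re_le (z : R[i]) : `|complex.Re z| <= 1 * cmod z.
Proof. by rewrite mul1r ler_Re_cmod. Qed.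

Let Im_le (z : R[i]) : `|complex.Im z| <= 1 * cmod z.
Proof. by rewrite mul1r ler_Im_cmod. Qed.

Let vw1 v : `|v| <= 1 -> `|v| * cmod w < 1.
Proof. by move=> v1; rewrite (le_lt_trans _ w1)// ler_piMl ?cmod_ge0. Qed.

Lemma cvgc_binomial_sum r v : 0 <= r -> `|v| <= 1 ->
  cvgc (fun N => \sum_(n < N) (binomial_coeff r n)%:C * (v%:C * w) ^+ n) (Phi r v).
Proof.
move=> r0 v1.
have cR := is_cvg_binomial_pseries r0 Re_le (vw1 v1).
have cI := is_cvg_binomial_pseries r0 Im_le (vw1 v1).
have E N : \sum_(n < N) (binomial_coeff r n)%:C * (v%:C * w) ^+ n =
    (binomial_pseries r w (@complex.Re R) v N) +i*
    (binomial_pseries r w (@complex.Im R) v N).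
  rewrite /binomial_pseries /pseries /series /=.
  elim: N => [|N ih]; first by rewrite big_ord0 !big_geq.
  rewrite big_ord_recr ih !big_nat_recr//= exprMn -rmorphXn.
  by apply: complex_eq; rewrite ?ReD ?ImD ?ReM ?ImM /= ?ReM ?ImM /=; ring.
by split; under eq_fun do rewrite E /=.
Qed.

(** Summed form of [binomial_coeff_pascal]: it expresses [Phi r] by [Phi (r + 1)] and so turns the
    derivative formula into a closed differential equation. *)
Let PhiE r v : 0 <= r -> `|v| <= 1 ->
  Phi (r + 1) v = Phi r v + v%:C * w * Phi (r + 1) v.
Proof.
move=> r0 v1; have r10 : 0 <= r + 1 by rewrite addr_ge0.
have h1 := cvgc_binomial_sum r10 v1; have h0 := cvgc_binomial_sum r0 v1.
have shift (u : nat -> R[i]) z : cvgc u z -> cvgc (fun n => u n.+1) z.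
  by move=> [hr hi]; split; rewrite (cvg_shiftS (fun n => _ (u n))).
apply: cvgc_unique (shift _ _ h1) _.
have := cvgcD (shift _ _ h0) (cvgcM (cvgc_cst (v%:C * w)) h1).
apply: cvgc_near; apply: nearW => N.
rewrite !big_ord_recl /= !binomial_coeff0 !expr0 -addrA; congr (_ + _).
rewrite mulr_sumr -big_split /=; apply: eq_bigr => n _.
by rewrite /bump leq0n add1n binomial_coeff_pascal rmorphD /= mulrDl exprS; ring.
Qed.

Let is_derive_Phi r v : 0 <= r -> `|v| <= 1 ->
  is_derive v 1 (fun v => complex.Re (Phi r v))
    (r * (a * complex.Re (Phi (r + 1) v) - b * complex.Im (Phi (r + 1) v))) /\
  is_derive v 1 (fun v => complex.Im (Phi r v))
    (r * (a * complex.Im (Phi (r + 1) v) + b * complex.Re (Phi (r + 1) v))).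
Proof.
move=> r0 v1; have r10 : 0 <= r + 1 by rewrite addr_ge0.
have cR := is_cvg_binomial_pseries r10 Re_le (vw1 v1).
have cI := is_cvg_binomial_pseries r10 Im_le (vw1 v1).
have dR := is_derive_binomial_pseries r0 w1 Re_le v1.
have dI := is_derive_binomial_pseries r0 w1 Im_le v1.
split; [apply: is_derive_eq dR _|apply: is_derive_eq dI _]; apply/cvg_lim => //.
  rewrite (_ : binomial_pseries _ _ _ _ = fun N =>
    r * (a * binomial_pseries (r + 1) w (@complex.Re R) v N
         - b * binomial_pseries (r + 1) w (@complex.Im R) v N)).
    by apply: cvgMr => //; apply: cvgB; apply: cvgMr.
  apply/funext => N; rewrite /binomial_pseries /pseries /series /=.
  rewrite !mulr_sumr -sumrB mulr_sumr; apply: eq_bigr => n _.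
  by rewrite ReM; ring.
rewrite (_ : binomial_pseries _ _ _ _ = fun N =>
    r * (a * binomial_pseries (r + 1) w (@complex.Im R) v N
         + b * binomial_pseries (r + 1) w (@complex.Re R) v N)).
  by apply: cvgMr => //; apply: cvgD; apply: cvgMr.
apply/funext => N; rewrite /binomial_pseries /pseries /series /=.
rewrite !mulr_sumr -big_split mulr_sumr; apply: eq_bigr => n _ /=.
by rewrite ImM; ring.
Qed.

(** X + i Y = 1 - v w, whose real part is positive since |v w| < 1. *)
Let X v := 1 - v * a.
Let Y v := - (v * b).

Let clogE v : clog (1 - v%:C * w) =
  (ln (X v * X v + Y v * Y v) / 2) +i* atan (Y v / X v).
Proof.
rewrite /clog ReD ImD ReN ImN ReM ImM /= !mul0r subr0 addr0 add0r.
by rewrite !expr2.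
Qed.

Let X_gt0 v : `|v| <= 1 -> 0 < X v.
Proof.
move=> v1; rewrite subr_gt0; apply: le_lt_trans (vw1 v1).
by rewrite (le_trans (ler_norm _))// normrM ler_wpM2l// /a ler_Re_cmod.
Qed.

Let is_derive_clog v : `|v| <= 1 ->
  is_derive v 1 (fun v => complex.Re (clog (1 - v%:C * w)))
    (- (X v * a + Y v * b) / (X v * X v + Y v * Y v)) /\
  is_derive v 1 (fun v => complex.Im (clog (1 - v%:C * w)))
    ((Y v * a - X v * b) / (X v * X v + Y v * Y v)).
Proof.
move=> v1; have X0 := X_gt0 v1.
have Xn0 : X v != 0 by rewrite gt_eqF.
have S0 : 0 < X v * X v + Y v * Y v.
  by rewrite ltr_wpDr ?mulr_gt0// -expr2 sqr_ge0.
have Sn0 : X v * X v + Y v * Y v != 0 by rewrite gt_eqF.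
have Sn1 : 1 + (Y v / X v) ^+ 2 != 0 by rewrite gt_eqF// ltr_wpDr ?sqr_ge0.
have did := is_derive_id v (1 : R).
have dX : is_derive v 1 X (- a).
  have h : is_derive v 1 X (0 - (1 * a + v * 0)) := is_deriveB_fun
    (is_derive_cst (1 : R) v 1) (is_deriveM_fun did (is_derive_cst a v 1)).
  by apply: is_derive_eq h _; ring.
have dY : is_derive v 1 Y (- b).
  have h : is_derive v 1 Y (- (1 * b + v * 0)) := is_deriveN
    (is_deriveM_fun did (is_derive_cst b v 1)).
  by apply: is_derive_eq h _; ring.
have hX := is_deriveM_fun dX dX; have hY := is_deriveM_fun dY dY.
have hS := is_deriveD_fun hX hY.
have hL := @is_derive_comp_fun (@ln R) _ v _ _ (is_derive1_ln S0) hS.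
have hLhalf := is_deriveM_fun hL (is_derive_cst (2^-1 : R) v 1).
have hXV : is_derive v 1 (fun v => (X v)^-1) (- (X v) ^- 2 *: - a).
  exact: is_deriveV.
have hYX := is_deriveM_fun dY hXV.
have hA := @is_derive_comp_fun (@atan R) _ v _ _ (is_derive1_atan (Y v / X v)) hYX.
split; under eq_fun do rewrite clogE /=.
  by apply: is_derive_eq hLhalf _ => /=; field.
apply: is_derive_eq hA _; rewrite /GRing.scale /=.
by field; rewrite Xn0 ?andbT /=; exact: Sn0.
Qed.

Let h r v := Phi r v * cexp (r%:C * clog (1 - v%:C * w)).

(** The derivative is r w (1 - v w)^(r - 1) times (1 - v w) Phi (r + 1) - Phi r, zero by [PhiE]. *)
Let is_derive_h r v : 0 <= r -> `|v| <= 1 ->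
  is_derive v 1 (fun v => complex.Re (h r v)) 0 /\
  is_derive v 1 (fun v => complex.Im (h r v)) 0.
Proof.
move=> r0 v1; have [dC dS] := is_derive_Phi r0 v1.
have [dA dB] := is_derive_clog v1.
have PE := PhiE r0 v1.
have X0 := X_gt0 v1.
have Sn0 : X v * X v + Y v * Y v != 0.
  by rewrite gt_eqF// ltr_wpDr ?mulr_gt0// -expr2 sqr_ge0.
have CE : complex.Re (Phi r v) = X v * complex.Re (Phi (r + 1) v)
    - Y v * complex.Im (Phi (r + 1) v).
  have := congr1 (@complex.Re R) PE; rewrite ReD !ReM ImM /= => e.
  by rewrite /X /Y /a /b; lra.
have SE : complex.Im (Phi r v) = X v * complex.Im (Phi (r + 1) v)
    + Y v * complex.Re (Phi (r + 1) v).
  have := congr1 (@complex.Im R) PE; rewrite ImD !ImM ReM /= => e.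
  by rewrite /X /Y /a /b; lra.
set A := (fun v : R => complex.Re (clog (1 - v%:C * w))) in dA *.
set B := (fun v : R => complex.Im (clog (1 - v%:C * w))) in dB *.
set C := (fun v : R => complex.Re (Phi r v)) in dC *.
set S := (fun v : R => complex.Im (Phi r v)) in dS *.
have drA := is_deriveM_fun (is_derive_cst r v 1) dA.
have drB := is_deriveM_fun (is_derive_cst r v 1) dB.
have dE := @is_derive_comp_fun (@expR R) _ v _ _ (is_derive_expR _) drA.
have dcos := @is_derive_comp_fun (@cos R) _ v _ _ (is_derive_cos _) drB.
have dsin := @is_derive_comp_fun (@sin R) _ v _ _ (is_derive_sin _) drB.
have dEc := is_deriveM_fun dE dcos; have dEs := is_deriveM_fun dE dsin.
split.
  have -> : (fun v => complex.Re (h r v)) = (fun v =>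
      C v * (expR (r * A v) * cos (r * B v)) - S v * (expR (r * A v) * sin (r * B v))).
    by apply/funext => u; rewrite /h ReM cexpE (ReM r%:C) (ImM r%:C) /= !mul0r subr0 addr0.
  have d1 := is_deriveB_fun (is_deriveM_fun dC dEc) (is_deriveM_fun dS dEs).
  apply: is_derive_eq d1 _; rewrite /C /S CE SE /cst; field.
  exact: Sn0.
have -> : (fun v => complex.Im (h r v)) = (fun v =>
    C v * (expR (r * A v) * sin (r * B v)) + S v * (expR (r * A v) * cos (r * B v))).
  by apply/funext => u; rewrite /h ImM cexpE (ReM r%:C) (ImM r%:C) /= !mul0r subr0 addr0.
have d1 := is_deriveD_fun (is_deriveM_fun dC dEs) (is_deriveM_fun dS dEc).
apply: is_derive_eq d1 _; rewrite /C /S CE SE /cst; field.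
exact: Sn0.
Qed.

Let derivative0_cst (f : R -> R) : (forall v, `|v| <= 1 -> is_derive v 1 f 0) ->
  f 1 = f 0.
Proof.
move=> df; have h01 v : v \in `[0, 1] -> `|v| <= 1.
  by rewrite in_itv/= => /andP[? ?]; rewrite ger0_norm.
have [||c _] := @MVT_segment R f (fun=> 0) 0 1 ler01.
- by move=> v v01; apply/df/h01/subset_itv_oo_cc.
- apply: derivable_within_continuous => v v01.
  by have [] := df v (h01 _ v01).
by rewrite mul0r => /eqP; rewrite subr_eq0 => /eqP.
Qed.

(** As v runs from 0 to 1, the product of [Phi r v] and (1 - v w)^r keeps its initial value 1. *)
Theorem binomial_series r : 0 <= r ->
  cvgc (fun N => \sum_(n < N) (binomial_coeff r n)%:C * w ^+ n)
       (cexp (- (r%:C * clog (1 - w)))).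
Proof.
move=> r0; have v1 : `|1 : R| <= 1 by rewrite normr1.
have v0 : `|0 : R| <= 1 by rewrite normr0.
have := cvgc_binomial_sum r0 v1; rewrite mul1r.
suff -> : Phi r 1 = cexp (- (r%:C * clog (1 - w))) by [].
have Phi0 : Phi r 0 = 1.
  apply: cvgc_unique (cvgc_binomial_sum r0 v0) _.
  apply: cvgc_near (cvgc_cst _); near=> N.
  have N0 : (0 < N)%N by near: N; exact: nbhs_infty_gt.
  rewrite -(prednK N0) big_ord_recl binomial_coeff0 mul0r expr0 mulr1 big1 ?addr0//.
  by move=> n _; rewrite /= exprS mul0r mulr0.
have : h r 1 = h r 0.
  apply: complex_eq.
    by apply: (derivative0_cst (f := fun v => complex.Re (h r v))) => v ?;
      have [] := is_derive_h r0 (v := v).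
  by apply: (derivative0_cst (f := fun v => complex.Im (h r v))) => v ?;
    have [] := is_derive_h r0 (v := v).
rewrite /h Phi0 mul0r subr0 clog1 mulr0 cexp0 mulr1 mul1r => e.
by rewrite cexpN -[LHS](mulfK (cexp_neq0 (r%:C * clog (1 - w)))) e mul1r.
Unshelve. all: by end_near. Qed.

End binomial_sum.

End binomial_series.

(** * Integration against a density *)

Section density.
Local Open Scope ereal_scope.
Context {d} {T : measurableType d} {R : realType}.
Variables (mu nu : {measure set T -> \bar R}) (p : T -> R).
Hypotheses (mp : measurable_fun setT p) (p0 : forall x, (0 <= p x)%R)
  (nuE : forall A, measurable A -> nu A = \int[mu]_(x in A) (p x)%:E).

Import HBNNSimple.

(** The identity holds for indicators by [nuE], hence for simple functions, and passes to the limit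
    by monotone convergence on both sides. *)
Lemma ge0_integral_density (f : T -> \bar R) : measurable_fun setT f ->
  (forall x, 0 <= f x) -> \int[nu]_x f x = \int[mu]_x (f x * (p x)%:E).
Proof.
move=> mf f0; pose h := nnsfun_approx measurableT mf.
have mpE : measurable_fun setT (EFin \o p) by exact/measurable_EFinP.
have pE0 x : 0 <= (p x)%:E by rewrite lee_fin.
have -> : \int[nu]_x f x = lim (\int[nu]_x (EFin \o h n) x @[n --> \oo]).
  have fE x : f x = lim ((EFin \o h n) x @[n --> \oo]).
    by apply/esym/cvg_lim => //; exact: cvg_nnsfun_approx.
  under eq_integral do rewrite fE.
  apply: monotone_convergence => //.
  - by move=> n; apply/measurable_EFinP; exact/measurable_funP.
  - by move=> n x _ //=; rewrite lee_fin.
  - by move=> x _ a b ab; rewrite lee_fin; exact/lefP/nd_nnsfun_approx.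
have -> : \int[mu]_x (f x * (p x)%:E) =
    lim (\int[mu]_x ((EFin \o h n) x * (p x)%:E) @[n --> \oo]).
  have fg x : f x * (p x)%:E = lim (((EFin \o h n) x * (p x)%:E) @[n --> \oo]).
    by apply/esym/cvg_lim => //; apply: cvgeZr => //; exact: cvg_nnsfun_approx.
  under eq_integral do rewrite fg.
  apply: monotone_convergence => //.
  - by move=> n; apply/emeasurable_funM => //; exact/measurable_EFinP.
  - by move=> n x _ /=; rewrite mule_ge0 ?lee_fin.
  - move=> x _ a b ab/=; rewrite lee_wpmul2r ?lee_fin//.
    exact/lefP/nd_nnsfun_approx.
suff suf n : \int[mu]_x ((EFin \o h n) x * (p x)%:E) = \int[nu]_x (EFin \o h n) x.
  by under [in RHS]eq_fun do rewrite suf.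
transitivity (\int[nu]_x
   (\sum_(y \in range (h n)) (y * \1_(h n @^-1` [set y]) x)%:E)); last first.
  by apply: eq_integral => t tE; rewrite /= fimfunE -fsumEFin.
have indich m r : measurable_fun setT (fun x => (r * \1_(h m @^-1` [set r]) x)%:E).
  by apply: (measurable_comp measurableT) => //; exact: measurable_funM.
rewrite ge0_integral_fsum//; last by move=> m y Ey; exact: nnfun_muleindic_ge0.
transitivity (\int[mu]_x (\sum_(y \in range (h n))
    (y * \1_(h n @^-1` [set y]) x)%:E * (p x)%:E)).
  under [RHS]eq_integral => x xE.
    rewrite -ge0_mule_fsuml => [|y]; last exact: nnfun_muleindic_ge0.
    rewrite fsumEFin // -(fimfunE _ x); over.
  by [].
rewrite ge0_integral_fsum//; last 2 first.
  - by move=> y; apply: emeasurable_funM.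
  - by move=> m y Ey; rewrite mule_ge0// nnfun_muleindic_ge0.
apply: eq_fsbigr => r rhn.
under [RHS]eq_integral do rewrite EFinM.
rewrite integralZl_indic_nnsfun => //.
under eq_integral do rewrite EFinM -muleA.
rewrite ge0_integralZl//.
- under eq_integral do rewrite muleC.
  rewrite (eq_integral ((EFin \o p) \_ (h n @^-1` [set r]))); last first.
    by move=> x xE; rewrite epatch_indic.
  by rewrite -integral_mkcondr setTI -nuE// integral_indic// setIT.
- by apply: emeasurable_funM => //; exact/measurable_EFinP.
- by move=> t Et; rewrite mule_ge0 ?lee_fin.
- by move: rhn; rewrite inE => -[t _ <-]; rewrite lee_fin.
Qed.

End density.

(** * Scaling of Lebesgue measure *)

Section lebesgue_scaling.
Context {R : realType}.
Local Notation mu := (@lebesgue_measure R).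
Variable c : R.
Hypothesis c0 : 0 < c.

Let scale : measurableTypeR R -> measurableTypeR R := fun x => c * x.

Let mscale_fun : measurable_fun setT scale.
Proof. exact: measurable_funM. Qed.

(** The right-hand side is a measure giving []a, b]] its length, and Lebesgue measure is the only
    one with that property. *)
Lemma lebesgue_measure_scale (A : set R) : measurable A ->
  lebesgue_measure A = (c%:E * lebesgue_measure (scale @^-1` A))%E.
Proof.
have c0' : 0 <= c by exact: ltW.
have @m : {measure set (measurableTypeR R) -> \bar R}.
  by refine (mscale (NngNum c0') (pushforward mu scale)); exact: mscale_fun.
move=> mA; rewrite -[RHS]/(m A); apply: lebesgue_measure_unique => //.
move=> _ [[a b] _ <-].
rewrite -[RHS]/(c%:E * lebesgue_measure (scale @^-1` `]a, b]%classic))%E /=.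
have -> : scale @^-1` `]a, b]%classic = `]a / c, b / c]%classic.
  apply/seteqP; split => x /=; rewrite !in_itv/= ltr_pdivrMr// ler_pdivlMr//;
    by rewrite [x * c]mulrC.
rewrite !lebesgue_measure_itv/= !lte_fin ltr_pM2r ?invr_gt0//.
case: ifPn => _; last by rewrite mule0.
by rewrite -!EFinB -EFinM -mulrBl mulrC divfK// gt_eqF.
Qed.

Lemma ge0_integral_scale (f : R -> \bar R) : measurable_fun setT f ->
  (forall x, 0 <= f x)%E ->
  (\int[mu]_x f x = c%:E * \int[mu]_x f (c * x)%R)%E.
Proof.
move=> mf f0; have c0' : 0 <= c by exact: ltW.
have @m : {measure set (measurableTypeR R) -> \bar R}.
  by refine (mscale (NngNum c0') (pushforward mu scale)); exact: mscale_fun.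
rewrite (eq_measure_integral m); last by move=> A mA _; exact: lebesgue_measure_scale.
by rewrite ge0_integral_mscale// ge0_integral_pushforward.
Qed.

End lebesgue_scaling.

(** * Difference quotients of exponentials and powers *)

Section expR_quotient.
Context {R : realType}.
Implicit Types x y : R.

Lemma one_sub_expRN_le y : 1 - expR (- y) <= y.
Proof. by rewrite lerBlDr addrC -lerBlDr; exact: expR_ge1Dx. Qed.

Lemma one_sub_expRN_ge y : 0 <= y -> y / (1 + y) <= 1 - expR (- y).
Proof.
move=> y0; have y1 : 0 < 1 + y by rewrite ltr_pwDl.
rewrite ler_pdivrMr// mulrBl mul1r lerBrDr.
suff : expR (- y) * (1 + y) <= 1 by lra.
by rewrite expRN mulrC ler_pdivrMr ?expR_gt0// mul1r expR_ge1Dx.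
Qed.

Lemma cvg_invS : (n.+1%:R^-1 : R) @[n --> \oo] --> 0.
Proof. exact: cvg_harmonic. Qed.

(** Squeeze between m / (1 + h m) and m. The factor m varies with n because the jump rates are
    themselves evaluated at a moving point. *)
Lemma cvg_expR_quotient (h m : nat -> R) (x : R) :
  (forall n, 0 < h n) -> h n @[n --> \oo] --> 0 -> (forall n, 0 <= m n) ->
  m n @[n --> \oo] --> x ->
  (1 - expR (- (h n * m n))) / h n @[n --> \oo] --> x.
Proof.
move=> h0 ch m0 cm; apply: (@squeeze_cvgr _ _ _ _
  (fun n => m n / (1 + h n * m n)) m) => //.
- apply: nearW => n; have := h0 n; move: (h n) (m n) (m0 n) => {h0 ch m0 cm}h {}m m0 h0.
  rewrite ler_pdivlMr// ler_pdivrMr// [m * h]mulrC one_sub_expRN_le andbT.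
  have -> : m / (1 + h * m) * h = (h * m) / (1 + h * m) by ring.
  by rewrite one_sub_expRN_ge// mulr_ge0// ltW.
- rewrite -[X in _ --> X]divr1; apply: cvgM => //.
  apply: cvgV; first exact: oner_neq0.
  rewrite -[X in _ --> X]addr0; apply: cvgD; first exact: cvg_cst.
  by rewrite -[X in _ --> X](mul0r x); apply: cvgM.
Qed.

(** The limit is minus the derivative of (1 + h)^(-s) at h = 0. Writing the power as exp(- s ln (1 +
    h)), with h / (1 + h) <= ln (1 + h) <= h, reduces it to a squeeze. *)
Lemma cvg_powR_quotient s : 0 < s ->
  (1 - (1 + n.+1%:R^-1) `^ (- s)) / n.+1%:R^-1 @[n --> \oo] --> (s : R).
Proof.
move=> s0; apply: (@squeeze_cvgr _ _ _ _
  (fun n => s / ((1 + n.+1%:R^-1) * (1 + s * n.+1%:R^-1))) (fun=> s)).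
- apply: nearW => n; set h := (n.+1%:R^-1 : R); have h0 : 0 < h by rewrite invr_gt0.
  clearbody h.
  have h1 : 0 < 1 + h by rewrite addr_gt0.
  rewrite /powR gt_eqF// mulNr; set y := s * ln (1 + h).
  have yle : y <= s * h.
    by rewrite ler_pM2l// le_ln1Dx// (lt_trans _ h0)// ltrN10.
  have yge : s * (h / (1 + h)) <= y.
    rewrite ler_pM2l// -lerN2 -lnV ?posrE//.
    have e : (1 + h)^-1 = 1 + - (h / (1 + h)) by field; rewrite gt_eqF.
    rewrite [X in ln X]e; apply: le_ln1Dx; rewrite ltrN2 ltr_pdivrMr// mul1r; lra.
  have y0 : 0 <= y.
    by apply: le_trans yge; rewrite mulr_ge0 ?divr_ge0 ?(ltW s0) ?(ltW h0) ?(ltW h1).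
  rewrite ler_pdivlMr// ler_pdivrMr//; apply/andP; split; last first.
    exact: le_trans (one_sub_expRN_le _) yle.
  apply: le_trans (one_sub_expRN_ge y0).
  have sh0 : 0 < 1 + s * h by rewrite addr_gt0 ?mulr_gt0.
  have -> : s / ((1 + h) * (1 + s * h)) * h = s * (h / (1 + h)) / (1 + s * h).
    by field; rewrite !gt_eqF.
  apply: ler_pM => //.
  + by rewrite mulr_ge0 ?divr_ge0 ?(ltW s0) ?(ltW h0) ?(ltW h1).
  + by rewrite invr_ge0 ltW.
  + by rewrite lef_pV2 ?posrE ?lerD2l// ltr_wpDr.
- rewrite -[X in _ --> X]divr1; apply: cvgM; first exact: cvg_cst.
  apply: cvgV; first exact: oner_neq0.
  rewrite -[X in _ --> X]mulr1; apply: cvgM.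
    rewrite -[X in _ --> X]addr0; apply: cvgD; [exact: cvg_cst|exact: cvg_invS].
  rewrite -[X in _ --> X]addr0; apply: cvgD; first exact: cvg_cst.
  rewrite -[X in _ --> X](mulr0 s); apply: cvgM; [exact: cvg_cst|exact: cvg_invS].
- exact: cvg_cst.
Qed.

End expR_quotient.

(** * Gamma integrals deduced from normalised densities *)

Section gamma_integrals.
Context {R : realType}.
Local Notation mu := (@lebesgue_measure R).
Implicit Types (s A x : R).

(** The gamma density without its constant; the rate A is kept free so that multiplication by an
    exponential stays in the family. *)
Definition gamma_kernel s A x : R :=
  if 0 < x then x `^ (s - 1) * expR (- (A * x)) else 0.

Definition gamma_integral s A : \bar R := (\int[mu]_x (gamma_kernel s A x)%:E)%E.

Lemma gamma_kernel_ge0 s A x : 0 <= gamma_kernel s A x.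
Proof.
by rewrite /gamma_kernel; case: ifP => // _; rewrite mulr_ge0 ?powR_ge0 ?expR_ge0.
Qed.

Lemma measurable_gamma_kernel s A : measurable_fun setT (gamma_kernel s A).
Proof.
apply: measurable_fun_ifT => //.
  exact: measurable_fun_ltr.
apply: measurable_funM; first exact: measurable_powR.
apply: (measurableT_comp (@measurable_expR R)); apply: measurable_funN.
exact: measurable_funM.
Qed.

Let measurable_gamma_kernelE s A :
  measurable_fun [set: measurableTypeR R] (fun x => (gamma_kernel s A x)%:E).
Proof. by apply: measurableT_comp => //; exact: measurable_gamma_kernel. Qed.

Lemma gamma_functionE s : gamma_function s = fine (gamma_integral s 1).
Proof.
rewrite /gamma_function /Rintegral; congr fine.
rewrite integral_mkcond; apply: eq_integral => x _.
rewrite patchE /gamma_kernel; have [x0|x0] := ltP 0 x.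
  by rewrite mem_set ?mul1r//= in_itv/= x0.
by rewrite memNset//= in_itv/= andbT; apply/negP; rewrite -leNgt.
Qed.

Lemma gamma_pdfE s A x :
  gamma_pdf s A x = A `^ s / gamma_function s * gamma_kernel s A x.
Proof.
by rewrite /gamma_pdf /gamma_kernel; case: ifP; rewrite ?mulr0// mulrA.
Qed.

Lemma gamma_integral_ge0 s A : (0 <= gamma_integral s A)%E.
Proof. by apply: integral_ge0 => x _; rewrite lee_fin gamma_kernel_ge0. Qed.

Lemma gamma_function_ge0 s : 0 <= gamma_function s.
Proof. by rewrite gamma_functionE fine_ge0// gamma_integral_ge0. Qed.

(** Change of variable x -> A x, stated in the extended reals because finiteness is not yet
    known. *)
Lemma gamma_integral_scale s A : 0 < s -> 0 < A ->
  gamma_integral s 1 = ((A `^ s)%:E * gamma_integral s A)%E.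
Proof.
move=> s0 A0; rewrite /gamma_integral (ge0_integral_scale A0); last 2 first.
- exact: measurable_gamma_kernelE.
- by move=> x; rewrite lee_fin gamma_kernel_ge0.
have kE x : gamma_kernel s 1 (A * x) = A `^ (s - 1) * gamma_kernel s A x.
  rewrite /gamma_kernel pmulr_rgt0//; case: ifP => x0; last by rewrite mulr0.
  by rewrite powRM ?(ltW A0) ?(ltW x0)// mul1r mulrA.
under eq_integral do rewrite kE EFinM.
rewrite ge0_integralZl//; last 2 first.
- by move=> x _; rewrite lee_fin gamma_kernel_ge0.
- by rewrite lee_fin powR_ge0.
by rewrite muleA -EFinM mulr_powRB1// ltW.
Qed.

Section normalized.
Variable a : R.
Hypotheses (a0 : 0 < a)
  (pdf1 : forall s, 0 < s -> (\int[mu]_x (gamma_pdf s a x)%:E = 1)%E).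

Let norm1 s : 0 < s -> ((a `^ s / gamma_function s)%:E * gamma_integral s a = 1)%E.
Proof.
move=> s0; rewrite -[RHS](pdf1 s0) /gamma_integral.
rewrite -ge0_integralZl//; last 2 first.
- by move=> x _; rewrite lee_fin gamma_kernel_ge0.
- by rewrite lee_fin divr_ge0 ?powR_ge0 ?gamma_function_ge0.
by apply: eq_integral => x _; rewrite gamma_pdfE EFinM.
Qed.

(** [fine] sends an infinite integral to 0 and the inverse of 0 is 0, so a Gamma integral that is
    zero or infinite would make the density vanish identically, against total mass 1. *)
Lemma gamma_function_gt0 s : 0 < s -> 0 < gamma_function s.
Proof.
move=> s0; rewrite lt0r gamma_function_ge0 andbT; apply/eqP => G0.
by have := norm1 s0; rewrite G0 invr0 mulr0 mul0e => -[] /eqP; rewrite eq_sym oner_eq0.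
Qed.

Lemma gamma_integral1 s : 0 < s -> gamma_integral s 1 = (gamma_function s)%:E.
Proof.
move=> s0; have := gamma_function_gt0 s0; rewrite gamma_functionE.
by case: (gamma_integral s 1) => [r _ //| |] /=; rewrite ltxx.
Qed.

(** An infinite value is impossible: multiplied by A^s > 0 it would have to be the finite number
    Gamma(s). *)
Lemma gamma_integralE s A : 0 < s -> 0 < A ->
  gamma_integral s A = (gamma_function s / A `^ s)%:E.
Proof.
move=> s0 A0; have := gamma_integral_scale s0 A0; rewrite gamma_integral1//.
have As0 : 0 < A `^ s by rewrite powR_gt0.
case: (gamma_integral s A) (gamma_integral_ge0 s A) => [r|_|//].
- by move=> _ [->]; congr EFin; rewrite mulrAC divff ?mul1r// gt_eqF.
- by rewrite gt0_muley// lte_fin.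
Qed.

Let h n : R := n.+1%:R^-1.

Let h0 n : 0 < h n.
Proof. by rewrite invr_gt0. Qed.

(* Both sides are the limit of [int x^(s-1) (e^(-x) - e^(-(1+h)x)) / h] as
   [h] goes to 0: on the left by dominated convergence, on the right because
   [int x^(s-1) e^(-(1+h)x) = Gamma(s) (1+h)^(-s)]. *)
Lemma gamma_functionS s : 0 < s ->
  gamma_function (s + 1) = s * gamma_function s.
Proof.
move=> s0; have s10 : 0 < s + 1 by rewrite addr_gt0.
pose F n x := (gamma_kernel s 1 x - gamma_kernel s (1 + h n) x) / h n.
have FE n x : 0 < x ->
    F n x = x `^ (s - 1) * expR (- x) * ((1 - expR (- (h n * x))) / h n).
  move=> x0; rewrite /F /gamma_kernel x0 (mulrDl 1 (h n) x) !mul1r opprD expRD.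
  by rewrite [RHS]mulrA; congr (_ / _); ring.
(* Since (1 - exp(- h x)) / h <= x, the quotients are dominated by the kernel of parameter s + 1,
   integrable by [gamma_integral1]. *)
have F_ge0 n x : 0 <= F n x <= gamma_kernel (s + 1) 1 x.
  have [x0|x0] := ltP 0 x; last first.
    by rewrite /F /gamma_kernel ltNge x0/= subrr mul0r lexx.
  have hx : 0 <= h n * x by rewrite mulr_ge0 ?(ltW x0) ?(ltW (h0 n)).
  rewrite FE//; apply/andP; split.
    rewrite mulr_ge0 ?mulr_ge0 ?powR_ge0 ?expR_ge0 ?invr_ge0 ?(ltW (h0 n))//.
    by rewrite subr_ge0 expR_le1 oppr_le0.
  rewrite /gamma_kernel x0 mul1r addrK.
  have -> : x `^ s * expR (- x) = x `^ (s - 1) * expR (- x) * x.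
    by rewrite -(mulr_powRB1 (ltW x0) s0); ring.
  apply: ler_wpM2l; first by rewrite mulr_ge0 ?powR_ge0 ?expR_ge0.
  by rewrite ler_pdivrMr// [x * _]mulrC one_sub_expRN_le.
have mF n : measurable_fun setT (F n).
  apply: measurable_funM => //; apply: measurable_funB;
    exact: measurable_gamma_kernel.
have cF x : F n x @[n --> \oo] --> gamma_kernel (s + 1) 1 x.
  have [x0|x0] := ltP 0 x; last first.
    rewrite /gamma_kernel ltNge x0/=; apply: cvg_near_cst; apply: nearW => n.
    by rewrite /F /gamma_kernel ltNge x0/= subrr mul0r.
  have -> : F ^~ x = (fun n => x `^ (s - 1) * expR (- x) * ((1 - expR (- (h n * x))) / h n)).
    by apply/funext => n; rewrite FE.
  have -> : gamma_kernel (s + 1) 1 x = x `^ (s - 1) * expR (- x) * x.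
    rewrite /gamma_kernel x0 mul1r addrK -(mulr_powRB1 (ltW x0) s0); ring.
  by apply: cvgMr; exact: (cvg_expR_quotient h0 cvg_invS (fun=> ltW x0) (cvg_cst _)).
have ik A : 0 < A -> mu.-integrable setT (fun x => (gamma_kernel s A x)%:E).
  move=> A0; apply/integrableP; split; first exact: measurable_gamma_kernelE.
  under eq_integral do rewrite gee0_abs ?lee_fin ?gamma_kernel_ge0//.
  by rewrite -/(gamma_integral s A) gamma_integralE// ltry.
have ik1 : mu.-integrable setT (fun x => (gamma_kernel (s + 1) 1 x)%:E).
  apply/integrableP; split; first exact: measurable_gamma_kernelE.
  under eq_integral do rewrite gee0_abs ?lee_fin ?gamma_kernel_ge0//.
  by rewrite -/(gamma_integral (s + 1) 1) gamma_integral1// ltry.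
have intF n : (\int[mu]_x (F n x)%:E =
    (gamma_function s * ((1 - (1 + h n) `^ (- s)) / h n))%:E)%E.
  have h10 : 0 < 1 + h n by rewrite addr_gt0.
  rewrite /F; under eq_integral do rewrite mulrC EFinM EFinB.
  rewrite integralZl//; last by apply: integrableB => //; exact: ik.
  rewrite integralB//; [|exact: ik|exact: ik].
  rewrite -/(gamma_integral s 1) -/(gamma_integral s (1 + h n)).
  rewrite gamma_integral1// gamma_integralE// -EFinB -EFinM powRN.
  by congr EFin; ring.
have cF' x : setT x ->
    (EFin \o F n) x @[n --> \oo] --> (gamma_kernel (s + 1) 1 x)%:E.
  by move=> _; apply/fine_cvgP; split; [exact: nearW|exact: cF].
have bF x n : setT x -> (`|(EFin \o F n) x| <= (gamma_kernel (s + 1) 1 x)%:E)%E.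
  by move=> _; have /andP[? ?] := F_ge0 n x; rewrite /= ger0_norm ?lee_fin.
have mF' n : measurable_fun [set: measurableTypeR R] (EFin \o F n).
  by apply: measurableT_comp => //; exact: mF.
have [_ _ cvgL] := @dominated_convergence _ _ _ mu _ measurableT
  (fun n => EFin \o F n) (fun x => (gamma_kernel (s + 1) 1 x)%:E)
  (fun x => (gamma_kernel (s + 1) 1 x)%:E) mF' (measurable_gamma_kernelE _ _)
  (aeW mu cF') ik1 (aeW mu bF).
rewrite -/(gamma_integral (s + 1) 1) gamma_integral1// in cvgL.
have cvgR : (gamma_function s * ((1 - (1 + h n) `^ (- s)) / h n)) @[n --> \oo]
    --> gamma_function s * s by apply: cvgMr; exact: cvg_powR_quotient.
have cvgL' : (gamma_function s * ((1 - (1 + h n) `^ (- s)) / h n)) @[n --> \oo]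
    --> gamma_function (s + 1).
  rewrite (_ : (fun n => _) = fine \o [sequence (\int[mu]_x (EFin \o F n) x)%E]_n).
    exact: fine_cvg.
  by apply/funext => n; rewrite /= intF.
rewrite [RHS]mulrC.
by rewrite -[RHS](cvg_lim _ cvgR)// -[LHS](cvg_lim _ cvgL').
Qed.

(** n! times [binomial_coeff s n] is s (s + 1) ... (s + n - 1), one factor per use of the functional
    equation. *)
Lemma gamma_functionDn s n : 0 < s ->
  gamma_function (s + n%:R) = gamma_function s * (n`!%:R * binomial_coeff s n).
Proof.
move=> s0; elim: n => [|n ih].
  by rewrite addr0 fact0 binomial_coeff0 !mulr1.
have sn0 : 0 < s + n%:R by rewrite ltr_wpDr.
rewrite -natr1 addrA gamma_functionS// ih factS natrM.
by rewrite [n.+1%:R * _]mulrC -mulrA binomial_coeffS; ring.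
Qed.

End normalized.
End gamma_integrals.

(** * The complex exponential series *)

Section exponential_series.
Context {R : realType}.
Variable z : R[i].

Let is_cvg_exp_pseries (L : R[i] -> R) (A v : R) :
  (forall y, `|L y| <= A * cmod y) ->
  cvgn (pseries (fun n => n`!%:R^-1 * L (z ^+ n)) v).
Proof.
move=> LA; apply: normed_cvg => /=.
have A0 : 0 <= A by have := LA 1; rewrite cmod1 mulr1; exact: le_trans.
apply: (@series_le_cvg _ _ (A *: exp_coeff (cmod z * `|v|))).
- by move=> n /=.
- move=> n; rewrite -[X in 0 <= X]/(A * exp_coeff (cmod z * `|v|) n).
  by rewrite mulr_ge0// exp_coeff_ge0// mulr_ge0 ?cmod_ge0.
- move=> n; rewrite -[leLHS]/(`|n`!%:R^-1 * L (z ^+ n) * v ^+ n|).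
  rewrite -[leRHS]/(A * ((cmod z * `|v|) ^+ n / n`!%:R)).
  rewrite !normrM ger0_norm ?invr_ge0// normrX exprMn -cmodX -mulrA mulrC.
  by rewrite !mulrA ler_wpM2r ?invr_ge0// ler_wpM2r ?exprn_ge0.
- by apply: is_cvg_seriesZ; exact: is_cvg_series_exp_coeff.
Qed.

Let exp_pseries_diffs (L : R[i] -> R) :
  pseries_diffs (fun n => n`!%:R^-1 * L (z ^+ n)) =
  (fun n => n`!%:R^-1 * L (z * z ^+ n)).
Proof.
apply/funext => n; rewrite /pseries_diffs exprS mulrA factS natrM invfM mulrA.
by rewrite mulfV ?mul1r// pnatr_eq0.
Qed.

Let Phi v : R[i] := limn (pseries (fun n => n`!%:R^-1 * complex.Re (z ^+ n)) v)
  +i* limn (pseries (fun n => n`!%:R^-1 * complex.Im (z ^+ n)) v).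

Let a := complex.Re z.
Let b := complex.Im z.

Let Re_le (y : R[i]) : `|complex.Re y| <= 1 * cmod y.
Proof. by rewrite mul1r ler_Re_cmod. Qed.

Let Im_le (y : R[i]) : `|complex.Im y| <= 1 * cmod y.
Proof. by rewrite mul1r ler_Im_cmod. Qed.

Let cvgc_Phi v :
  cvgc (fun N => \sum_(n < N) (n`!%:R^-1 : R)%:C * (v%:C * z) ^+ n) (Phi v).
Proof.
have cR := is_cvg_exp_pseries Re_le (v := v); have cI := is_cvg_exp_pseries Im_le (v := v).
have E N : \sum_(n < N) (n`!%:R^-1 : R)%:C * (v%:C * z) ^+ n =
    (pseries (fun n => n`!%:R^-1 * complex.Re (z ^+ n)) v N) +i*
    (pseries (fun n => n`!%:R^-1 * complex.Im (z ^+ n)) v N).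
  rewrite /pseries /series /=.
  elim: N => [|N ih]; first by rewrite big_ord0 !big_geq.
  rewrite big_ord_recr ih !big_nat_recr//= exprMn -rmorphXn.
  by apply: complex_eq; rewrite ?ReD ?ImD ?ReM ?ImM /= ?ReM ?ImM /=; ring.
by split; under eq_fun do rewrite E /=.
Qed.

Let is_derive_pseries (L : R[i] -> R) (A v : R) :
  (forall y, `|L y| <= A * cmod y) ->
  is_derive v 1 (fun v => limn (pseries (fun n => n`!%:R^-1 * L (z ^+ n)) v))
    (limn (pseries (fun n => n`!%:R^-1 * L (z * z ^+ n)) v)).
Proof.
move=> LA.
have bL (L0 : R[i] -> R) (B : R) : (forall y, `|L0 y| <= B * cmod y) ->
    forall y, `|L0 (z * y)| <= (B * cmod z) * cmod y.
  by move=> LB y; rewrite -mulrA -cmodM.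
have := @pseries_snd_diffs _ (fun n => n`!%:R^-1 * L (z ^+ n)) (`|v| + 1) v.
rewrite (exp_pseries_diffs L) (exp_pseries_diffs (fun y => L (z * y))).
apply.
- exact: is_cvg_exp_pseries LA.
- exact: is_cvg_exp_pseries (bL _ _ LA).
- exact: is_cvg_exp_pseries (bL _ _ (bL _ _ LA)).
- by rewrite [ltRHS]ger0_norm ?addr_ge0// ltrDl.
Qed.

Let is_derive_Phi (v : R) :
  is_derive v 1 (fun v => complex.Re (Phi v))
    (a * complex.Re (Phi v) - b * complex.Im (Phi v)) /\
  is_derive v 1 (fun v => complex.Im (Phi v))
    (a * complex.Im (Phi v) + b * complex.Re (Phi v)).
Proof.
have cR := is_cvg_exp_pseries Re_le (v := v); have cI := is_cvg_exp_pseries Im_le (v := v).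
have dR := is_derive_pseries v Re_le; have dI := is_derive_pseries v Im_le.
split; [apply: is_derive_eq dR _|apply: is_derive_eq dI _]; apply/cvg_lim => //.
  rewrite (_ : pseries _ v = fun N =>
    a * pseries (fun n => n`!%:R^-1 * complex.Re (z ^+ n)) v N
    - b * pseries (fun n => n`!%:R^-1 * complex.Im (z ^+ n)) v N).
    by apply: cvgB; apply: cvgMr.
  apply/funext => N; rewrite /pseries /series /=.
  rewrite !mulr_sumr -sumrB; apply: eq_bigr => n _.
  by rewrite ReM; ring.
rewrite (_ : pseries _ v = fun N =>
  a * pseries (fun n => n`!%:R^-1 * complex.Im (z ^+ n)) v N
  + b * pseries (fun n => n`!%:R^-1 * complex.Re (z ^+ n)) v N).
  by apply: cvgD; apply: cvgMr.
apply/funext => N; rewrite /pseries /series /=.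
rewrite !mulr_sumr -big_split; apply: eq_bigr => n _ /=.
by rewrite ImM; ring.
Qed.

Let h v := Phi v * cexp (v%:C * - z).

Let is_derive_h (v : R) :
  is_derive v 1 (fun v => complex.Re (h v)) 0 /\
  is_derive v 1 (fun v => complex.Im (h v)) 0.
Proof.
have [dC dS] := is_derive_Phi v.
set C := (fun v : R => complex.Re (Phi v)) in dC *.
set S := (fun v : R => complex.Im (Phi v)) in dS *.
have dA := is_deriveM_fun (is_derive_id v (1 : R)) (is_derive_cst (- a) v 1).
have dB := is_deriveM_fun (is_derive_id v (1 : R)) (is_derive_cst (- b) v 1).
have dE := @is_derive_comp_fun R (@expR R) _ v _ _ (is_derive_expR _) dA.
have dcos := @is_derive_comp_fun R (@cos R) _ v _ _ (is_derive_cos _) dB.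
have dsin := @is_derive_comp_fun R (@sin R) _ v _ _ (is_derive_sin _) dB.
have dEc := is_deriveM_fun dE dcos; have dEs := is_deriveM_fun dE dsin.
split.
  have -> : (fun v => complex.Re (h v)) = (fun v =>
      C v * (expR (v * - a) * cos (v * - b)) - S v * (expR (v * - a) * sin (v * - b))).
    apply/funext => u; rewrite /h ReM cexpE (ReM u%:C) (ImM u%:C) ReN ImN /=.
    by rewrite !mul0r subr0 addr0.
  have d1 := is_deriveB_fun (is_deriveM_fun dC dEc) (is_deriveM_fun dS dEs).
  by apply: is_derive_eq d1 _; rewrite /C /S /cst; ring.
have -> : (fun v => complex.Im (h v)) = (fun v =>
    C v * (expR (v * - a) * sin (v * - b)) + S v * (expR (v * - a) * cos (v * - b))).
  apply/funext => u; rewrite /h ImM cexpE (ReM u%:C) (ImM u%:C) ReN ImN /=.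
  by rewrite !mul0r subr0 addr0.
have d1 := is_deriveD_fun (is_deriveM_fun dC dEs) (is_deriveM_fun dS dEc).
by apply: is_derive_eq d1 _; rewrite /C /S /cst; ring.
Qed.

(** The sum [Phi] satisfies Phi' = z Phi in v, so Phi(v) exp(- v z) is constant, equal to its value
    1 at v = 0. *)
Theorem cexp_series :
  cvgc (fun N => \sum_(n < N) (n`!%:R^-1 : R)%:C * z ^+ n) (cexp z).
Proof.
have := cvgc_Phi 1; rewrite mul1r.
suff -> : Phi 1 = cexp z by [].
have Phi0 : Phi 0 = 1.
  apply: cvgc_unique (cvgc_Phi 0) _.
  apply: cvgc_near (cvgc_cst _); near=> N.
  have N0 : (0 < N)%N by near: N; exact: nbhs_infty_gt.
  rewrite -(prednK N0) big_ord_recl fact0 invr1 mul0r expr0 mulr1 big1 ?addr0//.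
  by move=> n _; rewrite /= exprS mul0r mulr0.
have : h 1 = h 0.
  apply: complex_eq.
    exact: (@is_derive_0_is_cst _ (fun v => complex.Re (h v)) 1 0
      (fun v => (is_derive_h v).1)).
  exact: (@is_derive_0_is_cst _ (fun v => complex.Im (h v)) 1 0
    (fun v => (is_derive_h v).2)).
rewrite /h Phi0 mul0r cexp0 mulr1 mul1r cexpN => e.
by rewrite -[LHS](mulfVK (cexp_neq0 z)) e mul1r.
Unshelve. all: by end_near. Qed.

(** A bound uniform in N, from which the dominating function of the gamma transform is built. *)
Lemma cmod_exp_sum_le N :
  cmod (\sum_(n < N) (n`!%:R^-1 : R)%:C * z ^+ n) <= expR (cmod z).
Proof.
apply: (@le_trans _ _ (series (exp_coeff (cmod z)) N)).
  rewrite /series /= big_mkord; elim: N => [|N ih].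
    by rewrite !big_ord0 (cmod_real 0) normr0.
  rewrite !big_ord_recr /= (le_trans (cmodD _ _))// lerD//.
  by rewrite cmodM cmod_real cmodX ger0_norm ?invr_ge0// mulrC.
rewrite /expR; apply: nondecreasing_cvgn_le.
  by apply: nondecreasing_series => n _ _; rewrite exp_coeff_ge0// cmod_ge0.
exact: is_cvg_series_exp_coeff.
Qed.

End exponential_series.

(** Dividing by A > 0 leaves the argument unchanged and lowers ln |z| by ln A. *)
Lemma clog_scale {R : realType} (A : R) (z : R[i]) : 0 < A -> 0 < complex.Re z ->
  clog (z / A%:C) = clog z - (ln A)%:C.
Proof.
move=> A0 z0; have An0 : A != 0 by rewrite gt_eqF.
have -> : z / A%:C = (complex.Re z / A) +i* (complex.Im z / A).
  by rewrite -fmorphV /=; apply: complex_eq; rewrite ?ReM ?ImM /=; ring.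
have zn0 : complex.Re z != 0 by rewrite gt_eqF.
rewrite /clog /=; apply: complex_eq; rewrite ?ReD ?ImD ?ReN ?ImN /=.
  rewrite !expr_div_n -mulrDl ln_div ?posrE ?exprn_gt0//; last first.
    by rewrite ltr_wpDr ?sqr_ge0// exprn_gt0.
  by rewrite lnXn// mulrBl mulr2n; congr (_ - _); field.
by rewrite subr0; congr atan; field; rewrite An0 zn0.
Qed.

(** * Exponential moments and complex transform of a gamma variable *)

Section gamma_variable.
Context {d} {T : measurableType d} {R : realType} (P : probability T R).
Variables (a s : R) (Z : T -> R).
Hypotheses (a0 : 0 < a) (s0 : 0 < s)
  (pdf1 : forall s, 0 < s -> (\int[@lebesgue_measure R]_x (gamma_pdf s a x)%:E = 1)%E)
  (mZ : measurable_fun setT Z) (Z_ge0 : forall w, 0 <= Z w)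
  (lawZ : forall A : set R, measurable A -> P (Z @^-1` A) =
     (\int[@lebesgue_measure R]_(x in A) (gamma_pdf s a x)%:E)%E).

Let Z_rv : {mfun T >-> measurableTypeR R} :=
  HB.pack (Z : T -> measurableTypeR R)
    (isMeasurableFun.Build _ _ _ _ (Z : T -> measurableTypeR R) mZ).

(** Weighting the gamma density by x^n exp(- b x) gives, up to a constant, the kernel of shape s + n
    and rate a + b; hence b may be negative as long as a + b > 0. *)
Lemma gamma_exp_moment n (b : R) : 0 < a + b ->
  (\int[P]_w (Z w ^+ n * expR (- (b * Z w)))%:E =
   (a `^ s * (n`!%:R * binomial_coeff s n) / (a + b) `^ (s + n%:R))%:E)%E.
Proof.
move=> ab0.
(* The absolute value makes f nonnegative on the whole line, as the passage to the law of Z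
   requires; it is harmless since Z >= 0. *)
pose f (x : measurableTypeR R) := (`|x| ^+ n * expR (- (b * x)))%:E.
have mf : measurable_fun setT f.
  apply: measurableT_comp => //; apply: measurable_funM.
    by apply: measurable_funX; exact: normr_measurable.
  apply: (measurableT_comp (@measurable_expR R)); apply: measurable_funN.
  exact: measurable_funM.
have f0 x : (0 <= f x)%E by rewrite lee_fin mulr_ge0 ?exprn_ge0 ?expR_ge0.
transitivity (\int[P]_w (f \o Z_rv) w)%E.
  by apply: eq_integral => w _; rewrite /f /= ger0_norm.
rewrite -ge0_integral_distribution//.
have pdf_ge0 x : 0 <= gamma_pdf s a x.
  rewrite gamma_pdfE mulr_ge0 ?gamma_kernel_ge0// divr_ge0 ?powR_ge0//.
  exact: gamma_function_ge0.
have mpdf : measurable_fun [set: measurableTypeR R] (gamma_pdf s a).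
  rewrite (_ : gamma_pdf s a = fun x => a `^ s / gamma_function s * gamma_kernel s a x).
    by apply: measurable_funM => //; exact: measurable_gamma_kernel.
  by apply/funext => x; rewrite gamma_pdfE.
rewrite (@ge0_integral_density _ _ _ (@lebesgue_measure R) _ (gamma_pdf s a))//.
have sn0 : 0 < s + n%:R by rewrite ltr_wpDr.
have fE x : (f x * (gamma_pdf s a x)%:E =
    (a `^ s / gamma_function s)%:E * (gamma_kernel (s + n%:R) (a + b) x)%:E)%E.
  rewrite /f -!EFinM gamma_pdfE mulrCA; congr (_ * _)%:E.
  rewrite /gamma_kernel; have [x0|x0] := ltP 0 x; last by rewrite mulr0.
  have -> : s + n%:R - 1 = n%:R + (s - 1) by ring.
  rewrite [in RHS]powRD; last by rewrite (gt_eqF x0) implybT.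
  rewrite powR_mulrn ?(ltW x0)// gtr0_norm// mulrDl opprD expRD; ring.
under eq_integral do rewrite fE.
rewrite ge0_integralZl//; last 3 first.
- by apply: measurableT_comp => //; exact: measurable_gamma_kernel.
- by move=> x _; rewrite lee_fin gamma_kernel_ge0.
- by rewrite lee_fin divr_ge0 ?powR_ge0// gamma_function_ge0.
rewrite -/(gamma_integral (s + n%:R) (a + b)) (gamma_integralE pdf1)//.
rewrite (gamma_functionDn pdf1)// -EFinM; congr EFin.
have Gn0 : gamma_function s != 0 by rewrite gt_eqF// (gamma_function_gt0 pdf1).
by field; rewrite Gn0 gt_eqF// powR_gt0.
Qed.

(** With z = a - c, a real A and delta = A - z, one has exp(c Z) = exp(- (A - a) Z) exp(delta Z).
    Expanding the second factor and integrating termwise gives (a / A)^s times the binomial series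
    at delta / A, whose sum is (z / A)^(- s). *)
Lemma gamma_transform (c : R[i]) : complex.Re c <= 0 ->
  cexpectation P (fun w => cexp ((Z w)%:C * c)) =
  cexp (s%:C * ((ln a)%:C - clog (a%:C - c))).
Proof.
move=> c0; set z := a%:C - c.
have z0 : 0 < complex.Re z by rewrite ReD ReN /= subr_gt0 (le_lt_trans c0).
(* Since |A - z|^2 = A^2 - 2 A Re z + |z|^2, the requirement |A - z| < A amounts to A Re z > |z|^2 /
   2; this choice gives A Re z = a Re z + |z|^2. *)
pose A := a + cmod z ^+ 2 / complex.Re z.
have zn0 : 0 < cmod z.
  by rewrite (lt_le_trans z0)// (le_trans (ler_norm _))// ler_Re_cmod.
have b0 : 0 < cmod z ^+ 2 / complex.Re z by rewrite divr_gt0 ?exprn_gt0.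
have A0 : 0 < A by rewrite addr_gt0.
pose delta := A%:C - z.
have dA : cmod delta < A.
  rewrite cmodE -(@ltr_pXn2r _ 2) ?nnegrE ?sqrtr_ge0 ?(ltW A0)//.
  rewrite sqr_sqrtr ?addr_ge0 ?sqr_ge0// /delta ReD ImD ReN ImN /=.
  have -> : (A - complex.Re z) ^+ 2 + (0 - complex.Im z) ^+ 2 =
    A ^+ 2 + (complex.Re z ^+ 2 + complex.Im z ^+ 2 - 2 * (A * complex.Re z)) by ring.
  have e : cmod z ^+ 2 = complex.Re z ^+ 2 + complex.Im z ^+ 2.
    by rewrite cmodE sqr_sqrtr// addr_ge0 ?sqr_ge0.
  have -> : A * complex.Re z = a * complex.Re z + cmod z ^+ 2.
    by rewrite /A mulrDl divfK// gt_eqF.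
  have : 0 < a * complex.Re z by rewrite mulr_gt0.
  have : 0 < cmod z ^+ 2 by rewrite exprn_gt0.
  by rewrite -e; lra.
pose beta := A - a.
have beta0 : 0 < beta by rewrite /beta /A addrC addKr.
pose f n w := (Z w ^+ n * expR (- (beta * Z w)))%:C.
have mfR n b : measurable_fun setT (fun w => Z w ^+ n * expR (- (b * Z w))).
  apply: measurable_funM; first exact: measurable_funX.
  apply: (measurableT_comp (@measurable_expR R)); apply: measurable_funN.
  exact: measurable_funM.
have mf n : measurable_cfun (f n) by split; [exact: mfR|exact: measurable_cst].
have f_ge0 n w : 0 <= Z w ^+ n * expR (- (beta * Z w)).
  by rewrite mulr_ge0 ?expR_ge0// exprn_ge0.
(* From exp(y) >= y^n / n! with y = beta Z; a bound for each term is what the exchange of integral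
   and finite sum demands. *)
have fb n w : cmod (f n w) <= n`!%:R / beta ^+ n.
  rewrite cmod_real ger0_norm// ler_pdivlMr ?exprn_gt0// expRN.
  rewrite mulrAC ler_pdivrMr ?expR_gt0// -exprMn.
  rewrite [Z w * _]mulrC -ler_pdivrMl ?ltr0n ?fact_gt0//.
  case: n => [|n].
    by rewrite expr0 fact0 mulr1 invr1 -expR0 ler_expR mulr_ge0// ltW.
  have := @expR_ge1Dxn R (beta * Z w) n; rewrite mulr_ge0 ?(ltW beta0)//.
  move=> /(_ isT) h; apply: le_trans h.
  by rewrite [_^-1 * _]mulrC lerDr.
pose F N w := \sum_(n < N) ((n`!%:R^-1)%:C * delta ^+ n) * f n w.
have FE N w : F N w = (\sum_(n < N) (n`!%:R^-1 : R)%:C * (delta * (Z w)%:C) ^+ n)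
     * (expR (- (beta * Z w)))%:C.
  rewrite mulr_suml; apply: eq_bigr => n _.
  by rewrite /f exprMn rmorphM rmorphXn /=; ring.
have mF N : measurable_cfun (F N).
  elim: N => [|N ih].
    by rewrite /F; under eq_fun do rewrite big_ord0; exact: measurable_cfun_cst.
  rewrite /F; under eq_fun do rewrite big_ord_recr /=.
  by apply: measurable_cfunD => //; apply: measurable_cfunM => //;
    exact: measurable_cfun_cst.
(* The rate beta - |delta| may be negative, but a + beta - |delta| = A - |delta| > 0 keeps
   [gamma_exp_moment] applicable; the factor [Z w ^+ 0] matches its case n = 0. *)
pose g w := Z w ^+ 0 * expR (- ((beta - cmod delta) * Z w)).
have g_ge0 w : 0 <= g w by rewrite mulr_ge0 ?expR_ge0 ?exprn_ge0.
have ig : P.-integrable setT (EFin \o g).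
  apply/integrableP; split; first exact/measurable_EFinP/mfR.
  under eq_integral do rewrite /= ger0_norm//.
  rewrite gamma_exp_moment ?ltry//.
  by rewrite /beta addrA subrKC subr_gt0.
have Fg N w : cmod (F N w) <= g w.
  rewrite FE cmodM cmod_real (ger0_norm (expR_ge0 _)) /g expr0 mul1r.
  have -> : expR (- ((beta - cmod delta) * Z w)) =
      expR (cmod delta * Z w) * expR (- (beta * Z w)).
    by rewrite -expRD; congr expR; ring.
  apply: ler_wpM2r; first exact: expR_ge0.
  apply: le_trans (cmod_exp_sum_le _ _) _.
  by rewrite cmodM cmod_real ger0_norm.
have Fcvg w : cvgc (F ^~ w) (cexp ((Z w)%:C * c)).
  rewrite (_ : F ^~ w = fun N => (\sum_(n < N) (n`!%:R^-1 : R)%:C * (delta * (Z w)%:C) ^+ n)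
     * (expR (- (beta * Z w)))%:C); last by apply/funext => N; rewrite FE.
  have -> : cexp ((Z w)%:C * c) = cexp (delta * (Z w)%:C) * (expR (- (beta * Z w)))%:C.
    rewrite -cexp_real -cexpD; congr cexp.
    by rewrite /delta /z /beta rmorphN rmorphM rmorphB /=; ring.
  by apply: cvgcM; [exact: cexp_series|exact: cvgc_cst].
have := dominated_cintegral_cvg measurableT mF ig Fg Fcvg.
rewrite cexpectationE => /cvgc_unique; apply.
have IF N : cintegral P setT (F N) =
    ((a / A) `^ s)%:C * \sum_(n < N) (binomial_coeff s n)%:C * (delta / A%:C) ^+ n.
  rewrite /F.
  rewrite (cintegral_lincomb P (fun n => (n`!%:R^-1 : R)%:C * delta ^+ n) _ measurableT mf fb).
  rewrite mulr_sumr.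
  apply: eq_bigr => n _; rewrite cintegral_real /Rintegral gamma_exp_moment; last first.
    by rewrite /beta subrKC.
  have -> : a + beta = A by rewrite /beta subrKC.
  rewrite /= powRD ?(gt_eqF A0) ?implybT// powR_mulrn ?(ltW A0)//.
  have AsV : A^-1 `^ s = (A `^ s)^-1.
    by rewrite -[A^-1]powR_inv1 ?(ltW A0)// -powRrM mulN1r powRN.
  rewrite (powRM _ (ltW a0)) ?invr_ge0 ?(ltW A0)// AsV.
  have An0 : A != 0 by rewrite gt_eqF.
  have Asn0 : A `^ s != 0 by rewrite gt_eqF// powR_gt0.
  have fn0 : n`!%:R != 0 :> R by rewrite pnatr_eq0 -lt0n fact_gt0.
  rewrite exprMn exprVn -[A%:C ^+ n]rmorphXn -fmorphV /=.
  rewrite mulrAC [RHS]mulrA [RHS]mulrA [RHS]mulrAC; congr (_ * _).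
  rewrite -!rmorphM /=; congr (_ %:C); field.
  by rewrite expf_neq0 ?Asn0.
under eq_fun do rewrite IF.
have -> : cexp (s%:C * ((ln a)%:C - clog z)) =
    ((a / A) `^ s)%:C * cexp (- (s%:C * clog (1 - delta / A%:C))).
  have -> : 1 - delta / A%:C = z / A%:C.
    rewrite /delta mulrBl divff; first by ring.
    by apply/eqP => /complexI/eqP; rewrite gt_eqF.
  rewrite clog_scale// /powR gt_eqF ?divr_gt0// ln_div ?posrE//.
  rewrite -cexp_real -cexpD; congr cexp.
  by rewrite rmorphM rmorphB /=; ring.
apply: cvgcM; first exact: cvgc_cst.
apply: binomial_series; last exact: ltW.
by rewrite cmodM cmodV cmod_real (gtr0_norm A0) ltr_pdivrMr// mul1r.
Qed.

End gamma_variable.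

(** * Negative binomial weights and mixtures *)

Section negative_binomial_mixture.
Context {d} {T : measurableType d} {R : realType} (P : probability T R).
Variable theta : R.
Hypotheses (theta_gt0 : 0 < theta) (theta_lt1 : theta < 1).

Definition negative_binomial_pmf (r : R) (n : nat) : R :=
  (1 - theta) `^ r * binomial_coeff r n * theta ^+ n.

Let onem_gt0 : 0 < 1 - theta.
Proof. by rewrite subr_gt0. Qed.

Lemma negative_binomial_pmf_ge0 r n : 0 <= r -> 0 <= negative_binomial_pmf r n.
Proof.
move=> r0; rewrite mulr_ge0 ?exprn_ge0 ?(ltW theta_gt0)//.
by rewrite mulr_ge0 ?powR_ge0 ?binomial_coeff_ge0.
Qed.

Lemma negative_binomial_pmf_shift r n :
  (r + n%:R) * negative_binomial_pmf r n =
  r / (1 - theta) * negative_binomial_pmf (r + 1) n.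
Proof.
rewrite /negative_binomial_pmf powRD; last by rewrite (gt_eqF onem_gt0) implybT.
rewrite powRr1 ?(ltW onem_gt0)//.
have -> : (r + n%:R) * ((1 - theta) `^ r * binomial_coeff r n * theta ^+ n) =
  (1 - theta) `^ r * ((r + n%:R) * binomial_coeff r n) * theta ^+ n by ring.
by rewrite binomial_coeff_shift; field; rewrite gt_eqF.
Qed.

Section moments.
Hypothesis pmf1 : forall r, 0 <= r ->
  (\sum_(n <oo) (negative_binomial_pmf r n)%:E = 1)%E.

(** Moments of r + n rather than n are taken, r + n being the gamma shape given B = n. The shift to
    r + 1 is why mass 1 is asked at every parameter. *)
Lemma negative_binomial_moment1 r : 0 <= r ->
  (\sum_(n <oo) (negative_binomial_pmf r n * (r + n%:R))%:E =
   (r / (1 - theta))%:E)%E.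
Proof.
move=> r0; have r10 : 0 <= r + 1 by rewrite addr_ge0.
under eq_eseriesr do rewrite mulrC negative_binomial_pmf_shift EFinM.
rewrite nneseriesZl; last by move=> n _; rewrite lee_fin negative_binomial_pmf_ge0.
by rewrite pmf1// mule1.
Qed.

Lemma negative_binomial_moment2 r : 0 <= r ->
  (\sum_(n <oo) (negative_binomial_pmf r n * ((r + n%:R) * (r + n%:R + 1)))%:E =
   (r * (r + 1) / (1 - theta) ^+ 2)%:E)%E.
Proof.
move=> r0; have r10 : 0 <= r + 1 by rewrite addr_ge0.
transitivity (\sum_(n <oo) ((r / (1 - theta))%:E *
    (negative_binomial_pmf (r + 1) n * (r + 1 + n%:R))%:E))%E.
  apply: eq_eseriesr => n _; rewrite -EFinM mulrA [_ * (r + n%:R)]mulrC.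
  by rewrite negative_binomial_pmf_shift; congr EFin; ring.
rewrite nneseriesZl; last first.
  by move=> n _; rewrite lee_fin mulr_ge0 ?negative_binomial_pmf_ge0 ?addr_ge0.
rewrite negative_binomial_moment1// -EFinM; congr EFin.
by field; rewrite gt_eqF.
Qed.

(** (r + n)^2 = (r + n) (r + n + 1) - (r + n); the subtraction of series is sound because the first
    moment is finite. *)
Lemma negative_binomial_moment_sqr r : 0 <= r ->
  (\sum_(n <oo) (negative_binomial_pmf r n * (r + n%:R) ^+ 2)%:E =
   (r * (r + 1) / (1 - theta) ^+ 2 - r / (1 - theta))%:E)%E.
Proof.
move=> r0; rewrite EFinB -negative_binomial_moment2// -negative_binomial_moment1//.
have p0 n : 0 <= negative_binomial_pmf r n by exact: negative_binomial_pmf_ge0.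
rewrite [X in (_ = X - _)%E](_ : _ =
  \sum_(n <oo) ((negative_binomial_pmf r n * (r + n%:R) ^+ 2)%:E +
             (negative_binomial_pmf r n * (r + n%:R))%:E))%E; last first.
  by apply: eq_eseriesr => n _; rewrite -EFinD; congr EFin; ring.
rewrite nneseriesD; last 2 first.
- by move=> n _; rewrite lee_fin mulr_ge0// sqr_ge0.
- by move=> n _; rewrite lee_fin mulr_ge0// addr_ge0.
by rewrite addeK// negative_binomial_moment1.
Qed.

End moments.

Variables (r : R) (B : T -> nat) (U V : nat -> T -> R).
Hypotheses (r0 : 0 <= r) (mB : forall n, measurable [set w | B w = n])
  (lawB : forall n, P [set w | B w = n] = (negative_binomial_pmf r n)%:E)
  (mU : forall n, measurable_fun setT (U n))
  (mV : forall n, measurable_fun setT (V n))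
  (U0 : forall n w, 0 <= U n w) (V0 : forall n w, 0 <= V n w)
  (indep : forall n, independent_on P [set w | B w = n] (U n) (V n)).

(** On B = n the two factors contribute exp((r + n) (k1 + k2)); the sum over n is the binomial
    series at theta exp(k1 + k2), of modulus less than 1 because the real parts are nonpositive. *)
Lemma mixture_transform (c1 c2 k1 k2 : R[i]) :
  complex.Re c1 <= 0 -> complex.Re c2 <= 0 ->
  complex.Re k1 <= 0 -> complex.Re k2 <= 0 ->
  (forall n, cexpectation P (fun w => cexp ((U n w)%:C * c1)) =
     cexp ((r + n%:R)%:C * k1)) ->
  (forall n, cexpectation P (fun w => cexp ((V n w)%:C * c2)) =
     cexp ((r + n%:R)%:C * k2)) ->
  cexpectation P (fun w => cexp ((U (B w) w)%:C * c1) * cexp ((V (B w) w)%:C * c2)) =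
  cexp (r%:C * ((ln (1 - theta))%:C + k1 + k2
                - clog (1 - theta%:C * cexp (k1 + k2)))).
Proof.
move=> c1_le0 c2_le0 k1_le0 k2_le0 EU EV; rewrite cexpectationE.
have mexp (c : R[i]) : measurable_cfun (fun x : R => cexp (x%:C * c)).
  apply: measurable_cfun_cexp; apply: measurable_cfunM.
    by split; [exact: measurable_id|exact: measurable_cst].
  exact: measurable_cfun_cst.
have mexpU n : measurable_cfun (fun w => cexp ((U n w)%:C * c1)).
  have [mr mi] := mexp c1.
  by split; [exact: (measurableT_comp mr)|exact: (measurableT_comp mi)].
have mexpV n : measurable_cfun (fun w => cexp ((V n w)%:C * c2)).
  have [mr mi] := mexp c2.
  by split; [exact: (measurableT_comp mr)|exact: (measurableT_comp mi)].
pose F n w := cexp ((U n w)%:C * c1) * cexp ((V n w)%:C * c2).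
have mF n : measurable_cfun (F n) by exact: measurable_cfunM.
have Fb n w : cmod (F n w) <= 1.
  by rewrite cmodM mulr_ile1 ?cmod_ge0// cmod_cexp_le1.
have := cintegral_countable P mB measurableT mF Fb.
move=> /cvgc_unique; apply.
have E n : cintegral P (setT `&` [set w | B w = n]) (F n) =
    ((1 - theta) `^ r)%:C * cexp (r%:C * (k1 + k2)) *
    ((binomial_coeff r n)%:C * (theta%:C * cexp (k1 + k2)) ^+ n).
  (* The factorisation lemma wants a bound on the whole real line, whereas exp(x c) is known to be
     bounded only for x >= 0; |x| agrees with x on the values of U and V. *)
  pose abs_exp (c : R[i]) (x : R) := cexp (`|x|%:C * c).
  have mabs (c : R[i]) : measurable_cfun (abs_exp c).
    have [mr mi] := mexp c.
    split.
      exact: (measurableT_comp mr (@normr_measurable R setT)).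
    exact: (measurableT_comp mi (@normr_measurable R setT)).
  rewrite setTI -(@eq_cintegral _ _ _ _ _
    (fun w => abs_exp c1 (U n w) * abs_exp c2 (V n w))); last first.
    by move=> w _; rewrite /F /abs_exp !ger0_norm.
  rewrite (@cintegral_independent_on _ _ _ _ _ _ _ P _ (U n) (V n) _ _ _ _
    (abs_exp c1) (abs_exp c2) 1 1)//; last 2 first.
  - by move=> x; exact: cmod_cexp_le1.
  - by move=> x; exact: cmod_cexp_le1.
  have -> : abs_exp c1 \o U n = fun w => cexp ((U n w)%:C * c1).
    by apply/funext => w; rewrite /abs_exp /= ger0_norm.
  have -> : abs_exp c2 \o V n = fun w => cexp ((V n w)%:C * c2).
    by apply/funext => w; rewrite /abs_exp /= ger0_norm.
  have ED : cexp ((r + n%:R)%:C * (k1 + k2)) =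
      cexp (r%:C * (k1 + k2)) * cexp (k1 + k2) ^+ n.
    by rewrite -cexpMn -cexpD; congr cexp; rewrite rmorphD rmorph_nat mulrDl.
  rewrite EU EV lawB /= -cexpD -mulrDr ED.
  by rewrite /negative_binomial_pmf !rmorphM rmorphXn exprMn /=; ring.
under eq_fun do under eq_bigr do rewrite E.
under eq_fun do rewrite -mulr_sumr.
have -> : cexp (r%:C * ((ln (1 - theta))%:C + k1 + k2
                - clog (1 - theta%:C * cexp (k1 + k2)))) =
    ((1 - theta) `^ r)%:C * cexp (r%:C * (k1 + k2)) *
    cexp (- (r%:C * clog (1 - theta%:C * cexp (k1 + k2)))).
  rewrite /powR gt_eqF// -cexp_real -!cexpD; congr cexp.
  by rewrite rmorphM /=; ring.
apply: cvgcM; first exact: cvgc_cst.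
apply: binomial_series => //.
rewrite cmodM cmod_real cmod_cexp gtr0_norm//.
rewrite -[ltRHS]mulr1 (@lt_le_trans _ _ (1 * expR (complex.Re (k1 + k2))))//.
  by rewrite ltr_pM2r ?expR_gt0.
by rewrite !mul1r expR_le1 ReD -[leRHS]addr0 lerD.
Qed.

(** Only the product of the two integrals is prescribed, so g = 1 with a constant V gives the
    moments of a single component. *)
Lemma ge0_integral_mixture (f g : R -> R) (alpha : nat -> R) :
  measurable_fun setT f -> measurable_fun setT g ->
  (forall x, 0 <= f x) -> (forall x, 0 <= g x) ->
  (forall n, (\int[P]_w (f (U n w))%:E * \int[P]_w (g (V n w))%:E = (alpha n)%:E)%E) ->
  (\int[P]_w (f (U (B w) w) * g (V (B w) w))%:E =
   \sum_(n <oo) (negative_binomial_pmf r n * alpha n)%:E)%E.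
Proof.
move=> mf mg f0 g0 Ea.
have mF n : measurable_fun setT (fun w => f (U n w) * g (V n w)).
  by apply: measurable_funM; exact: measurableT_comp.
rewrite (ge0_integral_countable P mB mF); last first.
  by move=> n w; rewrite mulr_ge0.
apply: eq_eseriesr => n _.
under eq_integral do rewrite EFinM.
rewrite (ge0_integral_independent_on (mB n) (mU n) (mV n) (@indep n)
  (f := EFin \o f) (g := EFin \o g)) /=.
- by rewrite lawB Ea EFinM.
- exact/measurable_EFinP.
- exact/measurable_EFinP.
- by move=> x; rewrite lee_fin.
- by move=> x; rewrite lee_fin.
Qed.

End negative_binomial_mixture.

(** * From transforms to moments *)

Section moments_from_transforms.
Context {d} {T : measurableType d} {R : realType} (P : probability T R).

(** The counts are not known to be integrable beforehand, hence the monotone limit on the side of f;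
    the bounds [C n] make each approximation integrable, so that equality of real integrals lifts to
    extended ones. *)
Lemma integral_eq_of_approx (f g h : T -> R) (fn gn : nat -> T -> R)
    (C : nat -> R) :
  (forall n, measurable_fun setT (fn n)) -> (forall n, measurable_fun setT (gn n)) ->
  (forall n w, 0 <= fn n w <= C n) ->
  (forall w m n, (m <= n)%N -> fn m w <= fn n w) ->
  (forall w, fn n w @[n --> \oo] --> f w) ->
  (forall w, gn n w @[n --> \oo] --> g w) ->
  (forall n w, `|gn n w| <= h w) -> P.-integrable setT (EFin \o h) ->
  (forall n, \int[P]_w fn n w = \int[P]_w gn n w) ->
  (\int[P]_w (f w)%:E = \int[P]_w (g w)%:E)%E.
Proof.
move=> mf mg fC ndf cf cg gh ih fg.
have mfE n : measurable_fun setT (EFin \o fn n) by exact/measurable_EFinP.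
have mgE n : measurable_fun setT (EFin \o gn n) by exact/measurable_EFinP.
have mgl : measurable_fun setT (EFin \o g).
  by apply/measurable_EFinP; exact: (@measurable_fun_cvg _ _ _ _ gn).
have := @cvg_monotone_convergence _ _ _ P _ measurableT (fun n => EFin \o fn n)
  mfE (fun n w _ => ltac:(by have /andP[] := fC n w; rewrite /= lee_fin))
  (fun w _ m n mn => ltac:(by rewrite /= lee_fin; exact: ndf)).
have -> : (fun w => limn (fun n => (EFin \o fn n) w)) = EFin \o f.
  apply/funext => w; apply/cvg_lim => //.
  by apply/fine_cvgP; split; [exact: nearW|exact: cf].
move=> cL.
have cgE w : setT w -> (EFin \o gn n) w @[n --> \oo] --> (EFin \o g) w.
  by move=> _; apply/fine_cvgP; split; [exact: nearW|exact: cg].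
have ghE w n : setT w -> (`|(EFin \o gn n) w| <= (EFin \o h) w)%E.
  by move=> _; rewrite /= lee_fin.
have [_ _ cR] := @dominated_convergence _ _ _ P _ measurableT (fun n => EFin \o gn n)
  (EFin \o g) (EFin \o h) mgE mgl (aeW P cgE) ih (aeW P ghE).
have E n : (\int[P]_w (EFin \o fn n) w = \int[P]_w (EFin \o gn n) w)%E.
  have := fg n; rewrite /Rintegral => e.
  rewrite -[LHS]fineK ?e ?fineK//.
    apply: integrable_fin_num => //.
    apply: (le_integrable measurableT (mgE n) _ ih) => w _.
    by rewrite /= lee_fin (le_trans (gh n w))// ler_norm.
  apply: integrable_fin_num => //.
  apply: (@bounded_integrable _ _ _ _ _ (fn n) (C n)) => //.
  by move=> w; have /andP[? ?] := fC n w; rewrite ger0_norm.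
rewrite -[LHS](cvg_lim _ cL)// -[RHS](cvg_lim _ cR)//.
by congr (limn _); apply/funext => n; exact: E.
Qed.

(** One pattern for three uses: 1 - x (B = C = 0), (1 - x)^2 (A = B) and (1 - x) (1 - y). *)
Lemma eq_Rintegral_lincomb (A B C A' B' C' : T -> R) (K kappa : R) :
  (forall F : T -> R, [\/ F = A, F = B | F = C] \/ [\/ F = A', F = B' | F = C'] ->
     measurable_fun setT F /\ forall w, `|F w| <= K) ->
  \int[P]_w A w = \int[P]_w A' w -> \int[P]_w B w = \int[P]_w B' w ->
  \int[P]_w C w = \int[P]_w C' w ->
  \int[P]_w ((1 - A w - B w + C w) * kappa) =
  \int[P]_w ((1 - A' w - B' w + C' w) * kappa).
Proof.
move=> H eA eB eC.
have iF (F : T -> R) : [\/ F = A, F = B | F = C] \/ [\/ F = A', F = B' | F = C'] ->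
    P.-integrable setT (EFin \o F).
  by move=> /H [mF FK]; exact: (@bounded_integrable _ _ _ _ _ _ K).
have lin (A0 B0 C0 : T -> R) : P.-integrable setT (EFin \o A0) ->
    P.-integrable setT (EFin \o B0) -> P.-integrable setT (EFin \o C0) ->
    \int[P]_w ((1 - A0 w - B0 w + C0 w) * kappa) =
    (1 - \int[P]_w A0 w - \int[P]_w B0 w + \int[P]_w C0 w) * kappa.
  move=> iA iB iC.
  have i1 : P.-integrable setT (EFin \o (fun=> 1 : R)).
    exact: (@bounded_integrable _ _ _ _ _ _ `|1|).
  have i1A : P.-integrable setT (EFin \o (fun w => 1 - A0 w)).
    exact: (integrableB measurableT i1 iA).
  have i1AB : P.-integrable setT (EFin \o (fun w => 1 - A0 w - B0 w)).
    exact: (integrableB measurableT i1A iB).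
  have i1ABC : P.-integrable setT (EFin \o (fun w => 1 - A0 w - B0 w + C0 w)).
    exact: (integrableD measurableT i1AB iC).
  rewrite RintegralZr// RintegralD// RintegralB// RintegralB//.
  by rewrite Rintegral_cst//= probability_setT mulr1.
rewrite !lin ?eA ?eB ?eC//; apply: iF.
- by right; apply: Or31.
- by right; apply: Or32.
- by right; apply: Or33.
- by left; apply: Or31.
- by left; apply: Or32.
- by left; apply: Or33.
Qed.

End moments_from_transforms.

(** * Geometric sums near u = 1 *)

Section geometric_sums.
Context {R : realType}.
Implicit Types (u : R) (n j : nat).

Lemma cvg_bigsum (I : Type) (s : seq I) (F : nat -> I -> R) (L : I -> R) :
  (forall i, F n i @[n --> \oo] --> L i) ->
  \sum_(i <- s) F n i @[n --> \oo] --> \sum_(i <- s) L i.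
Proof.
move=> FL; elim: s => [|i s ih].
  by rewrite big_nil; under eq_fun do rewrite big_nil; exact: cvg_cst.
by rewrite big_cons; under eq_fun do rewrite big_cons; exact: cvgD.
Qed.

(** The quotient (1 - u^j) / (1 - u) without division: nondecreasing in u >= 0 and equal to j at u =
    1, it approximates a count j from below. *)
Definition gsum u j : R := \sum_(i < j) u ^+ i.

Lemma gsumE u j : 1 - u ^+ j = (1 - u) * gsum u j.
Proof.
have := subrXX (1 : R) u j; rewrite expr1n => ->; congr (_ * _).
by apply: eq_bigr => i _; rewrite expr1n mul1r.
Qed.

Lemma gsum_ge0 u j : 0 <= u -> 0 <= gsum u j.
Proof. by move=> u0; rewrite sumr_ge0// => i _; rewrite exprn_ge0. Qed.

Lemma gsum_le u j : 0 <= u <= 1 -> gsum u j <= j%:R.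
Proof.
move=> /andP[u0 u1]; rewrite -[in leRHS](card_ord j) -sumr_const.
by apply: ler_sum => i _; rewrite exprn_ile1.
Qed.

Lemma ler_gsum u v j : 0 <= u -> u <= v -> gsum u j <= gsum v j.
Proof.
move=> u0 uv; apply: ler_sum => i _; apply: lerXn2r => //.
by rewrite nnegrE (le_trans u0).
Qed.

(** A sequence increasing to 1 for which dividing by 1 - u is multiplying by [n.+1%:R]. *)
Definition approx1 n : R := 1 - n.+1%:R^-1.

Lemma approx1_itv n : 0 <= approx1 n <= 1.
Proof.
rewrite subr_ge0 invf_le1// ler1n/= gerBl invr_ge0//.
Qed.

Lemma onem_approx1 n : 1 - approx1 n = n.+1%:R^-1.
Proof. by rewrite /approx1 subKr. Qed.

Lemma ler_approx1 m n : (m <= n)%N -> approx1 m <= approx1 n.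
Proof. by move=> mn; rewrite lerD2l lerN2 lef_pV2 ?posrE// ler_nat. Qed.

Lemma cvg_approx1 : approx1 n @[n --> \oo] --> (1 : R).
Proof.
rewrite -[X in _ --> X]subr0; apply: cvgB; first exact: cvg_cst.
exact: cvg_invS.
Qed.

Lemma cvg_gsum j : gsum (approx1 n) j @[n --> \oo] --> (j%:R : R).
Proof.
elim: j => [|j ih].
  by rewrite /gsum; under eq_fun do rewrite big_ord0; exact: cvg_cst.
rewrite /gsum; under eq_fun do rewrite big_ord_recr /=.
rewrite -natr1; apply: cvgD => //.
have : approx1 n ^+ j @[n --> \oo] --> (1 ^+ j : R).
  elim: {ih}j => [|j ih]; first by under eq_fun do rewrite expr0; exact: cvg_cst.
  by rewrite exprS; under eq_fun do rewrite exprS; apply: cvgM => //; exact: cvg_approx1.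
by rewrite expr1n.
Qed.

End geometric_sums.

(** * The exponent of the counting process near u = 1 *)

Section compound_poisson_exponent.
Context {R : realType}.
Variables (k : nat) (lam : nat -> R).
Hypothesis lam0 : forall j, (1 <= j <= k)%N -> 0 < lam j.

(** This is the psi of E[u^M(t)] = exp(- t psi(u)). [jump_rate] and [jump_rate2] stand for psi(u) /
    (1 - u) and (2 psi(u) - psi(u^2)) / (1 - u)^2; their limits at u = 1 are [jump_mean] and
    [jump_mean2]. *)
Definition jump_exponent (u : R) : R := \sum_(1 <= j < k.+1) lam j * (1 - u ^+ j).
Definition jump_rate (u : R) : R := \sum_(1 <= j < k.+1) lam j * gsum u j.
Definition jump_rate2 (u : R) : R := \sum_(1 <= j < k.+1) lam j * gsum u j ^+ 2.
Definition jump_mean : R := \sum_(1 <= j < k.+1) lam j * j%:R.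
Definition jump_mean2 : R := \sum_(1 <= j < k.+1) lam j * j%:R ^+ 2.

Lemma jump_exponentE u : jump_exponent u = (1 - u) * jump_rate u.
Proof.
rewrite /jump_exponent /jump_rate mulr_sumr; apply: eq_bigr => j _.
by rewrite gsumE mulrCA.
Qed.

(** Term by term, 2 (1 - x) - (1 - x^2) = (1 - x)^2 with x = u^j. *)
Lemma jump_exponent2E u :
  2 * jump_exponent u - jump_exponent (u ^+ 2) = (1 - u) ^+ 2 * jump_rate2 u.
Proof.
rewrite /jump_exponent /jump_rate2 !mulr_sumr -sumrB; apply: eq_bigr => j _.
rewrite [RHS]mulrCA -exprMn -gsumE exprAC; ring.
Qed.

Let lam_ge0 j : (1 <= j < k.+1)%N -> 0 <= lam j.
Proof. by rewrite ltnS => /lam0/ltW. Qed.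

Lemma jump_exponent_ge0 u : 0 <= u <= 1 -> 0 <= jump_exponent u.
Proof.
move=> /andP[u0 u1]; rewrite /jump_exponent big_nat_cond sumr_ge0// => j.
rewrite andbT => /lam_ge0 l0; rewrite mulr_ge0// subr_ge0 exprn_ile1//.
Qed.

Lemma jump_rate_itv u : 0 <= u <= 1 -> 0 <= jump_rate u <= jump_mean.
Proof.
move=> u01; have /andP[u0 u1] := u01.
rewrite /jump_rate /jump_mean big_nat_cond [X in _ && (_ <= X)]big_nat_cond.
rewrite sumr_ge0 => [|j]; last first.
  by rewrite andbT => /lam_ge0 l0; rewrite mulr_ge0// gsum_ge0.
apply: ler_sum => j; rewrite andbT => /lam_ge0 l0.
by rewrite ler_wpM2l// gsum_le.
Qed.

Lemma jump_rate2_itv u : 0 <= u <= 1 -> 0 <= jump_rate2 u <= jump_mean2.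
Proof.
move=> u01; have /andP[u0 u1] := u01.
rewrite /jump_rate2 /jump_mean2 big_nat_cond [X in _ && (_ <= X)]big_nat_cond.
rewrite sumr_ge0 => [|j]; last first.
  by rewrite andbT => /lam_ge0 l0; rewrite mulr_ge0// sqr_ge0.
apply: ler_sum => j; rewrite andbT => /lam_ge0 l0.
by rewrite ler_wpM2l// lerXn2r ?nnegrE ?gsum_ge0// gsum_le.
Qed.

Lemma cvg_jump_rate : jump_rate (approx1 n) @[n --> \oo] --> jump_mean.
Proof.
apply: cvg_bigsum => j; apply: cvgM; first exact: cvg_cst.
exact: cvg_gsum.
Qed.

Lemma cvg_jump_rate2 : jump_rate2 (approx1 n) @[n --> \oo] --> jump_mean2.
Proof.
apply: cvg_bigsum => j; apply: cvgM; first exact: cvg_cst.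
by rewrite expr2; under eq_fun do rewrite expr2; apply: cvgM; exact: cvg_gsum.
Qed.

End compound_poisson_exponent.

(** * Mean, second moment and mixed moment of the counts *)

Section counting_moments.
Context {d} {T : measurableType d} {R : realType} (P : probability T R).

Let u (n : nat) : R := approx1 n.

Let h0 (n : nat) : 0 < (n.+1%:R^-1 : R).
Proof. by rewrite invr_gt0. Qed.

Let u01 n : 0 <= u n <= 1.
Proof. exact: approx1_itv. Qed.

Let gsum_recE n j : gsum (u n) j = (1 - u n ^+ j) * n.+1%:R.
Proof. by rewrite gsumE onem_approx1 mulrAC mulVf ?mul1r// pnatr_eq0. Qed.

Let gsum_rec_itv n j : 0 <= gsum (u n) j <= n.+1%:R.
Proof.
have /andP[u0 u1] := u01 n.
rewrite gsum_ge0//= gsum_recE ler_piMl// gerBl exprn_ge0//.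
Qed.

Let ler_gsum_rec m n j : (m <= n)%N -> gsum (u m) j <= gsum (u n) j.
Proof. by move=> mn; apply: ler_gsum; [case/andP: (u01 m)|exact: ler_approx1]. Qed.

Let measurable_natfun (X : T -> nat) (F : nat -> R) :
  measurable_fun setT X -> measurable_fun setT (fun w => F (X w)).
Proof. by move=> mX; exact: measurableT_comp. Qed.

Section one_variable.
Variables (X : T -> nat) (G : T -> R) (k : nat) (lam : nat -> R).
Hypotheses (lam0 : forall j, (1 <= j <= k)%N -> 0 < lam j)
  (mX : measurable_fun setT X) (mG : measurable_fun setT G)
  (G0 : forall w, 0 <= G w).
Hypothesis law : forall v : R, 0 <= v <= 1 ->
  \int[P]_w (v ^+ X w) = \int[P]_w expR (- (jump_exponent k lam v * G w)).

(** Laplace-side counterpart of [gsum (u n) (X w)]: both divide the defect from 1 by 1 - u, and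
    [law] equates their integrals. *)
Definition laplace_quotient (n : nat) (w : T) : R :=
  (1 - expR (- (jump_exponent k lam (u n) * G w))) * n.+1%:R.

Lemma laplace_quotientE n w : laplace_quotient n w =
  (1 - expR (- (n.+1%:R^-1 * (jump_rate k lam (u n) * G w)))) / n.+1%:R^-1.
Proof. by rewrite /laplace_quotient jump_exponentE onem_approx1 invrK mulrA. Qed.

Lemma laplace_quotient_itv n w :
  0 <= laplace_quotient n w <= jump_mean k lam * G w.
Proof.
have /andP[r0 rm] := jump_rate_itv lam0 (u01 n).
rewrite {1}/laplace_quotient; apply/andP; split.
  rewrite mulr_ge0// subr_ge0 expR_le1 oppr_le0 mulr_ge0//.
  exact: jump_exponent_ge0.
rewrite laplace_quotientE ler_pdivrMr//; apply: le_trans (one_sub_expRN_le _) _.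
by rewrite mulrC ler_wpM2r ?(ltW (h0 n))// ler_wpM2r.
Qed.

Lemma measurable_laplace_quotient n : measurable_fun setT (laplace_quotient n).
Proof.
apply: measurable_funM => //; apply: measurable_funB => //.
apply: (measurableT_comp (@measurable_expR R)); apply: measurable_funN.
exact: measurable_funM.
Qed.

Lemma cvg_laplace_quotient w :
  laplace_quotient n w @[n --> \oo] --> jump_mean k lam * G w.
Proof.
under eq_fun do rewrite laplace_quotientE.
apply: (cvg_expR_quotient h0 (@cvg_invS R)).
  by move=> n; have /andP[? _] := jump_rate_itv lam0 (u01 n); rewrite mulr_ge0.
by apply: cvgM; [exact: cvg_jump_rate|exact: cvg_cst].
Qed.

Lemma measurable_laplace (a : R) : measurable_fun setT (fun w => expR (- (a * G w))).
Proof.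
apply: (measurableT_comp (@measurable_expR R)); apply: measurable_funN.
exact: measurable_funM.
Qed.

Lemma norm_laplace_le1 (a : R) w : 0 <= a -> `|expR (- (a * G w))| <= 1.
Proof.
by move=> a0; rewrite ger0_norm ?expR_ge0// expR_le1 oppr_le0 mulr_ge0.
Qed.

Lemma norm_powX_le1 (v : R) w : 0 <= v <= 1 -> `|v ^+ X w| <= 1.
Proof.
by move=> /andP[v0 v1]; rewrite ger0_norm ?exprn_ge0// exprn_ile1.
Qed.

Lemma integral_count : P.-integrable setT (EFin \o G) ->
  (\int[P]_w (X w)%:R%:E = \int[P]_w (jump_mean k lam * G w)%:E)%E.
Proof.
move=> iG.
apply: (@integral_eq_of_approx _ _ _ P _ _ (fun w => jump_mean k lam * G w)
  (fun n w => gsum (u n) (X w)) laplace_quotient (fun n => n.+1%:R)).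
- by move=> n; exact: measurable_natfun.
- exact: measurable_laplace_quotient.
- by move=> n w; exact: gsum_rec_itv.
- by move=> w m n mn; exact: ler_gsum_rec.
- by move=> w; exact: cvg_gsum.
- exact: cvg_laplace_quotient.
- by move=> n w; have /andP[? ?] := laplace_quotient_itv n w; rewrite ger0_norm.
- exact: (integrableZl measurableT (jump_mean k lam) iG).
move=> n.
have := @eq_Rintegral_lincomb _ _ _ P (fun w => u n ^+ X w) (fun=> 0) (fun=> 0)
  (fun w => expR (- (jump_exponent k lam (u n) * G w))) (fun=> 0) (fun=> 0) 1 n.+1%:R.
have -> : \int[P]_w ((1 - u n ^+ X w - 0 + 0) * n.+1%:R) =
    \int[P]_w gsum (u n) (X w).
  by apply: eq_Rintegral => w _; rewrite subr0 addr0 gsum_recE.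
have -> : \int[P]_w ((1 - expR (- (jump_exponent k lam (u n) * G w)) - 0 + 0)
    * n.+1%:R) = \int[P]_w laplace_quotient n w.
  by apply: eq_Rintegral => w _; rewrite subr0 addr0.
apply => //; last exact: law.
have e0 := jump_exponent_ge0 lam0 (u01 n).
by move=> F [] [] ->; split => //; (try by rewrite normr0);
  [exact: measurable_natfun|move=> w; exact: norm_powX_le1
  |exact: measurable_laplace|move=> w; exact: norm_laplace_le1].
Qed.

(** With x = exp(- psi(u) G) and y = exp(- psi(u^2) G), the second difference 1 - 2 x + y is written
    (1 - x)^2 + y (1 - x^2 / y). Both terms are nonnegative, and after division by (1 - u)^2 they
    tend to the G^2 part and the G part of the moment. *)
Definition laplace_quotient2 (n : nat) (w : T) : R :=
  laplace_quotient n w ^+ 2 + expR (- (jump_exponent k lam (u n ^+ 2) * G w)) *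
    ((1 - expR (- (n.+1%:R^-1 ^+ 2 * (jump_rate2 k lam (u n) * G w)))) / n.+1%:R^-1 ^+ 2).

Lemma laplace_quotient2E n w : laplace_quotient2 n w =
  (1 - expR (- (jump_exponent k lam (u n) * G w))
     - expR (- (jump_exponent k lam (u n) * G w))
     + expR (- (jump_exponent k lam (u n ^+ 2) * G w))) * n.+1%:R ^+ 2.
Proof.
rewrite /laplace_quotient2 /laplace_quotient.
have -> : n.+1%:R^-1 ^+ 2 * (jump_rate2 k lam (u n) * G w) =
    (2 * jump_exponent k lam (u n) - jump_exponent k lam (u n ^+ 2)) * G w.
  by rewrite jump_exponent2E onem_approx1 mulrA.
set y := jump_exponent k lam (u n); set y2 := jump_exponent k lam (u n ^+ 2).
have -> : expR (- ((2 * y - y2) * G w)) =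
    expR (- (y * G w)) ^+ 2 / expR (- (y2 * G w)).
  by rewrite -expRM_natl -expRN -expRD; congr expR; ring.
have e2 : expR (- (y2 * G w)) != 0 by rewrite gt_eqF// expR_gt0.
have nn : n.+1%:R != 0 :> R by rewrite pnatr_eq0.
move: e2 nn; set E2 := expR _; set K := n.+1%:R => e2 nn.
by rewrite exprVn invrK; field.
Qed.

Lemma integral_count_sqr : P.-integrable setT (EFin \o G) ->
  P.-integrable setT (EFin \o (fun w => G w ^+ 2)) ->
  (\int[P]_w ((X w)%:R ^+ 2)%:E =
   \int[P]_w (jump_mean k lam ^+ 2 * G w ^+ 2 + jump_mean2 k lam * G w)%:E)%E.
Proof.
move=> iG iG2.
have u2_01 n : 0 <= u n ^+ 2 <= 1.
  by have /andP[a b] := u01 n; rewrite exprn_ge0// exprn_ile1.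
have h20 n : 0 < (n.+1%:R^-1 ^+ 2 : R) by rewrite exprn_gt0.
have cvg_h2 : (n.+1%:R^-1 ^+ 2 : R) @[n --> \oo] --> (0 : R).
  have : (n.+1%:R^-1 * n.+1%:R^-1 : R) @[n --> \oo] --> (0 * 0 : R).
    by apply: cvgM; exact: cvg_invS.
  by rewrite mulr0.
have q2 n w : 0 <= (1 - expR (- (n.+1%:R^-1 ^+ 2 * (jump_rate2 k lam (u n) * G w))))
    / n.+1%:R^-1 ^+ 2 <= jump_mean2 k lam * G w.
  have /andP[r0 rm] := jump_rate2_itv lam0 (u01 n).
  rewrite divr_ge0 ?(ltW (h20 n))//=; last first.
    by rewrite subr_ge0 expR_le1 oppr_le0 !mulr_ge0// ltW.
  rewrite ler_pdivrMr//; apply: le_trans (one_sub_expRN_le _) _.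
  by rewrite mulrC ler_wpM2r ?(ltW (h20 n))// ler_wpM2r.
have mq n : measurable_fun setT (laplace_quotient2 n).
  apply: measurable_funD.
    by apply: measurable_funX; exact: measurable_laplace_quotient.
  apply: measurable_funM; first exact: measurable_laplace.
  apply: measurable_funM => //; apply: measurable_funB => //.
  under eq_fun do rewrite mulrA; exact: measurable_laplace.
apply: (@integral_eq_of_approx _ _ _ P _ _
  (fun w => jump_mean k lam ^+ 2 * G w ^+ 2 + jump_mean2 k lam * G w)
  (fun n w => gsum (u n) (X w) ^+ 2) laplace_quotient2 (fun n => n.+1%:R ^+ 2)) => //.
- by move=> n; exact: (measurable_natfun (fun j => gsum (u n) j ^+ 2)).
- move=> n w; have /andP[? ?] := gsum_rec_itv n (X w).
  by rewrite exprn_ge0//= lerXn2r// nnegrE.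
- move=> w m n mn; have /andP[? ?] := gsum_rec_itv m (X w).
  have /andP[? ?] := gsum_rec_itv n (X w).
  by rewrite lerXn2r ?nnegrE// ler_gsum_rec.
- move=> w; rewrite expr2; under eq_fun do rewrite expr2.
  by apply: cvgM; exact: cvg_gsum.
- move=> w; apply: cvgD.
    rewrite -exprMn expr2; under eq_fun do rewrite expr2.
    by apply: cvgM; exact: cvg_laplace_quotient.
  rewrite -[X in _ --> X]mul1r; apply: cvgM; last first.
    apply: (cvg_expR_quotient h20).
    + exact: cvg_h2.
    + by move=> n; have /andP[? _] := jump_rate2_itv lam0 (u01 n); rewrite mulr_ge0.
    + by apply: cvgM; [exact: cvg_jump_rate2|exact: cvg_cst].
  (* The value psi(u^2) tends to 0, being 2 psi(u) - (1 - u)^2 times [jump_rate2] with psi(u) = (1 -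
     u) times [jump_rate]; so the exponential in front tends to 1. *)
  have cj2 : 2 * jump_exponent k lam (u n) - n.+1%:R^-1 ^+ 2 * jump_rate2 k lam (u n)
      @[n --> \oo] --> (2 * (0 * jump_mean k lam) - 0 * jump_mean2 k lam : R).
    apply: cvgB; last by apply: cvgM => //; exact: cvg_jump_rate2.
    apply: cvgM; first exact: cvg_cst.
    under eq_fun do rewrite jump_exponentE onem_approx1.
    by apply: cvgM; [exact: cvg_invS|exact: cvg_jump_rate].
  have cj : - (jump_exponent k lam (u n ^+ 2) * G w) @[n --> \oo] --> (- (0 * G w) : R).
    apply: cvgN; apply: cvgM; last exact: cvg_cst.
    move: cj2; rewrite !mul0r mulr0 subr0; apply: cvg_trans.
    apply: near_eq_cvg; apply: nearW => n.
    by rewrite -onem_approx1 -jump_exponent2E; ring.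
  have := cvg_comp _ _ cj (@continuous_expR R (- (0 * G w))).
  by rewrite mul0r oppr0 expR0.
- move=> n w; rewrite /laplace_quotient2.
  have /andP[q0 q1] := q2 n w; have /andP[l0 l1] := laplace_quotient_itv n w.
  rewrite ger0_norm; last first.
    by apply: addr_ge0; [exact: exprn_ge0|apply: mulr_ge0 => //; exact: expR_ge0].
  apply: lerD; first by rewrite -exprMn lerXn2r ?nnegrE// (le_trans l0).
  apply: le_trans q1; rewrite ler_piMl// expR_le1 oppr_le0 mulr_ge0//.
  exact: jump_exponent_ge0.
- have i1 := integrableZl measurableT (jump_mean k lam ^+ 2) iG2.
  have i2 := integrableZl measurableT (jump_mean2 k lam) iG.
  exact: (integrableD measurableT i1 i2).
move=> n.
pose A w := u n ^+ X w; pose C w := (u n ^+ 2) ^+ X w.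
pose A' w := expR (- (jump_exponent k lam (u n) * G w)).
pose C' w := expR (- (jump_exponent k lam (u n ^+ 2) * G w)).
have := @eq_Rintegral_lincomb _ _ _ P A A C A' A' C' 1 (n.+1%:R ^+ 2).
have -> : \int[P]_w ((1 - A w - A w + C w) * n.+1%:R ^+ 2) =
    \int[P]_w gsum (u n) (X w) ^+ 2.
  by apply: eq_Rintegral => w _; rewrite gsum_recE exprMn /A /C exprAC; ring.
have -> : \int[P]_w ((1 - A' w - A' w + C' w) * n.+1%:R ^+ 2) =
    \int[P]_w laplace_quotient2 n w.
  by apply: eq_Rintegral => w _; rewrite laplace_quotient2E.
apply; [|exact: law|exact: law|exact: law].
have e0 := jump_exponent_ge0 lam0 (u01 n).
have e1 := jump_exponent_ge0 lam0 (u2_01 n).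
have bA : measurable_fun setT A /\ forall w, `|A w| <= 1.
  by split; [exact: measurable_natfun|move=> w; exact: norm_powX_le1].
have bC : measurable_fun setT C /\ forall w, `|C w| <= 1.
  by split; [exact: measurable_natfun|move=> w; exact: norm_powX_le1].
have bA' : measurable_fun setT A' /\ forall w, `|A' w| <= 1.
  by split; [exact: measurable_laplace|move=> w; exact: norm_laplace_le1].
have bC' : measurable_fun setT C' /\ forall w, `|C' w| <= 1.
  by split; [exact: measurable_laplace|move=> w; exact: norm_laplace_le1].
by move=> F [] [] ->.
Qed.

End one_variable.

Section two_variables.
Variables (X1 X2 : T -> nat) (G1 G2 : T -> R) (k1 k2 : nat) (lam1 lam2 : nat -> R).
Hypotheses (lam1_gt0 : forall j, (1 <= j <= k1)%N -> 0 < lam1 j)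
  (lam2_gt0 : forall j, (1 <= j <= k2)%N -> 0 < lam2 j)
  (mX1 : measurable_fun setT X1) (mX2 : measurable_fun setT X2)
  (mG1 : measurable_fun setT G1) (mG2 : measurable_fun setT G2)
  (G1_ge0 : forall w, 0 <= G1 w) (G2_ge0 : forall w, 0 <= G2 w).
Hypothesis law : forall v1 v2 : R, 0 <= v1 <= 1 -> 0 <= v2 <= 1 ->
  \int[P]_w (v1 ^+ X1 w * v2 ^+ X2 w) =
  \int[P]_w (expR (- (jump_exponent k1 lam1 v1 * G1 w)) *
             expR (- (jump_exponent k2 lam2 v2 * G2 w))).

Lemma integral_countM :
  P.-integrable setT (EFin \o (fun w => G1 w * G2 w)) ->
  (\int[P]_w ((X1 w)%:R * (X2 w)%:R)%:E =
   \int[P]_w (jump_mean k1 lam1 * jump_mean k2 lam2 * (G1 w * G2 w))%:E)%E.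
Proof.
move=> iG.
pose Q1 := laplace_quotient G1 k1 lam1; pose Q2 := laplace_quotient G2 k2 lam2.
have Q1_itv n w := laplace_quotient_itv lam1_gt0 G1_ge0 n w.
have Q2_itv n w := laplace_quotient_itv lam2_gt0 G2_ge0 n w.
apply: (@integral_eq_of_approx _ _ _ P _ _
  (fun w => jump_mean k1 lam1 * jump_mean k2 lam2 * (G1 w * G2 w))
  (fun n w => gsum (u n) (X1 w) * gsum (u n) (X2 w))
  (fun n w => Q1 n w * Q2 n w) (fun n => n.+1%:R * n.+1%:R)).
- by move=> n; apply: measurable_funM; exact: measurable_natfun.
- by move=> n; apply: measurable_funM; exact: measurable_laplace_quotient.
- move=> n w; have /andP[? ?] := gsum_rec_itv n (X1 w).
  by have /andP[? ?] := gsum_rec_itv n (X2 w); rewrite mulr_ge0//= ler_pM.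
- move=> w m n mn; have /andP[? _] := gsum_rec_itv m (X1 w).
  by have /andP[? _] := gsum_rec_itv m (X2 w); rewrite ler_pM// ler_gsum_rec.
- by move=> w; apply: cvgM; exact: cvg_gsum.
- move=> w; rewrite mulrACA; apply: cvgM.
    exact: (cvg_laplace_quotient lam1_gt0 G1_ge0).
  exact: (cvg_laplace_quotient lam2_gt0 G2_ge0).
- move=> n w; have /andP[? ?] := Q1_itv n w; have /andP[? ?] := Q2_itv n w.
  by rewrite ger0_norm; [rewrite [leRHS]mulrACA; exact: ler_pM|exact: mulr_ge0].
- exact: (integrableZl measurableT (jump_mean k1 lam1 * jump_mean k2 lam2) iG).
move=> n.
pose A w := u n ^+ X1 w; pose B w := u n ^+ X2 w.
pose A' w := expR (- (jump_exponent k1 lam1 (u n) * G1 w)).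
pose B' w := expR (- (jump_exponent k2 lam2 (u n) * G2 w)).
have := @eq_Rintegral_lincomb _ _ _ P A B (A \* B) A' B' (A' \* B') 1 (n.+1%:R * n.+1%:R).
have -> : \int[P]_w ((1 - A w - B w + (A \* B) w) * (n.+1%:R * n.+1%:R)) =
    \int[P]_w (gsum (u n) (X1 w) * gsum (u n) (X2 w)).
  by apply: eq_Rintegral => w _; rewrite !gsum_recE /A /B /=; ring.
have -> : \int[P]_w ((1 - A' w - B' w + (A' \* B') w) * (n.+1%:R * n.+1%:R)) =
    \int[P]_w (Q1 n w * Q2 n w).
  by apply: eq_Rintegral => w _; rewrite /Q1 /Q2 /laplace_quotient /A' /B' /=; ring.
(* psi(1) = 0, so setting one variable to 1 in [law] yields the marginal identities used below. *)
have je1 k lam : jump_exponent k lam 1 = 0 :> R by rewrite jump_exponentE subrr mul0r.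
have i11 : 0 <= (1 : R) <= 1 by rewrite ler01 lexx.
apply; last exact: law.
- have e1 := jump_exponent_ge0 lam1_gt0 (u01 n).
  have e2 := jump_exponent_ge0 lam2_gt0 (u01 n).
  have bA : measurable_fun setT A /\ forall w, `|A w| <= 1.
    by split; [exact: measurable_natfun|move=> w; exact: norm_powX_le1].
  have bB : measurable_fun setT B /\ forall w, `|B w| <= 1.
    by split; [exact: measurable_natfun|move=> w; exact: norm_powX_le1].
  have bA' : measurable_fun setT A' /\ forall w, `|A' w| <= 1.
    by split; [exact: measurable_laplace|move=> w; exact: norm_laplace_le1].
  have bB' : measurable_fun setT B' /\ forall w, `|B' w| <= 1.
    by split; [exact: measurable_laplace|move=> w; exact: norm_laplace_le1].
  have bM (f g : T -> R) : measurable_fun setT f /\ (forall w, `|f w| <= 1) ->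
      measurable_fun setT g /\ (forall w, `|g w| <= 1) ->
      measurable_fun setT (f \* g) /\ forall w, `|(f \* g) w| <= 1.
    move=> [mf f1] [mg g1]; split; first exact: measurable_funM.
    by move=> w /=; rewrite normrM mulr_ile1.
  by move=> F [] [] -> //; exact: bM.
- have := law (u01 n) i11; rewrite je1 => e.
  transitivity (\int[P]_w (u n ^+ X1 w * 1 ^+ X2 w)).
    by apply: eq_Rintegral => w _; rewrite expr1n mulr1.
  by rewrite e; apply: eq_Rintegral => w _; rewrite mul0r oppr0 expR0 mulr1.
- have := law i11 (u01 n); rewrite je1 => e.
  transitivity (\int[P]_w (1 ^+ X1 w * u n ^+ X2 w)).
    by apply: eq_Rintegral => w _; rewrite expr1n mul1r.
  by rewrite e; apply: eq_Rintegral => w _; rewrite mul0r oppr0 expR0 mul1r.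
Qed.

End two_variables.
End counting_moments.

(** * Continuity and exponentials of the exponents *)

Section continuous_exponents.
Context {R : realType}.
Implicit Types (f g c : R -> R[i]) (a theta : R).

Definition ccontinuous f :=
  continuous (fun u => complex.Re (f u)) /\ continuous (fun u => complex.Im (f u)).

Lemma ccontinuous_cst (z : R[i]) : ccontinuous (fun=> z).
Proof. by split => u; exact: cst_continuous. Qed.

Lemma ccontinuousD f g : ccontinuous f -> ccontinuous g ->
  ccontinuous (fun u => f u + g u).
Proof.
move=> [rf jf] [rg ig]; split => u.
  by under eq_fun do rewrite ReD; exact: continuousD (rf u) (rg u).
by under eq_fun do rewrite ImD; exact: continuousD (jf u) (ig u).
Qed.

Lemma ccontinuousN f : ccontinuous f -> ccontinuous (fun u => - f u).
Proof.
move=> [rf jf]; split => u.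
  by under eq_fun do rewrite ReN; exact: continuousN (rf u).
by under eq_fun do rewrite ImN; exact: continuousN (jf u).
Qed.

Lemma ccontinuousM f g : ccontinuous f -> ccontinuous g ->
  ccontinuous (fun u => f u * g u).
Proof.
move=> [rf jf] [rg ig]; split => u.
  under eq_fun do rewrite ReM.
  by apply: cvgB; apply: cvgM; [exact: rf|exact: rg|exact: jf|exact: ig].
under eq_fun do rewrite ImM.
by apply: cvgD; apply: cvgM; [exact: rf|exact: ig|exact: jf|exact: rg].
Qed.

Lemma ccontinuous_sum (I : Type) (s : seq I) (F : I -> R -> R[i]) :
  (forall i, ccontinuous (F i)) -> ccontinuous (fun u => \sum_(i <- s) F i u).
Proof.
move=> cF; elim: s => [|i s ih].
  by under eq_fun do rewrite big_nil; exact: ccontinuous_cst.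
by under eq_fun do rewrite big_cons; exact: ccontinuousD.
Qed.

Lemma ccontinuous_cexp f : ccontinuous f -> ccontinuous (fun u => cexp (f u)).
Proof.
move=> [rf jf].
have h (g : R -> R) : continuous g ->
    continuous (fun u => g (complex.Re (f u))) /\
    continuous (fun u => g (complex.Im (f u))).
  by move=> cg; split => u;
    [exact: (continuous_comp (rf u) (cg _))|exact: (continuous_comp (jf u) (cg _))].
have [eR _] := h _ (@continuous_expR R).
have [_ cI] := h _ (@continuous_cos R); have [_ sI] := h _ (@continuous_sin R).
split => u; under eq_fun do rewrite cexpE /=; apply: cvgM.
- exact: eR.
- exact: cI.
- exact: eR.
- exact: sI.
Qed.

Lemma ccontinuousX f n : ccontinuous f -> ccontinuous (fun u => f u ^+ n).
Proof.
move=> cf; elim: n => [|n ih].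
  by under eq_fun do rewrite expr0; exact: ccontinuous_cst.
by under eq_fun do rewrite exprS; exact: ccontinuousM.
Qed.

Lemma ccontinuous_clog f : ccontinuous f -> (forall u, 0 < complex.Re (f u)) ->
  ccontinuous (fun u => clog (f u)).
Proof.
move=> [rf jf] f0; split => u; rewrite /clog /=.
  have s0 : 0 < complex.Re (f u) * complex.Re (f u) + complex.Im (f u) * complex.Im (f u).
    by rewrite -!expr2 ltr_wpDr ?sqr_ge0// exprn_gt0.
  have q : continuous (fun u => complex.Re (f u) * complex.Re (f u) +
      complex.Im (f u) * complex.Im (f u)).
    by move=> v; apply: cvgD; apply: cvgM; [exact: rf|exact: rf|exact: jf|exact: jf].
  apply: cvgM; last exact: cvg_cst.
  exact: (continuous_comp (q u) (continuous_ln s0)).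
have q : {for u, continuous (fun u => complex.Im (f u) / complex.Re (f u))}.
  by apply: cvgM; [exact: jf|apply: cvgV; [rewrite gt_eqF|exact: rf]].
exact: (continuous_comp q (@continuous_atan R _)).
Qed.

Lemma ccontinuous_within f : ccontinuous f ->
  {within `[0, 1], continuous (fun u => complex.Re (f u))} /\
  {within `[0, 1], continuous (fun u => complex.Im (f u))}.
Proof. by move=> [rf jf]; split; exact: continuous_subspaceT. Qed.

(** The logarithm of a / (a - z) that vanishes at z = 0; a gamma variable of shape s and rate a has
    transform exp of s times it. *)
Definition gamma_exponent a (z : R[i]) : R[i] := (ln a)%:C - clog (a%:C - z).

(** A logarithm of (1 - theta) e^z / (1 - theta e^z); multiplied by r, it is the exponent of r + n
    under the negative binomial weights. *)
Definition mixture_exponent theta (z : R[i]) : R[i] :=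
  (ln (1 - theta))%:C + z - clog (1 - theta%:C * cexp z).

(** |a - z| >= a when Re z <= 0. This keeps the exponential in the closed unit disc, where the
    mixture can be summed. *)
Lemma Re_gamma_exponent_le0 a (z : R[i]) : 0 < a -> complex.Re z <= 0 ->
  complex.Re (gamma_exponent a z) <= 0.
Proof.
move=> a0 z0; rewrite /gamma_exponent ReD ReN /= subr_le0.
rewrite ler_pdivlMr// mulr_natr -lnXn//.
have az : a <= complex.Re (a%:C - z).
  by rewrite ReD ReN /= lerDl oppr_ge0.
rewrite ler_ln ?posrE ?exprn_gt0//; last first.
  by rewrite ltr_wpDr ?sqr_ge0// exprn_gt0// (lt_le_trans a0).
by rewrite ler_wpDr ?sqr_ge0// lerXn2r// nnegrE ltW// (lt_le_trans a0).
Qed.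

Lemma cexp_gamma_exponent a (z : R[i]) : 0 < a -> complex.Re z <= 0 ->
  cexp (gamma_exponent a z) = a%:C / (a%:C - z).
Proof.
move=> a0 z0; rewrite cexpD cexpN cexp_real lnK ?posrE// clogK//.
by rewrite ReD ReN /= subr_gt0 (le_lt_trans z0).
Qed.

Lemma gamma_exponent0 a : 0 < a -> gamma_exponent a 0 = 0.
Proof. by move=> a0; rewrite /gamma_exponent subr0 clog_real// subrr. Qed.

Lemma Re_one_sub_gt0 theta (z : R[i]) : 0 < theta -> theta < 1 ->
  complex.Re z <= 0 -> 0 < complex.Re (1 - theta%:C * cexp z).
Proof.
move=> t0 t1 z0; rewrite ReD ReN subr_gt0 ReM /= mul0r subr0.
apply: le_lt_trans t1; rewrite ger_pMr//.
apply: le_trans (ler_norm _) _; apply: le_trans (ler_Re_cmod _) _.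
by rewrite cmod_cexp expR_le1.
Qed.

Lemma cexp_mixture_exponent theta (z : R[i]) : 0 < theta -> theta < 1 ->
  complex.Re z <= 0 ->
  cexp (mixture_exponent theta z) =
  (1 - theta)%:C * cexp z / (1 - theta%:C * cexp z).
Proof.
move=> t0 t1 z0; rewrite /mixture_exponent !cexpD cexpN cexp_real.
by rewrite lnK ?posrE ?subr_gt0// clogK// Re_one_sub_gt0.
Qed.

Lemma mixture_exponent0 theta : theta < 1 -> mixture_exponent theta 0 = 0.
Proof.
move=> t1; rewrite /mixture_exponent cexp0 mulr1 addr0.
by rewrite -(rmorphB (real_complex R) 1 theta) clog_real ?subr_gt0// subrr.
Qed.

Lemma ccontinuous_gamma_exponent a c : 0 < a -> ccontinuous c ->
  (forall u, complex.Re (c u) <= 0) ->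
  ccontinuous (fun u => gamma_exponent a (c u)).
Proof.
move=> a0 cc c0; apply: ccontinuousD; first exact: ccontinuous_cst.
apply: ccontinuousN; apply: ccontinuous_clog.
  by apply: ccontinuousD; [exact: ccontinuous_cst|exact: ccontinuousN].
by move=> u; rewrite ReD ReN /= subr_gt0 (le_lt_trans (c0 u)).
Qed.

Lemma ccontinuous_mixture_exponent theta c : 0 < theta -> theta < 1 ->
  ccontinuous c -> (forall u, complex.Re (c u) <= 0) ->
  ccontinuous (fun u => mixture_exponent theta (c u)).
Proof.
move=> t0 t1 cc c0; apply: ccontinuousD.
  by apply: ccontinuousD => //; exact: ccontinuous_cst.
apply: ccontinuousN; apply: ccontinuous_clog; last first.
  by move=> u; exact: Re_one_sub_gt0.
apply: ccontinuousD; first exact: ccontinuous_cst.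
apply: ccontinuousN; apply: ccontinuousM; first exact: ccontinuous_cst.
exact: ccontinuous_cexp.
Qed.

(** For s > 0 the quotient s / w is real exactly when w is, and then with the same sign, so the
    condition of [cln_path] can be checked on the denominator alone. *)
Lemma cln_path_inv (psi w : R -> R[i]) (s : R) : ccontinuous psi -> psi 0 = 0 ->
  0 < s -> (forall u, cexp (psi u) = s%:C / w u) ->
  (forall u, complex.Im (w u) = 0 -> 0 < complex.Re (w u)) ->
  cln (s%:C / w 1) = psi 1.
Proof.
move=> cpsi psi0 s0 e h; rewrite -e; apply: cln_path => //.
  exact: (ccontinuous_within cpsi).2.
move=> u _; rewrite e ImM ReM /= !mul0r subr0 addr0 => Im0.
have wn0 : w u != 0.
  by apply/eqP => w0; have := h u; rewrite w0 ltxx => /(_ erefl).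
have Imw : complex.Im (w u) = 0.
  move: Im0 => /eqP; rewrite mulf_eq0 (gt_eqF s0)/= ImV mulf_eq0 oppr_eq0.
  move=> /orP[/eqP//|]; rewrite invr_eq0 paddr_eq0 ?sqr_ge0// !sqrf_eq0.
  by move=> /andP[_ /eqP].
rewrite mulr_gt0// ReV Imw expr0n addr0 divr_gt0 ?exprn_gt0//; exact: h.
Qed.

Lemma ccontinuous_marginal_exponent theta a c : 0 < theta -> theta < 1 -> 0 < a ->
  ccontinuous c -> (forall u, complex.Re (c u) <= 0) ->
  ccontinuous (fun u => mixture_exponent theta (gamma_exponent a (c u))).
Proof.
move=> t0 t1 a0 cc c0; apply: ccontinuous_mixture_exponent => //.
  exact: ccontinuous_gamma_exponent.
by move=> u; exact: Re_gamma_exponent_le0.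
Qed.

Variables (theta a1 a2 : R) (c1 c2 : R -> R[i]).
Hypotheses (theta_gt0 : 0 < theta) (theta_lt1 : theta < 1)
  (a1_gt0 : 0 < a1) (a2_gt0 : 0 < a2)
  (cc1 : ccontinuous c1) (cc2 : ccontinuous c2)
  (c1_le0 : forall u, complex.Re (c1 u) <= 0)
  (c2_le0 : forall u, complex.Re (c2 u) <= 0) (c1_0 : c1 0 = 0) (c2_0 : c2 0 = 0).

Let Re_sub_ge a (z : R[i]) : complex.Re z <= 0 -> a <= complex.Re (a%:C - z).
Proof. by move=> z0; rewrite ReD ReN /= lerDl oppr_ge0. Qed.

Let sub_neq0 a (z : R[i]) : 0 < a -> complex.Re z <= 0 -> a%:C - z != 0.
Proof.
move=> a0 z0; apply/eqP => e; have := Re_sub_ge a z0.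
by rewrite e /= leNgt a0.
Qed.

Lemma ccontinuous_joint_exponent : ccontinuous (fun u =>
  mixture_exponent theta (gamma_exponent a1 (c1 u) + gamma_exponent a2 (c2 u))).
Proof.
apply: ccontinuous_mixture_exponent => //.
  by apply: ccontinuousD; exact: ccontinuous_gamma_exponent.
by move=> u; rewrite ReD -[leRHS]addr0 lerD// Re_gamma_exponent_le0.
Qed.

(** Putting x = a1 a2 / ((a1 - c1) (a2 - c2)) in (1 - theta) x / (1 - theta x) and clearing
    denominators gives the fraction. *)
Lemma cln_joint_exponent :
  cln (a1%:C * a2%:C * (1 - theta%:C) /
       ((a1%:C - c1 1) * (a2%:C - c2 1) - theta%:C * a1%:C * a2%:C)) =
  mixture_exponent theta (gamma_exponent a1 (c1 1) + gamma_exponent a2 (c2 1)).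
Proof.
pose w u := (a1%:C - c1 u) * (a2%:C - c2 u) - (theta * a1 * a2)%:C.
have -> : a1%:C * a2%:C * (1 - theta%:C) /
       ((a1%:C - c1 1) * (a2%:C - c2 1) - theta%:C * a1%:C * a2%:C) =
    (a1 * a2 * (1 - theta))%:C / w 1.
  by rewrite /w !rmorphM rmorphB.
have hw u : complex.Im (w u) = 0 -> 0 < complex.Re (w u).
  apply: (mulc_rhp_sub_notin_neg a1_gt0 a2_gt0); [exact: Re_sub_ge|exact: Re_sub_ge|].
  by rewrite -mulrA gtr_pMl// mulr_gt0.
pose psi u := mixture_exponent theta (gamma_exponent a1 (c1 u) + gamma_exponent a2 (c2 u)).
apply: (@cln_path_inv psi w) => //; first exact: ccontinuous_joint_exponent.
- by rewrite /psi c1_0 c2_0 !gamma_exponent0// addr0 mixture_exponent0.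
- by rewrite !mulr_gt0// subr_gt0.
move=> u; rewrite /psi cexp_mixture_exponent//; last first.
  by rewrite ReD -[leRHS]addr0 lerD// Re_gamma_exponent_le0.
rewrite cexpD !cexp_gamma_exponent// /w !rmorphM rmorphB /=.
have wn0 : (a1%:C - c1 u) * (a2%:C - c2 u) - (theta * a1 * a2)%:C != 0.
  by apply/eqP => w0; have := hw u; rewrite /w w0 ltxx => /(_ erefl).
rewrite !rmorphM /= in wn0.
have n1 := sub_neq0 a1_gt0 (c1_le0 u); have n2 := sub_neq0 a2_gt0 (c2_le0 u).
move: (c1 u) (c2 u) wn0 n1 n2 => z1 z2 wn0 n1 n2.
have -> : 1 - theta%:C * (a1%:C / (a1%:C - z1) * (a2%:C / (a2%:C - z2))) =
    ((a1%:C - z1) * (a2%:C - z2) - theta%:C * a1%:C * a2%:C) /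
    ((a1%:C - z1) * (a2%:C - z2)).
  by field; rewrite n1 n2.
by field; rewrite n1 n2 wn0.
Qed.

(** Each marginal exponential simplifies to b / (b - c) with b = a (1 - theta), the transform of a
    gamma law of rate b per unit of shape. Both factors of w lie in the right half-plane, so the two
    logarithms add up without crossing the cut. *)
Lemma cln_marginal_exponents :
  cln (a1%:C * a2%:C * (1 - theta%:C) ^+ 2 /
       ((a1%:C * (1 - theta%:C) - c1 1) * (a2%:C * (1 - theta%:C) - c2 1))) =
  mixture_exponent theta (gamma_exponent a1 (c1 1)) +
  mixture_exponent theta (gamma_exponent a2 (c2 1)).
Proof.
pose w u := ((a1 * (1 - theta))%:C - c1 u) * ((a2 * (1 - theta))%:C - c2 u).
have t0 : 0 < 1 - theta by rewrite subr_gt0.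
have b1 : 0 < a1 * (1 - theta) by rewrite mulr_gt0.
have b2 : 0 < a2 * (1 - theta) by rewrite mulr_gt0.
have -> : a1%:C * a2%:C * (1 - theta%:C) ^+ 2 /
       ((a1%:C * (1 - theta%:C) - c1 1) * (a2%:C * (1 - theta%:C) - c2 1)) =
    (a1 * a2 * (1 - theta) ^+ 2)%:C / w 1.
  by rewrite /w expr2 !rmorphM rmorphB.
pose psi u := mixture_exponent theta (gamma_exponent a1 (c1 u)) +
  mixture_exponent theta (gamma_exponent a2 (c2 u)).
apply: (@cln_path_inv psi w) => //.
- by apply: ccontinuousD; exact: ccontinuous_marginal_exponent.
- by rewrite /psi c1_0 c2_0 !gamma_exponent0// mixture_exponent0// addr0.
- by rewrite !mulr_gt0.
- have E a (z : R[i]) : 0 < a -> complex.Re z <= 0 ->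
      cexp (mixture_exponent theta (gamma_exponent a z)) =
      (a * (1 - theta))%:C / ((a * (1 - theta))%:C - z).
    move=> a0 z0; rewrite cexp_mixture_exponent ?Re_gamma_exponent_le0//.
    rewrite cexp_gamma_exponent//.
    have n1 := sub_neq0 a0 z0.
    have := @sub_neq0 (a * (1 - theta)) z (mulr_gt0 a0 t0) z0.
    rewrite !rmorphM rmorphB /= => n2.
    have -> : 1 - theta%:C * (a%:C / (a%:C - z)) =
        (a%:C * (1 - theta%:C) - z) / (a%:C - z) by field.
    by field; rewrite n1 n2.
  move=> u; rewrite /psi cexpD !E// /w.
  have n1 := sub_neq0 b1 (c1_le0 u); have n2 := sub_neq0 b2 (c2_le0 u).
  rewrite !rmorphM /= in n1 n2 *.
  move: (1 - theta)%:C (c1 u) (c2 u) n1 n2 => o z1 z2 n1 n2.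
  by field; rewrite n1 n2.
- move=> u; apply: mulc_rhp_notin_neg.
    by apply: (lt_le_trans b1); exact: Re_sub_ge.
  by apply: (lt_le_trans b2); exact: Re_sub_ge.
Qed.

End continuous_exponents.

(** * Events and independence extracted from the processes *)

Section independence_of_processes.
Context {d} {T : measurableType d} {R : realType} (P : probability T R).

Lemma mutually_independent2 (I : finType) (F : I -> set (set T)) (i j : I)
    (A B : set T) : mutually_independent P F -> i != j -> F i A -> F j B ->
  P (A `&` B) = (P A * P B)%E.
Proof.
move=> iF ij FA FB.
have := iF [set i; j]%SET (fun o => if o == i then A else B).
have -> : \bigcap_(o in [set` [set i; j]%SET]) (if o == i then A else B) = A `&` B.
  apply/seteqP; split => w.
    move=> h; have := h i; have := h j.
    rewrite /= !inE !eqxx orbT [j == i]eq_sym (negbTE ij) => hj hi.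
    by split; [exact: hi|exact: hj].
  by move=> [Aw Bw] o _; case: ifP.
move=> -> //; first by rewrite big_setU1 ?inE// big_set1 eqxx eq_sym (negbTE ij).
by move=> o; rewrite !inE => /orP[] /eqP ->; rewrite ?eqxx// eq_sym (negbTE ij).
Qed.

Lemma mutually_independent3 (I : finType) (F : I -> set (set T)) (i j k : I)
    (A B C : set T) : mutually_independent P F -> uniq [:: i; j; k] ->
  F i A -> F j B -> F k C -> P (A `&` (B `&` C)) = (P A * (P B * P C))%E.
Proof.
move=> iF /=; rewrite !inE negb_or andbT => /andP[/andP[ij ik] jk] FA FB FC.
have ji : (j == i) = false by rewrite eq_sym (negbTE ij).
have ki : (k == i) = false by rewrite eq_sym (negbTE ik).
have kj : (k == j) = false by rewrite eq_sym (negbTE jk).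
pose D o := if o == i then A else if o == j then B else C.
have := iF (i |: [set j; k])%SET D.
have -> : \bigcap_(o in [set` (i |: [set j; k])%SET]) D o = A `&` (B `&` C).
  apply/seteqP; split => w.
    move=> h; have := h i; have := h j; have := h k.
    rewrite /D /= !inE !eqxx !orbT ji ki kj => hk hj hi.
    by split; [exact: hi|split; [exact: hj|exact: hk]].
  by move=> [Aw [Bw Cw]] o _; rewrite /D; case: ifP => // _; case: ifP.
move=> -> //.
  rewrite big_setU1 ?inE ?negb_or ?ij ?ik// big_setU1 ?inE// big_set1.
  by rewrite /D !eqxx ji ki kj.
by move=> o; rewrite /D !inE => /orP[/eqP ->|/orP[] /eqP ->]; rewrite ?eqxx// ?ji ?ki ?kj.
Qed.

Lemma generated_sigma_algebra_preimage (J : Type) (D : set J) (X : J -> T -> R) j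
    (B : set R) : D j -> measurable B ->
  generated_sigma_algebra D X (X j @^-1` B).
Proof. by move=> Dj mB; apply: sub_sigma_algebra; exists j => //; exists B. Qed.

Lemma generated_sigma_algebraI (J : Type) (D : set J) (X : J -> T -> R) (A B : set T) :
  generated_sigma_algebra D X A -> generated_sigma_algebra D X B ->
  generated_sigma_algebra D X (A `&` B).
Proof.
exact: (@measurableI _ (g_sigma_algebraType
  [set A | exists2 j, D j & exists2 B : set R, measurable B & A = X j @^-1` B])).
Qed.

(** The sigma-algebras are generated by the real-valued versions of the counts; an event on the
    integers is carried over through the image set, which is countable and hence measurable. *)
Lemma natr_preimage (N : T -> nat) (A : set nat) :
  N @^-1` A = (fun w => (N w)%:R : R) @^-1` ((fun n => n%:R) @` A).
Proof.
apply/seteqP; split => w /=; first by exists (N w).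
by move=> [n An] /eqP; rewrite eqr_nat => /eqP <-.
Qed.

Lemma measurable_natr_image (A : set nat) : measurable ((fun n => n%:R : R) @` A).
Proof.
apply: countable_measurable => //.
exact: card_le_trans (card_image_le _ _) (countableP A).
Qed.

Lemma measurable_fun_natr (N : T -> nat) :
  measurable_fun setT (fun w => (N w)%:R : R) -> measurable_fun setT N.
Proof.
move=> mN _ A _; rewrite setTI natr_preimage; apply: measurable_preimage => //.
exact: measurable_natr_image.
Qed.

(** The preimage under a constant is everything or empty; in this way two-variable statements
    specialise to one component. *)
Lemma independent_on_cst d1 d2 (S1 : measurableType d1) (S2 : measurableType d2)
    (E : set T) (Y : T -> S1) (y : S2) :
  (forall A, measurable A -> P (E `&` Y @^-1` A) = (P E * P (Y @^-1` A))%E) ->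
  independent_on P E Y (cst y).
Proof.
move=> EY A C mA _; rewrite preimage_cst; case: ifP => _.
  by rewrite setIT probability_setT mule1 EY.
by rewrite !setI0 measure0 !mule0.
Qed.

End independence_of_processes.

(** * One-dimensional laws of the given processes *)

Section process_marginals.
Context {d} {T : measurableType d} {R : realType} (P : probability T R).

(** At time 0 the gamma process has no density and vanishes only almost surely, so that time is
    treated apart. *)
Lemma ae_zero_integral (Y : T -> R) (f : R -> R) : measurable_fun setT Y ->
  {ae P, forall w, Y w = 0} -> measurable_fun setT f ->
  (\int[P]_w (f (Y w))%:E = (f 0)%:E)%E.
Proof.
move=> mY Y0 mf; rewrite (ae_eq_integral (cst (f 0)%:E))//.
- by have -> := @integral_cst _ _ _ P setT measurableT (f 0)%:E; rewrite /= probability_setT mule1.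
- by apply/measurable_EFinP; exact: measurableT_comp.
- by apply: filterS Y0 => w Yw _; rewrite Yw.
Qed.

Section gamma_marginals.
Variables (lambda a : R) (Z : R -> T -> R).
Hypotheses (lambda_gt0 : 0 < lambda) (a_gt0 : 0 < a)
  (gammaZ : gamma_process P lambda a Z).

Lemma measurable_gamma_process t : 0 <= t -> measurable_fun setT (Z t).
Proof. by case: gammaZ => -[mZ _ _ _ _] _ _; exact: mZ. Qed.

Lemma gamma_process_ge0 t w : 0 <= t -> 0 <= Z t w.
Proof. by case: gammaZ => _ Z0 _; exact: Z0. Qed.

(** Total mass of the law at time s / lambda; every shape s > 0 is reached in this way. *)
Lemma gamma_pdf_integral1 s : 0 < s ->
  (\int[@lebesgue_measure R]_x (gamma_pdf s a x)%:E = 1)%E.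
Proof.
move=> s0; case: gammaZ => _ _ lawZ.
have := lawZ (s / lambda) setT (divr_gt0 s0 lambda_gt0) measurableT.
by rewrite preimage_setT probability_setT mulrC divfK ?gt_eqF// => <-.
Qed.

Lemma gamma_process_transform s (c : R[i]) : 0 <= s -> complex.Re c <= 0 ->
  cexpectation P (fun w => cexp ((Z s w)%:C * c)) =
  cexp ((lambda * s)%:C * gamma_exponent a c).
Proof.
move=> s0 c0; have [[mZ Z0 _ _ _] Zge0 lawZ] := gammaZ.
move: s0; rewrite le_eqVlt => /predU1P[<-|s0]; last first.
  apply: (gamma_transform a_gt0 (mulr_gt0 lambda_gt0 s0) gamma_pdf_integral1) => //.
  - by apply: mZ; exact: ltW.
  - by move=> w; apply: Zge0; exact: ltW.
  - by move=> A; exact: lawZ.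
rewrite mulr0 mul0r cexp0 cexpectationE.
have mexp : measurable_cfun (fun x : R => cexp (x%:C * c)).
  apply: measurable_cfun_cexp; apply: measurable_cfunM; last exact: measurable_cfun_cst.
  by split; [exact: measurable_id|exact: measurable_cst].
apply: complex_eq; rewrite /= /Rintegral.
  rewrite (@ae_zero_integral _ (fun x => complex.Re (cexp (x%:C * c))))//=.
  - by rewrite mul0r cexp0.
  - exact: mZ.
  - exact: mexp.1.
rewrite (@ae_zero_integral _ (fun x => complex.Im (cexp (x%:C * c))))//=.
- by rewrite mul0r cexp0.
- exact: mZ.
- exact: mexp.2.
Qed.

Let gamma_process_moment n s : (0 < n)%N -> 0 <= s ->
  (\int[P]_w (Z s w ^+ n)%:E =
   (n`!%:R * binomial_coeff (lambda * s) n / a ^+ n)%:E)%E.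
Proof.
move=> n0 s0; have [[mZ Z0 _ _ _] Zge0 lawZ] := gammaZ.
(* At time 0 both sides vanish: the power n is positive and the rising factorial starts with the
   factor 0. *)
move: s0; rewrite le_eqVlt => /predU1P[<-|s0].
  rewrite (@ae_zero_integral _ (fun x => x ^+ n))//; last exact: mZ.
  rewrite mulr0 expr0n gtn_eqF//=; congr EFin; case: n n0 => // n _.
  by rewrite /binomial_coeff big_ord_recl /= addr0 !mul0r mulr0 mul0r.
have s1 : 0 <= s by exact: ltW.
have ls : 0 < lambda * s by rewrite mulr_gt0.
have ab : 0 < a + 0 by rewrite addr0.
have := @gamma_exp_moment _ _ _ P a (lambda * s) (Z s) ls gamma_pdf_integral1
  (mZ _ s1) (Zge0 _ ^~ s1) (fun A => lawZ s A s0) n 0 ab.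
under eq_integral do rewrite mul0r oppr0 expR0 mulr1.
move=> ->; congr EFin; rewrite addr0 powRD ?(gt_eqF a_gt0) ?implybT//.
rewrite powR_mulrn ?(ltW a_gt0)//.
have Pn0 : a `^ (lambda * s) != 0 by rewrite gt_eqF// powR_gt0.
have an0 : a ^+ n != 0 by rewrite expf_neq0// gt_eqF.
by field; rewrite Pn0 an0.
Qed.

Lemma gamma_process_moment1 s : 0 <= s ->
  (\int[P]_w (Z s w)%:E = (lambda * s / a)%:E)%E.
Proof.
move=> s0; have := @gamma_process_moment 1 s isT s0.
under eq_integral do rewrite expr1.
move=> ->; have := binomial_coeffS (lambda * s) 0.
by rewrite binomial_coeff0 addr0 mulr1 expr1 => e; rewrite -[1`!%:R]/(1 : R) e.
Qed.

Lemma gamma_process_moment2 s : 0 <= s ->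
  (\int[P]_w (Z s w ^+ 2)%:E = (lambda * s * (lambda * s + 1) / a ^+ 2)%:E)%E.
Proof.
move=> s0; rewrite gamma_process_moment//; congr (_ / _)%:E.
have := binomial_coeffS (lambda * s) 1; have := binomial_coeffS (lambda * s) 0.
rewrite binomial_coeff0 addr0 mulr1 mul1r => -> e.
rewrite -[2`!%:R]/(2%:R) e; ring.
Qed.

End gamma_marginals.

Section negative_binomial_marginals.
Variables (theta : R) (B : R -> T -> nat).
Hypothesis nbB : negative_binomial_process P theta B.

Lemma measurable_negative_binomial_process t n : 0 <= t ->
  measurable [set w | B t w = n].
Proof.
move=> t0; case: nbB => -[mB _ _ _ _] _.
have := measurable_preimage (measurable_fun_natr (mB _ t0)) (A := [set n]) I.
by [].
Qed.

Lemma negative_binomial_processE t n : 0 <= t ->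
  P [set w | B t w = n] = (negative_binomial_pmf theta t n)%:E.
Proof. by move=> t0; case: nbB => _ ->//; rewrite real_binomialE. Qed.

(** The events {B r = n} partition the space. Letting r range over all times provides the raised
    parameters used by the moment recursion. *)
Lemma negative_binomial_pmf_sum1 r : 0 <= r ->
  (\sum_(n <oo) (negative_binomial_pmf theta r n)%:E = 1)%E.
Proof.
move=> r0; rewrite -(@probability_setT _ _ _ P).
have mB n := measurable_negative_binomial_process n r0.
have := @ge0_integral_countable _ _ _ P (B r) mB (fun _ _ => 1)
  (fun=> measurable_cst _) (fun _ _ => ler01).
rewrite integral_cst// mul1e => ->; apply: eq_eseriesr => n _.
by rewrite integral_cst// mul1e; exact/esym/negative_binomial_processE.
Qed.

End negative_binomial_marginals.

Section gcp_marginals.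
Variables (k : nat) (lam : nat -> R) (M : R -> T -> nat).
Hypotheses (lam_gt0 : forall j, (1 <= j <= k)%N -> 0 < lam j)
  (gcpM : gcp P k lam M).

(** At u = exp(omega) and u = exp(- omega) these are the constants c_i and c_l of the theorem. *)
Definition gcp_exponent (u : R[i]) : R[i] :=
  - \sum_(1 <= j < k.+1) (lam j)%:C * (1 - u ^+ j).

Lemma measurable_gcp t : 0 <= t -> measurable_fun setT (M t).
Proof. by move=> t0; case: gcpM => -[mM _ _ _ _] _; exact/measurable_fun_natr/mM. Qed.

Lemma gcp_right_continuous t w : 0 <= t ->
  (M s w)%:R @[s --> t^'+] --> ((M t w)%:R : R).
Proof. by move=> t0; case: gcpM => -[_ _ _ _ /(_ w)[rM _]] _; exact: rM. Qed.

Lemma normc_le1 (u : R[i]) : (`|u| <= 1) = (cmod u <= 1).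
Proof. by rewrite normc_def -cmodE -[1]/(1%:C) lecR. Qed.

Lemma gcp_transform (u : R[i]) t : cmod u <= 1 -> 0 <= t ->
  cexpectation P (fun w => u ^+ M t w) = cexp (t%:C * gcp_exponent u).
Proof.
rewrite -normc_le1 => u1 t0; case: gcpM => _ ->//.
by rewrite /gcp_exponent mulrN mulNr.
Qed.

Lemma Re_gcp_exponent_le0 (u : R[i]) : cmod u <= 1 ->
  complex.Re (gcp_exponent u) <= 0.
Proof.
move=> u1; rewrite /gcp_exponent ReN oppr_le0.
have -> : complex.Re (\sum_(1 <= j < k.+1) (lam j)%:C * (1 - u ^+ j)) =
    \sum_(1 <= j < k.+1) lam j * complex.Re (1 - u ^+ j).
  elim/big_ind2 : _ => // [x1 x2 y1 y2 <- <-|j _]; first by rewrite ReD.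
  by rewrite ReM /= mul0r subr0.
rewrite big_nat_cond sumr_ge0// => j; rewrite andbT => jk.
rewrite mulr_ge0 ?(ltW (lam_gt0 jk))// ReD ReN subr_ge0.
by apply: le_trans (ler_norm _) _; apply: le_trans (ler_Re_cmod _) (cmodX_le1 _ _).
Qed.

Lemma gcp_exponent1 : gcp_exponent 1 = 0.
Proof.
rewrite /gcp_exponent big1 ?oppr0// => j _.
by rewrite expr1n subrr mulr0.
Qed.

Lemma gcp_exponent_real (v : R) :
  gcp_exponent v%:C = - (jump_exponent k lam v)%:C.
Proof.
rewrite /gcp_exponent /jump_exponent rmorph_sum; congr (- _).
by apply: eq_bigr => j _; rewrite rmorphM rmorphB rmorphXn.
Qed.

End gcp_marginals.
End process_marginals.

(** * The time-changed process: transforms, moments, conclusions *)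

Section time_changed_process.
Context {d} {T : measurableType d} {R : realType} (P : probability T R).
Variables (q : nat) (k : 'I_q -> nat) (lam : 'I_q -> nat -> R)
  (lambda theta : R) (a : 'I_q -> R)
  (M : 'I_q -> R -> T -> nat) (Z : 'I_q -> R -> T -> R) (B : R -> T -> nat).
Hypotheses (lam_gt0 : forall (i : 'I_q) (j : nat), (1 <= j <= k i)%N -> 0 < lam i j)
  (lambda_gt0 : 0 < lambda) (theta_gt0 : 0 < theta) (theta_lt1 : theta < 1)
  (a_gt0 : forall i : 'I_q, 0 < a i)
  (M_gcp : multivariate_gcp P k lam M)
  (ZB_data : gamma_subordinator_data P lambda theta a Z B)
  (MG_indep : independent P
     (sigma_mprocess (fun (i : 'I_q) (t : R) (w : T) => (M i t w)%:R))
     (sigma_mprocess (gamma_subordinator lambda Z B))).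
Variables (t : R) (t_ge0 : 0 <= t).

(** On {B r = n} the clock [G i] equals [U i n], which is [Z i] at the time of shape r + n. *)
Let r := lambda * t.
Let G i := gamma_subordinator lambda Z B i t.
Let U (i : 'I_q) n : T -> R := Z i (t + lambda^-1 * n%:R).
Let X (i : 'I_q) w : nat := M i (G i w) w.

Let r_ge0 : 0 <= r.
Proof. by rewrite mulr_ge0// ltW. Qed.

Let shifted_time_ge0 n : 0 <= t + lambda^-1 * n%:R.
Proof. by rewrite addr_ge0// mulr_ge0// invr_ge0 ltW. Qed.

Let shifted_timeE n : lambda * (t + lambda^-1 * n%:R) = r + n%:R.
Proof. by rewrite mulrDr mulrA divff ?mul1r// gt_eqF. Qed.

Let gammaZ i : gamma_process P lambda (a i) (Z i).
Proof. by case: ZB_data. Qed.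

Let nbB : negative_binomial_process P theta B.
Proof. by case: ZB_data. Qed.

Let gcpM i : gcp P (k i) (lam i) (M i).
Proof. by case: M_gcp. Qed.

Let measurable_U i n : measurable_fun setT (U i n).
Proof. exact: measurable_gamma_process (gammaZ i) _ (shifted_time_ge0 n). Qed.

Let U_ge0 i n w : 0 <= U i n w.
Proof. exact: gamma_process_ge0 (gammaZ i) _ _ (shifted_time_ge0 n). Qed.

Let measurable_B n : measurable [set w | B r w = n].
Proof. exact: measurable_negative_binomial_process nbB _ _ r_ge0. Qed.

Let lawB n : P [set w | B r w = n] = (negative_binomial_pmf theta r n)%:E.
Proof. exact: negative_binomial_processE nbB _ _ r_ge0. Qed.

Let measurable_G i : measurable_fun setT (G i).
Proof. exact: (measurable_fun_countable measurable_B (measurable_U i)). Qed.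

Let G_ge0 i w : 0 <= G i w.
Proof. exact: U_ge0. Qed.

Let measurable_X i : measurable_fun setT (X i).
Proof.
apply/measurable_fun_natr.
apply: measurable_subordinated_nat => //.
  by move=> s s0; exact: (measurable_gcp (gcpM i)).
by move=> s w s0; exact: (gcp_right_continuous (gcpM i)).
Qed.

Let event_B n : sigma_process (fun s w => (B s w)%:R : R) [set w | B r w = n].
Proof.
have -> : [set w | B r w = n] = B r @^-1` [set n] by [].
rewrite (@natr_preimage _ _ R).
apply: (generated_sigma_algebra_preimage (X := fun s w => (B s w)%:R : R) r_ge0).
exact: measurable_natr_image.
Qed.

Let event_U i n (A : set R) : measurable A -> sigma_process (Z i) (U i n @^-1` A).
Proof. exact: (generated_sigma_algebra_preimage (X := Z i) (shifted_time_ge0 n)). Qed.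

Let mutual_ZB : mutually_independent P (fun o : option 'I_q =>
  if o is Some i then sigma_process (Z i)
  else sigma_process (fun s w => (B s w)%:R)).
Proof. by case: ZB_data. Qed.

Let B_indep_U i n : independent_on P [set w | B r w = n] (U i n)
  (cst 0 : T -> R).
Proof.
apply: independent_on_cst => A mA.
apply: (mutually_independent2 (i := None) (j := Some i) mutual_ZB) => //.
exact: event_U.
Qed.

Let B_indep_UU i l n : i != l ->
  independent_on P [set w | B r w = n] (U i n) (U l n).
Proof.
move=> il A C mA mC.
apply: (mutually_independent3 (i := None) (j := Some i) (k := Some l) mutual_ZB).
- by rewrite /= !inE /= andbT; apply/eqP => -[] /eqP; apply/negP.
- exact: event_B.
- exact: event_U.
- exact: event_U.
Qed.

Let event_M i s (A : set nat) : 0 <= s ->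
  sigma_process (fun s w => (M i s w)%:R : R) (M i s @^-1` A) /\
  sigma_mprocess (fun (i : 'I_q) (s : R) (w : T) => (M i s w)%:R : R) (M i s @^-1` A).
Proof.
move=> s0; rewrite (@natr_preimage _ _ R); split.
  apply: (generated_sigma_algebra_preimage (X := fun s w => (M i s w)%:R : R) s0).
  exact: measurable_natr_image.
apply: (generated_sigma_algebra_preimage (X := fun p w => (M p.1 p.2 w)%:R : R)
  (j := (i, s)) s0).
exact: measurable_natr_image.
Qed.

Let event_G i (A : set R) : measurable A ->
  sigma_mprocess (gamma_subordinator lambda Z B) (G i @^-1` A).
Proof.
exact: (generated_sigma_algebra_preimage
  (X := fun p => gamma_subordinator lambda Z B p.1 p.2) (j := (i, t)) t_ge0).
Qed.

Let M_indep_G i s (E : set T) : 0 <= s ->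
  sigma_mprocess (gamma_subordinator lambda Z B) E ->
  independent_on P E (M i s) (cst 0%N).
Proof.
move=> s0 GE; apply: independent_on_cst => A _.
have := MG_indep (event_M i A s0).2 GE.
by rewrite setIC [X in _ = X -> _]muleC.
Qed.

Let MM_indep_G i l s s' (E : set T) : i != l -> 0 <= s -> 0 <= s' ->
  sigma_mprocess (gamma_subordinator lambda Z B) E ->
  independent_on P E (M i s) (M l s').
Proof.
move=> il s0 s'0 GE A C _ _.
have := MG_indep (generated_sigma_algebraI (event_M i A s0).2 (event_M l C s'0).2) GE.
rewrite setIC [X in _ = X -> _]muleC => ->; case: M_gcp => _ mM.
have -> := mutually_independent2 mM il (event_M i A s0).1 (event_M l C s'0).1.
by [].
Qed.

Let gamma_transform_U i n (c : R[i]) : complex.Re c <= 0 ->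
  cexpectation P (fun w => cexp ((U i n w)%:C * c)) =
  cexp ((r + n%:R)%:C * gamma_exponent (a i) c).
Proof.
by move=> c0; rewrite (gamma_process_transform lambda_gt0 (a_gt0 i) (gammaZ i)) ?shifted_timeE.
Qed.

Let cexpectation_cst (z : R[i]) : cexpectation P (fun=> z) = z.
Proof. by rewrite cexpectationE cintegral_cst// probability_setT mulr1. Qed.

Let cmod_le1 : cmod (1 : R[i]) <= 1.
Proof. by rewrite cmod1. Qed.

Let Re0_le0 : complex.Re (0 : R[i]) <= 0.
Proof. by []. Qed.

(** The two-component statement with a second count identically 0 run by a clock identically 0,
    hence u2 = 1 and c2 = 0. *)
Lemma marginal_subordination i (u c : R[i]) : cmod u <= 1 -> complex.Re c <= 0 ->
  (forall s, 0 <= s -> cexpectation P (fun w => u ^+ M i s w) = cexp (s%:C * c)) ->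
  cexpectation P (fun w => u ^+ X i w) = cexpectation P (fun w => cexp ((G i w)%:C * c)).
Proof.
move=> u1 c0 Eu.
have -> : (fun w => u ^+ X i w) = (fun w => u ^+ M i (G i w) w * 1 ^+ 0%N).
  by apply/funext => w; rewrite expr0 mulr1.
have -> : (fun w => cexp ((G i w)%:C * c)) =
    (fun w => cexp ((G i w)%:C * c) * cexp ((0 : R)%:C * 0)).
  by apply/funext => w; rewrite mulr0 cexp0 mulr1.
apply: (@subordination _ _ _ P (M i) (fun _ => cst 0%N) (G i) (cst 0)
  (@measurable_gcp _ _ _ _ _ _ _ (gcpM i)) (fun _ _ => measurable_cst _)
  (@gcp_right_continuous _ _ _ _ _ _ _ (gcpM i)) (fun _ _ _ => cvg_cst _)
  (measurable_G i) (measurable_cst _) (G_ge0 i)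
  (fun=> lexx _) _ u 1 c 0 u1 cmod_le1 c0 Re0_le0 Eu); last first.
  by move=> s s0; rewrite cexpectation_cst mulr0 cexp0.
move=> s s' A C s0 s'0 mA mC; apply: M_indep_G => //.
rewrite preimage_cst; case: ifP => _; first by rewrite setIT; exact: event_G.
rewrite setI0; exact: (@measurable0 _ (g_sigma_algebraType
  [set A | exists2 j, [set p : 'I_q * R | 0 <= p.2] j &
           exists2 C : set R, measurable C &
             A = gamma_subordinator lambda Z B j.1 j.2 @^-1` C])).
Qed.

Lemma joint_subordination i l (u1 u2 c1 c2 : R[i]) : i != l ->
  cmod u1 <= 1 -> cmod u2 <= 1 -> complex.Re c1 <= 0 -> complex.Re c2 <= 0 ->
  (forall s, 0 <= s -> cexpectation P (fun w => u1 ^+ M i s w) = cexp (s%:C * c1)) ->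
  (forall s, 0 <= s -> cexpectation P (fun w => u2 ^+ M l s w) = cexp (s%:C * c2)) ->
  cexpectation P (fun w => u1 ^+ X i w * u2 ^+ X l w) =
  cexpectation P (fun w => cexp ((G i w)%:C * c1) * cexp ((G l w)%:C * c2)).
Proof.
move=> il *; apply: subordination => //.
- by move=> s; exact: measurable_gcp.
- by move=> s; exact: measurable_gcp.
- by move=> s w; exact: gcp_right_continuous.
- by move=> s w; exact: gcp_right_continuous.
- move=> s s' A C s0 s'0 mA mC; apply: MM_indep_G => //.
  by apply: generated_sigma_algebraI; exact: event_G.
Qed.

Let Re_gamma_gcp (i : 'I_q) (u : R[i]) : cmod u <= 1 ->
  complex.Re (gamma_exponent (a i) (gcp_exponent (k i) (lam i) u)) <= 0.
Proof.
move=> u1; apply: Re_gamma_exponent_le0 => //.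
by apply: Re_gcp_exponent_le0 => //; exact: lam_gt0.
Qed.

Let Re_gcp i (u : R[i]) : cmod u <= 1 ->
  complex.Re (gcp_exponent (k i) (lam i) u) <= 0.
Proof. by move=> u1; apply: Re_gcp_exponent_le0 => //; exact: lam_gt0. Qed.

Let gcpE i (u : R[i]) : cmod u <= 1 -> forall s, 0 <= s ->
  cexpectation P (fun w => u ^+ M i s w) = cexp (s%:C * gcp_exponent (k i) (lam i) u).
Proof. by move=> u1 s s0; exact: (gcp_transform (gcpM i)). Qed.

Lemma marginal_transform i (u : R[i]) : cmod u <= 1 ->
  cexpectation P (fun w => u ^+ X i w) =
  cexp (r%:C * mixture_exponent theta
    (gamma_exponent (a i) (gcp_exponent (k i) (lam i) u))).
Proof.
move=> u1; rewrite (marginal_subordination u1 (Re_gcp i u1) (gcpE i u1)).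
have -> : (fun w => cexp ((G i w)%:C * gcp_exponent (k i) (lam i) u)) =
    (fun w => cexp ((G i w)%:C * gcp_exponent (k i) (lam i) u) * cexp ((0 : R)%:C * 0)).
  by apply/funext => w; rewrite mulr0 cexp0 mulr1.
have := @mixture_transform _ _ _ P theta theta_gt0 theta_lt1 r (B r) (U i) (fun _ => cst 0)
  r_ge0 measurable_B lawB (measurable_U i) (fun=> measurable_cst _) (U_ge0 i)
  (fun _ _ => lexx _) (B_indep_U i) _ 0 _ 0 (Re_gcp i u1) Re0_le0 (Re_gamma_gcp i u1) Re0_le0
  (fun n => gamma_transform_U i n (Re_gcp i u1)) _.
rewrite !addr0; apply => n.
by rewrite /= cexpectation_cst !mulr0.
Qed.

Lemma joint_transform i l (u1 u2 : R[i]) : i != l -> cmod u1 <= 1 -> cmod u2 <= 1 ->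
  cexpectation P (fun w => u1 ^+ X i w * u2 ^+ X l w) =
  cexp (r%:C * mixture_exponent theta
    (gamma_exponent (a i) (gcp_exponent (k i) (lam i) u1) +
     gamma_exponent (a l) (gcp_exponent (k l) (lam l) u2))).
Proof.
move=> il u1_le1 u2_le1.
rewrite (joint_subordination il u1_le1 u2_le1 (Re_gcp i u1_le1) (Re_gcp l u2_le1)
  (gcpE i u1_le1) (gcpE l u2_le1)).
have := @mixture_transform _ _ _ P theta theta_gt0 theta_lt1 r (B r) (U i) (U l)
  r_ge0 measurable_B lawB (measurable_U i) (measurable_U l) (U_ge0 i)
  (U_ge0 l) (fun n => B_indep_UU n il) _ _ _ _ (Re_gcp i u1_le1) (Re_gcp l u2_le1)
  (Re_gamma_gcp i u1_le1) (Re_gamma_gcp l u2_le1)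
  (fun n => gamma_transform_U i n (Re_gcp i u1_le1))
  (fun n => gamma_transform_U l n (Re_gcp l u2_le1)).
by rewrite /mixture_exponent !addrA.
Qed.

Let cmod_real_le1 (v : R) : 0 <= v <= 1 -> cmod v%:C <= 1.
Proof. by move=> /andP[v0 v1]; rewrite cmod_real ger0_norm. Qed.

Let cexp_gcp_real i (v x : R) : cexp (x%:C * gcp_exponent (k i) (lam i) v%:C) =
  (expR (- (jump_exponent (k i) (lam i) v * x)))%:C.
Proof. by rewrite gcp_exponent_real -rmorphN -rmorphM cexp_real mulrN mulrC. Qed.

Let cexpectation_real (f : T -> R) : cexpectation P (fun w => (f w)%:C) =
  (\int[P]_w f w)%:C.
Proof. by rewrite cexpectationE cintegral_real. Qed.

Lemma marginal_laplace i (v : R) : 0 <= v <= 1 ->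
  \int[P]_w (v ^+ X i w) =
  \int[P]_w expR (- (jump_exponent (k i) (lam i) v * G i w)).
Proof.
move=> v01; have v1 := cmod_real_le1 v01.
have := marginal_subordination v1 (Re_gcp i v1) (gcpE i v1).
under eq_fun do rewrite -rmorphXn; under [X in _ = cexpectation _ X -> _]eq_fun do
  rewrite cexp_gcp_real.
by rewrite !cexpectation_real => /complexI.
Qed.

Lemma joint_laplace i l (v1 v2 : R) : i != l -> 0 <= v1 <= 1 -> 0 <= v2 <= 1 ->
  \int[P]_w (v1 ^+ X i w * v2 ^+ X l w) =
  \int[P]_w (expR (- (jump_exponent (k i) (lam i) v1 * G i w)) *
             expR (- (jump_exponent (k l) (lam l) v2 * G l w))).
Proof.
move=> il v1_01 v2_01; have u1 := cmod_real_le1 v1_01; have u2 := cmod_real_le1 v2_01.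
have := joint_subordination il u1 u2 (Re_gcp i u1) (Re_gcp l u2) (gcpE i u1) (gcpE l u2).
have -> : (fun w => v1%:C ^+ X i w * v2%:C ^+ X l w) =
    (fun w => (v1 ^+ X i w * v2 ^+ X l w)%:C).
  by apply/funext => w; rewrite rmorphM !rmorphXn.
have -> : (fun w => cexp ((G i w)%:C * gcp_exponent (k i) (lam i) v1%:C) *
      cexp ((G l w)%:C * gcp_exponent (k l) (lam l) v2%:C)) =
    (fun w => (expR (- (jump_exponent (k i) (lam i) v1 * G i w)) *
               expR (- (jump_exponent (k l) (lam l) v2 * G l w)))%:C).
  apply/funext => w; rewrite [RHS](rmorphM (real_complex R)).
  by congr (_ * _); exact: cexp_gcp_real.
by rewrite !cexpectation_real => /complexI.
Qed.

Let pmf_sum1 s : 0 <= s -> (\sum_(n <oo) (negative_binomial_pmf theta s n)%:E = 1)%E.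
Proof. by move=> s0; exact: (negative_binomial_pmf_sum1 nbB). Qed.

Let sum_scale (f : nat -> R) (y z : R) : (forall n, 0 <= f n) ->
  (\sum_(n <oo) (f n)%:E = y%:E)%E -> (\sum_(n <oo) (f n * z)%:E = (y * z)%:E)%E.
Proof.
move=> f0 fy; under eq_eseriesr do rewrite mulrC EFinM.
by rewrite nneseriesZl ?fy -?EFinM 1?mulrC// => n _; rewrite lee_fin.
Qed.

Let pmf_ge0 n : 0 <= negative_binomial_pmf theta r n.
Proof. exact: negative_binomial_pmf_ge0. Qed.

Let moment1_pmf (z : R) :
  (\sum_(n <oo) (negative_binomial_pmf theta r n * ((r + n%:R) * z))%:E =
   (r / (1 - theta) * z)%:E)%E.
Proof.
under eq_eseriesr do rewrite mulrA; apply: sum_scale.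
  by move=> n; rewrite mulr_ge0// addr_ge0.
exact: (negative_binomial_moment1 theta_gt0 theta_lt1 pmf_sum1 r_ge0).
Qed.

Lemma gamma_subordinator_mean i :
  (\int[P]_w (G i w)%:E = (r / (1 - theta) / a i)%:E)%E.
Proof.
have := @ge0_integral_mixture _ _ _ P theta r (B r) (U i) (fun _ => cst 0)
  measurable_B lawB (measurable_U i) (fun=> measurable_cst _) (B_indep_U i)
  (* The absolute value is a nonnegative stand-in for the identity, equal to it on the values of the
     clock. *)
  (fun x => `|x|) (cst 1) (fun n => (r + n%:R) / a i)
  (@normr_measurable R setT) (measurable_cst _) (@normr_ge0 _ _) (fun=> ler01) _.
rewrite moment1_pmf => <-.
  by apply: eq_integral => w _; rewrite mulr1 ger0_norm.
move=> n; rewrite [X in (_ * X)%E](@integral_cst _ _ _ P setT measurableT 1%E).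
rewrite /= probability_setT !mule1.
under eq_integral do rewrite ger0_norm//.
by rewrite (gamma_process_moment1 lambda_gt0 (a_gt0 i) (gammaZ i))// shifted_timeE.
Qed.

Lemma gamma_subordinator_moment2 i :
  (\int[P]_w (G i w ^+ 2)%:E = (r * (r + 1) / (1 - theta) ^+ 2 / a i ^+ 2)%:E)%E.
Proof.
have := @ge0_integral_mixture _ _ _ P theta r (B r) (U i) (fun _ => cst 0)
  measurable_B lawB (measurable_U i) (fun=> measurable_cst _) (B_indep_U i)
  (fun x => x ^+ 2) (cst 1) (fun n => (r + n%:R) * (r + n%:R + 1) / a i ^+ 2)
  (exprn_measurable 2) (measurable_cst _) (@sqr_ge0 _) (fun=> ler01) _.
under eq_eseriesr do rewrite mulrA.
rewrite (@sum_scale _ (r * (r + 1) / (1 - theta) ^+ 2)); last 2 first.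
- by move=> n; rewrite mulr_ge0// mulr_ge0// !addr_ge0.
- exact: (negative_binomial_moment2 theta_gt0 theta_lt1 pmf_sum1 r_ge0).
move=> <-; first by apply: eq_integral => w _; rewrite mulr1.
move=> n; rewrite [X in (_ * X)%E](@integral_cst _ _ _ P setT measurableT 1%E).
rewrite /= probability_setT !mule1.
by rewrite (gamma_process_moment2 lambda_gt0 (a_gt0 i) (gammaZ i))// shifted_timeE.
Qed.

(** On B = n the two gamma variables factorise, with means (r + n) / a i and (r + n) / a l.
    Subtracting the product of the means of the clocks leaves r theta / (a_i a_l (1 - theta)^2): the
    shared B is the source of the factor theta. *)
Lemma gamma_subordinator_cross_moment i l : i != l ->
  (\int[P]_w (G i w * G l w)%:E =
   ((r * (r + 1) / (1 - theta) ^+ 2 - r / (1 - theta)) / (a i * a l))%:E)%E.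
Proof.
move=> il; have := @ge0_integral_mixture _ _ _ P theta r (B r) (U i) (U l)
  measurable_B lawB (measurable_U i) (measurable_U l) (fun n => B_indep_UU n il)
  (fun x => `|x|) (fun x => `|x|) (fun n => (r + n%:R) ^+ 2 / (a i * a l))
  (@normr_measurable R setT) (@normr_measurable R setT) (@normr_ge0 _ _) (@normr_ge0 _ _) _.
under eq_eseriesr do rewrite mulrA.
rewrite (@sum_scale _ (r * (r + 1) / (1 - theta) ^+ 2 - r / (1 - theta))); last 2 first.
- by move=> n; rewrite mulr_ge0// sqr_ge0.
- exact: (negative_binomial_moment_sqr theta_gt0 theta_lt1 pmf_sum1 r_ge0).
move=> <-; first by apply: eq_integral => w _; rewrite !ger0_norm.
move=> n; under eq_integral do rewrite ger0_norm//.
under [X in (_ * X)%E]eq_integral do rewrite ger0_norm//.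
rewrite !(gamma_process_moment1 lambda_gt0 _ (gammaZ _))// shifted_timeE -EFinM.
by congr EFin; rewrite invfM; ring.
Qed.

Let ge0_integrable (f : T -> R) (y : R) : measurable_fun setT f ->
  (forall w, 0 <= f w) -> (\int[P]_w (f w)%:E = y%:E)%E ->
  P.-integrable setT (EFin \o f).
Proof.
move=> mf f0 fy; apply/integrableP; split; first exact/measurable_EFinP.
by under eq_integral do rewrite /= ger0_norm//; rewrite fy ltry.
Qed.

Let integral_scale (f : T -> R) (y c : R) : P.-integrable setT (EFin \o f) ->
  (\int[P]_w (f w)%:E = y%:E)%E -> (\int[P]_w (c * f w)%:E = (c * y)%:E)%E.
Proof.
by move=> fi fy; under eq_integral do rewrite EFinM; rewrite integralZl// fy.
Qed.

Let integrable_G i : P.-integrable setT (EFin \o G i).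
Proof. exact: ge0_integrable (measurable_G i) (G_ge0 i) (gamma_subordinator_mean i). Qed.

Let integrable_G2 i : P.-integrable setT (EFin \o (fun w => G i w ^+ 2)).
Proof.
apply: (ge0_integrable _ _ (gamma_subordinator_moment2 i)).
  exact: measurable_funX.
by move=> w; exact: sqr_ge0.
Qed.

Lemma time_changed_mean i : (\int[P]_w (X i w)%:R%:E =
  (jump_mean (k i) (lam i) * (r / (1 - theta) / a i))%:E)%E.
Proof.
rewrite (integral_count (@lam_gt0 i) (measurable_X i) (measurable_G i) (G_ge0 i)
  (@marginal_laplace i) (integrable_G i)).
exact: integral_scale (integrable_G i) (gamma_subordinator_mean i).
Qed.

Lemma time_changed_moment2 i : (\int[P]_w ((X i w)%:R ^+ 2)%:E =
  (jump_mean (k i) (lam i) ^+ 2 * (r * (r + 1) / (1 - theta) ^+ 2 / a i ^+ 2) +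
   jump_mean2 (k i) (lam i) * (r / (1 - theta) / a i))%:E)%E.
Proof.
rewrite (integral_count_sqr (@lam_gt0 i) (measurable_X i) (measurable_G i) (G_ge0 i)
  (@marginal_laplace i) (integrable_G i) (integrable_G2 i)).
under eq_integral do rewrite EFinD.
rewrite integralD//; last 2 first.
- exact: (integrableZl measurableT (jump_mean (k i) (lam i) ^+ 2) (integrable_G2 i)).
- exact: (integrableZl measurableT (jump_mean2 (k i) (lam i)) (integrable_G i)).
rewrite (integral_scale _ (integrable_G2 i) (gamma_subordinator_moment2 i)).
by rewrite (integral_scale _ (integrable_G i) (gamma_subordinator_mean i)) -EFinD.
Qed.

Lemma time_changed_cross_moment i l : i != l ->
  (\int[P]_w ((X i w)%:R * (X l w)%:R)%:E =
   (jump_mean (k i) (lam i) * jump_mean (k l) (lam l) *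
    ((r * (r + 1) / (1 - theta) ^+ 2 - r / (1 - theta)) / (a i * a l)))%:E)%E.
Proof.
move=> il.
have iGG : P.-integrable setT (EFin \o (fun w => G i w * G l w)).
  apply: (ge0_integrable _ _ (gamma_subordinator_cross_moment il)).
    exact: measurable_funM.
  by move=> w; exact: mulr_ge0.
rewrite (integral_countM (@lam_gt0 i) (@lam_gt0 l) (measurable_X i) (measurable_X l)
  (measurable_G i) (measurable_G l) (G_ge0 i) (G_ge0 l)
  (fun v1 v2 => @joint_laplace i l v1 v2 il) iGG).
exact: integral_scale iGG (gamma_subordinator_cross_moment il).
Qed.

Let Xr i w : R := (X i w)%:R.

Let measurable_Xr i : measurable_fun setT (Xr i).
Proof. exact: measurableT_comp (measurable_X i). Qed.

Let covariance_Xr i l (y : R) : (\int[P]_w (Xr i w * Xr l w)%:E = y%:E)%E ->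
  covariance P (Xr i) (Xr l) =
  (y - (jump_mean (k i) (lam i) * (r / (1 - theta) / a i)) *
       (jump_mean (k l) (lam l) * (r / (1 - theta) / a l)))%:E.
Proof.
move=> Ey.
have iX i' : P.-integrable setT (EFin \o Xr i').
  exact: ge0_integrable (measurable_Xr i') _ (time_changed_mean i').
have iXX : P.-integrable setT (EFin \o (Xr i * Xr l)).
  by apply: ge0_integrable Ey => [|w]; [exact: measurable_funM|exact: mulr_ge0].
rewrite covarianceE; [|exact/Lfun1_integrable|exact/Lfun1_integrable|exact/Lfun1_integrable].
rewrite unlock; have -> : (\int[P]_w ((Xr i * Xr l) w)%:E = y%:E)%E by exact: Ey.
by rewrite !time_changed_mean -EFinM -EFinB.
Qed.

Lemma covariance_time_changed i l : covariance P (Xr i) (Xr l) =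
    ((\sum_(1 <= j < (k i).+1) j%:R ^+ 2 * lam i j)
       * (lambda * t / (a i * (1 - theta))) * (i == l)%:R
     + (\sum_(1 <= j < (k i).+1) \sum_(1 <= m < (k l).+1)
          j%:R * m%:R * (lam i j * lam l m * lambda * t
                         / (a i * a l * (1 - theta) ^+ 2)))
       * (theta * (i != l)%:R + (i == l)%:R))%:E.
Proof.
have -> : \sum_(1 <= j < (k i).+1) j%:R ^+ 2 * lam i j = jump_mean2 (k i) (lam i).
  by apply: eq_bigr => j _; rewrite mulrC.
have -> : \sum_(1 <= j < (k i).+1) \sum_(1 <= m < (k l).+1)
      j%:R * m%:R * (lam i j * lam l m * lambda * t / (a i * a l * (1 - theta) ^+ 2)) =
    jump_mean (k i) (lam i) * jump_mean (k l) (lam l) *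
    (r / (a i * a l * (1 - theta) ^+ 2)).
  rewrite /jump_mean big_distrlr /= mulr_suml; apply: eq_bigr => j _.
  by rewrite mulr_suml; apply: eq_bigr => m _; rewrite /r; ring.
have theta1 : 1 - theta != 0 by rewrite subr_eq0 gt_eqF.
have ai0 := gt_eqF (a_gt0 i); have al0 := gt_eqF (a_gt0 l).
rewrite -/r; have [il|il] := eqVneq i l.
  (* For i = l the variance of the clock is r / (a i (1 - theta))^2, without theta, and the jumps
     add the term with [jump_mean2]. *)
  subst l; rewrite (covariance_Xr (time_changed_moment2 i)); congr EFin.
  rewrite /= mulr0 add0r !mulr1; move: (jump_mean _ _) (jump_mean2 _ _) => m v.
  by field; rewrite theta1 ai0.
rewrite (covariance_Xr (time_changed_cross_moment il)); congr EFin.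
rewrite /= mulr0 add0r mulr1 addr0.
move: (jump_mean (k i) _) (jump_mean (k l) _) => m1 m2.
by field; rewrite theta1 ai0 al0.
Qed.

Let expiu (u : R) : R[i] := cexp ('i%C * u%:C).
Let expNiu (u : R) : R[i] := cexp (- ('i%C * u%:C)).

Let cmod_expiu u : cmod (expiu u) <= 1.
Proof. by rewrite cmod_cexp ReM /= mul0r mulr0 subr0 expR0. Qed.

Let cmod_expNiu u : cmod (expNiu u) <= 1.
Proof. by rewrite cmod_cexp ReN ReM /= mul0r mulr0 subr0 oppr0 expR0. Qed.

Let ccontinuous_iu : ccontinuous (fun u : R => 'i%C * u%:C).
Proof.
split => u.
  by under eq_fun do rewrite ReM /= mul0r mulr0 subr0; exact: cst_continuous.
by under eq_fun do rewrite ImM /= mul0r mul1r add0r.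
Qed.

Let ccontinuous_gcp_exponent i (f : R -> R[i]) : ccontinuous f ->
  ccontinuous (fun u => gcp_exponent (k i) (lam i) (f u)).
Proof.
move=> cf; apply: ccontinuousN; apply: ccontinuous_sum => j.
apply: ccontinuousM; first exact: ccontinuous_cst.
apply: ccontinuousD; first exact: ccontinuous_cst.
by apply: ccontinuousN; exact: ccontinuousX.
Qed.

Let is_distinguished_log_exp (phi psi : R -> R[i]) : ccontinuous psi -> psi 0 = 0 ->
  (forall u, phi u = cexp (r%:C * psi u)) ->
  is_distinguished_log phi (fun u => r%:C * psi u).
Proof.
move=> cpsi psi0 e; have [cR cI] : ccontinuous (fun u => r%:C * psi u).
  by apply: ccontinuousM => //; exact: ccontinuous_cst.
by split; [exact: continuous_subspaceT|exact: continuous_subspaceT|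
  rewrite psi0 mulr0|move=> u _; rewrite e].
Qed.

Lemma codifference_time_changed i l :
  codifference P (Xr i) (Xr l) =
    r%:C
      * cln ((a i)%:C * (a l)%:C * (1 - theta%:C) /
          (((a i)%:C - gcp_exponent (k i) (lam i) (expiu 1)) *
           ((a l)%:C - gcp_exponent (k l) (lam l) (expNiu 1))
           - theta%:C * (a i)%:C * (a l)%:C))
      * (i != l)%:R
    - r%:C
      * cln ((a i)%:C * (a l)%:C * (1 - theta%:C) ^+ 2
             / (((a i)%:C * (1 - theta%:C) - gcp_exponent (k i) (lam i) (expiu 1)) *
                ((a l)%:C * (1 - theta%:C) - gcp_exponent (k l) (lam l) (expNiu 1)))).
Proof.
pose c1 u := gcp_exponent (k i) (lam i) (expiu u).
pose c2 u := gcp_exponent (k l) (lam l) (expNiu u).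
have cc1 : ccontinuous c1.
  by apply: ccontinuous_gcp_exponent; exact: ccontinuous_cexp.
have cc2 : ccontinuous c2.
  by apply: ccontinuous_gcp_exponent; apply: ccontinuous_cexp; exact: ccontinuousN.
have c1_le0 u : complex.Re (c1 u) <= 0 by apply: Re_gcp; exact: cmod_expiu.
have c2_le0 u : complex.Re (c2 u) <= 0 by apply: Re_gcp; exact: cmod_expNiu.
have c1_0 : c1 0 = 0 by rewrite /c1 /expiu mulr0 cexp0 gcp_exponent1.
have c2_0 : c2 0 = 0 by rewrite /c2 /expNiu mulr0 oppr0 cexp0 gcp_exponent1.
pose psi1 u := mixture_exponent theta (gamma_exponent (a i) (c1 u)).
pose psi2 u := mixture_exponent theta (gamma_exponent (a l) (c2 u)).
pose psi u := mixture_exponent theta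
  (gamma_exponent (a i) (c1 u) + gamma_exponent (a l) (c2 u)).
have expX u n : cexp ('i%C * (u * n%:R)%:C) = expiu u ^+ n.
  by rewrite -cexpMn; congr cexp; rewrite rmorphM rmorph_nat /=; ring.
have expNX u n : cexp ('i%C * (u * - n%:R)%:C) = expNiu u ^+ n.
  by rewrite -cexpMn; congr cexp; rewrite rmorphM rmorphN rmorph_nat /=; ring.
rewrite /codifference.
set L1 := cln (_ * _ * (1 - _) / _); set L2 := (X in _ - _ * X).
(* A purely analytic identity in c1 and c2, valid for i = l as well, where the indicator removes the
   term. *)
have eL1 : L1 = psi 1 by exact: cln_joint_exponent.
have eL2 : L2 = psi1 1 + psi2 1 by exact: cln_marginal_exponents.
rewrite eL1 eL2 {L1 L2 eL1 eL2}.
have -> : distinguished_ln (char_fun P (Xr i)) = r%:C * psi1 1.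
  apply: (distinguished_lnE (psi := fun u => r%:C * psi1 u)).
  apply: is_distinguished_log_exp.
  - exact: ccontinuous_marginal_exponent.
  - by rewrite /psi1 c1_0 gamma_exponent0// mixture_exponent0.
  - move=> u; rewrite /char_fun; under eq_fun do rewrite expX.
    exact: marginal_transform.
have -> : distinguished_ln (char_fun P (fun w => - Xr l w)) = r%:C * psi2 1.
  apply: (distinguished_lnE (psi := fun u => r%:C * psi2 u)).
  apply: is_distinguished_log_exp.
  - exact: ccontinuous_marginal_exponent.
  - by rewrite /psi2 c2_0 gamma_exponent0// mixture_exponent0.
  - move=> u; rewrite /char_fun; under eq_fun do rewrite expNX.
    exact: marginal_transform.
have [il|il] := eqVneq i l.
  (* For i = l the difference is identically 0: its characteristic function is 1 and its
     distinguished logarithm 0. *)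
  have -> : distinguished_ln (char_fun P (fun w => Xr i w - Xr l w)) = r%:C * 0.
    apply: (distinguished_lnE (psi := fun u => r%:C * 0)).
    apply: (@is_distinguished_log_exp _ (fun=> 0)) => //; first exact: ccontinuous_cst.
    move=> u; rewrite /char_fun il; under eq_fun do rewrite subrr mulr0 mulr0 cexp0.
    by rewrite cexpectation_cst mulr0 cexp0.
  by move: (psi 1) (psi1 1) (psi2 1) => z z1 z2; rewrite /= !mulr0 !sub0r mulrDr opprD.
have -> : distinguished_ln (char_fun P (fun w => Xr i w - Xr l w)) = r%:C * psi 1.
  apply: (distinguished_lnE (psi := fun u => r%:C * psi u)).
  apply: is_distinguished_log_exp.
  - exact: ccontinuous_joint_exponent.
  - by rewrite /psi c1_0 c2_0 !gamma_exponent0// addr0 mixture_exponent0.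
  - move=> u; rewrite /char_fun.
    (* The characteristic function of the difference is the joint generating function at exp(omega
       u) and exp(- omega u). *)
    under eq_fun do rewrite mulrBr -mulrN rmorphD mulrDr cexpD expX expNX.
    exact: joint_transform.
by move: (psi 1) (psi1 1) (psi2 1) => z z1 z2; rewrite mulr1 mulrDr opprD addrA.
Qed.

End time_changed_process.

Local Close Scope classical_set_scope.

Theorem proposition4p1 (d : measure_display) (T : measurableType d)
    (R : realType) (P : probability T R)
    (q : nat) (k : 'I_q -> nat) (lam : 'I_q -> nat -> R)
    (lambda theta : R) (a : 'I_q -> R)
    (M : 'I_q -> R -> T -> nat) (Z : 'I_q -> R -> T -> R) (B : R -> T -> nat)
    (lam_gt0 : forall (i : 'I_q) (j : nat), (1 <= j <= k i)%N -> 0 < lam i j)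
    (lambda_gt0 : 0 < lambda)
    (theta_gt0 : 0 < theta) (theta_lt1 : theta < 1)
    (a_gt0 : forall i : 'I_q, 0 < a i)
    (M_gcp : multivariate_gcp P k lam M)
    (ZB_data : gamma_subordinator_data P lambda theta a Z B)
    (MG_indep : independent P
       (sigma_mprocess (fun (i : 'I_q) (t : R) (w : T) => (M i t w)%:R))
       (sigma_mprocess (gamma_subordinator lambda Z B)))
    (i l : 'I_q) (t : R) (t_ge0 : 0 <= t) :
  let X := time_changed M (gamma_subordinator lambda Z B) in
  let ci : R[i] :=
    - \sum_(1 <= j < (k i).+1) (lam i j)%:C * (1 - cexp ('i%C * j%:R)) in
  let cl : R[i] :=
    - \sum_(1 <= j < (k l).+1) (lam l j)%:C * (1 - cexp (- ('i%C * j%:R))) in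
  let ai : R[i] := (a i)%:C in
  let al : R[i] := (a l)%:C in
  let th : R[i] := theta%:C in
  covariance P (X i t) (X l t) =
    ((\sum_(1 <= j < (k i).+1) j%:R ^+ 2 * lam i j)
       * (lambda * t / (a i * (1 - theta))) * (i == l)%:R
     + (\sum_(1 <= j < (k i).+1) \sum_(1 <= m < (k l).+1)
          j%:R * m%:R * (lam i j * lam l m * lambda * t
                         / (a i * a l * (1 - theta) ^+ 2)))
       * (theta * (i != l)%:R + (i == l)%:R))%:E
  /\
  codifference P (X i t) (X l t) =
    (lambda * t)%:C
      * cln (ai * al * (1 - th) / ((ai - ci) * (al - cl) - th * ai * al))
      * (i != l)%:R
    - (lambda * t)%:C
      * cln (ai * al * (1 - th) ^+ 2
             / ((ai * (1 - th) - ci) * (al * (1 - th) - cl))).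
Proof.
move=> X ci cl ai al th; split.
  exact: (covariance_time_changed lam_gt0 lambda_gt0 theta_gt0 theta_lt1 a_gt0
    M_gcp ZB_data MG_indep t_ge0 i l).
(* exp(omega j) = exp(omega)^j, so [ci] is the counting exponent at exp(omega), the endpoint u = 1
   of the curve. *)
have eci : ci = gcp_exponent (k i) (lam i) (cexp ('i%C * 1%:C)).
  rewrite /ci /gcp_exponent; congr (- _); apply: eq_bigr => j _.
  by rewrite -cexpMn [1%:C]rmorph1 mulr1 [j%:R * _]mulrC.
have ecl : cl = gcp_exponent (k l) (lam l) (cexp (- ('i%C * 1%:C))).
  rewrite /cl /gcp_exponent; congr (- _); apply: eq_bigr => j _.
  by rewrite -cexpMn [1%:C]rmorph1 mulr1 mulrN [j%:R * _]mulrC.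
rewrite eci ecl.
exact: (codifference_time_changed lam_gt0 lambda_gt0 theta_gt0 theta_lt1 a_gt0
  M_gcp ZB_data MG_indep t_ge0 i l).
Qed.
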